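(* Let $Q$ be a finite quiver and let $\Phi,\Psi\in\widetilde{\mathbb CQ}_{cyc}$ be two $\widetilde J$-finite analytic potentials of order $\ge3$. Then the following are equivalent: (1) There exists an $l$-algebra isomorphism $\gamma:\widetilde\Lambda(Q,\Phi)\cong\widetilde\Lambda(Q,\Psi)$ such that $\gamma_*([\Phi]_\Phi)=[\Psi]_\Psi$. (2) $\Phi$ and $\Psi$ are analytically right equivalent.
   Context: $l=\mathbb CQ_0$; $\widehat{\mathbb CQ}$ is the path algebra of $Q$ completed at the arrow ideal, with elements $\sum_wa_ww$ ($w$ paths, $|w|$ length); $\widetilde{\mathbb CQ}$ is the subalgebra of analytic series: those for which there is $C>0$ with $|a_w|\le C^{|w|}$ for all $w$ with $|w|$ sufficiently large. $\widetilde{\mathbb CQ}_{cyc}$ is the image of $\widetilde{\mathbb CQ}$ in $\widehat{\mathbb CQ}/[\widehat{\mathbb CQ},\widehat{\mathbb CQ}]^{cl}$ (quotient by the adic closure of the commutator space); its elements are analytic potentials; the order of a potential is the minimal length of a cyclic path with nonzero coefficient. For $a\in Q_1$, $D_a$ sends a cyclic path $c$ to $\sum_{c=uav}vu$. The analytic Jacobi ideal is $\widetilde J(Q,\Phi)=\{\sum_{a\in Q_1}\sum_{u,v}A^{(a)}_{u,v}\,u\,(D_a\Phi)\,v\}$, where $u,v$ run over paths and $|A^{(a)}_{u,v}|\le C^{|u|+|v|}$ for some $C>0$ and $|u|+|v|$ large. $\widetilde\Lambda(Q,\Phi)=\widetilde{\mathbb CQ}/\widetilde J(Q,\Phi)$;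 $\Phi$ is $\widetilde J$-finite if this is finite dimensional. $\widetilde\Lambda(Q,\Phi)_{cyc}$ is the quotient of $\widetilde{\mathbb CQ}_{cyc}$ by the image of $\widetilde J(Q,\Phi)$ (equal to $\widetilde\Lambda/[\widetilde\Lambda,\widetilde\Lambda]$ in the finite-dimensional case), $[\Phi]_\Phi$ is the class of $\Phi$ in it, and $\gamma_*$ is the map induced by $\gamma$ on these quotients. Two analytic potentials are analytically right equivalent if they lie in the same orbit of the group $\mathrm{Aut}_l(\widetilde{\mathbb CQ})$ of analytic $l$-algebra automorphisms. *)

(* Defs.v *)
From HB Require Import structures.
From mathcomp Require Import all_boot all_order all_algebra.
From mathcomp Require Import generic_quotient ring_quotient.
From mathcomp Require Import boolp classical_sets functions.

Set Implicit Arguments.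
Unset Strict Implicit.
Unset Printing Implicit Defensive.

Import Order.TTheory GRing.Theory Num.Theory.
Import Quotient.Exports.
Local Open Scope ring_scope.
Local Open Scope quotient_scope.

Record quiver := Quiver {
  vert : finType;
  arrow : finType;
  src : arrow -> vert;
  tgt : arrow -> vert }.

Section Paths.
Variable Q : quiver.
Implicit Types (i : vert Q) (w : seq (arrow Q)).

(* [walk i w] : the arrows of [w], read from left to right, can be traversed
   one after the other starting at the vertex [i]. *)
Fixpoint walk i w : bool :=
  if w is a :: w' then (src a == i) && walk (tgt a) w' else true.

Definition walk_end i w : vert Q := last i (map (@tgt Q) w).

(* A path is a starting vertex together with a walk from it; the starting
   vertex is what distinguishes the trivial paths. The product [u v] of two
   paths is "[u], then [v]". *)
Record qpath := QPath {
  pval : vert Q * seq (arrow Q);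
  pvalP : walk pval.1 pval.2 }.

HB.instance Definition _ := [isSub for pval].
HB.instance Definition _ := [Countable of qpath by <:].

Implicit Types p q : qpath.

Definition pstart p := (pval p).1.
Definition parrows p := (pval p).2.
Definition plen p := size (parrows p).
Definition pend p := walk_end (pstart p) (parrows p).
Definition cyclic p := pstart p == pend p.

Lemma walk_cat i w1 w2 :
  walk i (w1 ++ w2) = walk i w1 && walk (walk_end i w1) w2.
Proof. by elim: w1 i => //= a w1 IH i; rewrite IH andbA. Qed.

Lemma walk_end_cat i w1 w2 :
  walk_end i (w1 ++ w2) = walk_end (walk_end i w1) w2.
Proof. by rewrite /walk_end map_cat last_cat. Qed.

Lemma walk_take k p : walk (pstart p) (take k (parrows p)).
Proof.
by have := pvalP p; rewrite -/(pstart p) -/(parrows p)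
   -{1}(cat_take_drop k (parrows p)) walk_cat => /andP[].
Qed.

Lemma walk_drop k p :
  walk (walk_end (pstart p) (take k (parrows p))) (drop k (parrows p)).
Proof.
by have := pvalP p; rewrite -/(pstart p) -/(parrows p)
   -{1}(cat_take_drop k (parrows p)) walk_cat => /andP[].
Qed.

(* [p] is the product of [ptake k p], its first [k] arrows, and [pdrop k p];
   for [0 <= k <= plen p] these are all the factorizations [p = u v]. *)
Definition ptake k p : qpath :=
  @QPath (pstart p, take k (parrows p)) (walk_take k p).
Definition pdrop k p : qpath :=
  @QPath (walk_end (pstart p) (take k (parrows p)), drop k (parrows p))
    (walk_drop k p).

(* The rotation [v u] of a cyclic path [u v] with [u] of length [k]
   ([rot k (parrows p)] is always a walk when [p] is cyclic; on other paths
   the default value [p] may be returned). *)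
Definition prot k p : qpath :=
  insubd p (pend (ptake k p), rot k (parrows p)).

Definition rotations p : seq qpath :=
  undup [seq prot k p | k <- iota 0 (plen p).+1].

Lemma parrows_take k p : parrows (ptake k p) = take k (parrows p).
Proof. by []. Qed.

Lemma parrows_drop k p : parrows (pdrop k p) = drop k (parrows p).
Proof. by []. Qed.

Lemma pstart_drop k p :
  pstart (pdrop k p) = walk_end (pstart p) (take k (parrows p)).
Proof. by []. Qed.

Lemma qpath_eqP p q :
  pstart p = pstart q -> parrows p = parrows q -> p = q.
Proof.
move=> h1 h2; apply: val_inj; rewrite /= [pval p]surjective_pairing.
by rewrite [pval q]surjective_pairing; congr pair.
Qed.

Lemma plen_take k p : (k <= plen p)%N -> plen (ptake k p) = k.
Proof. by move=> h; rewrite /plen /= size_takel. Qed.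

Lemma plen_drop k p : plen (pdrop k p) = (plen p - k)%N.
Proof. by rewrite /plen /= size_drop. Qed.

Lemma ptake_take j k p : (j <= k)%N -> ptake j (ptake k p) = ptake j p.
Proof. by move=> h; apply: qpath_eqP => //=; rewrite /parrows /= take_takel. Qed.

Lemma pdrop_drop j k p : pdrop j (pdrop k p) = pdrop (k + j) p.
Proof.
apply: qpath_eqP; rewrite /pstart /parrows /=.
  by rewrite -walk_end_cat -takeD.
by rewrite drop_drop addnC.
Qed.

Lemma pdrop_take j k p : (j <= k)%N ->
  pdrop j (ptake k p) = ptake (k - j) (pdrop j p).
Proof.
move=> h; apply: qpath_eqP; rewrite /pstart /parrows /=.
  by rewrite take_takel.
by rewrite take_drop subnK.
Qed.

Lemma ptake_size p : ptake (plen p) p = p.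
Proof. by apply: qpath_eqP => //=; rewrite /parrows /= take_size. Qed.

Lemma pdrop0 p : pdrop 0 p = p.
Proof. by apply: qpath_eqP; rewrite /pstart /parrows /= ?take0 ?drop0. Qed.

Lemma short_paths N : exists s : seq qpath,
  forall p, (plen p < N)%N -> p \in s.
Proof.
have [s hs] : exists s : seq (seq (arrow Q)),
    forall w, (size w < N)%N -> w \in s.
  elim: N => [|N [s hs]]; first by exists [::].
  exists ([::] :: [seq a :: w | a <- enum (arrow Q), w <- s]).
  case=> [|a w] //=; rewrite ltnS => /hs wsP.
  by rewrite inE; apply/orP; right; apply: allpairs_f; rewrite ?mem_enum.
exists (pmap insub [seq (i, w) | i <- enum (vert Q), w <- s]) => p hp.
rewrite mem_pmap_sub; apply/allpairsP; exists (pval p).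
by rewrite mem_enum hs // -surjective_pairing.
Qed.

End Paths.

(* The formal series [sum_w (f w) w]. *)
Definition fseries (K : numClosedFieldType) (Q : quiver) : Type := qpath Q -> K.

Section FormalSeries.
Variables (K : numClosedFieldType) (Q : quiver).
Local Notation fser := (fseries K Q).
Implicit Types (f g h : fser) (p : qpath Q).

HB.instance Definition _ := GRing.Lmodule.copy fser (qpath Q -> K^o).

Definition fmul f g : fser :=
  fun p => \sum_(k < (plen p).+1) f (ptake k p) * g (pdrop k p).

(* The structure map [l -> fser], [c |-> sum_i (c i) e_i], where
   [l = K Q_0] is the algebra of functions on the vertices. *)
Definition fl (c : vert Q -> K) : fser :=
  fun p => if plen p == 0 then c (pstart p) else 0.

Lemma sum_exchange n (F : nat -> nat -> K) :
  \sum_(k < n.+1) \sum_(j < (n - k).+1) F k (k + j)%N =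
  \sum_(j < n.+1) \sum_(k < j.+1) F k j.
Proof.
have -> : \sum_(j < n.+1) \sum_(k < j.+1) F k j =
          \sum_(j < n.+1) \sum_(k < n.+1 | (k <= j)%N) F k j.
  apply: eq_bigr => j _.
  by rewrite (big_ord_widen n.+1 (fun k => F k j)).
rewrite (exchange_big_dep predT) //=; apply: eq_bigr => k _.
rewrite -(big_mkord xpredT (fun j => F k (k + j)%N)).
rewrite -(big_mkord (fun j => (k <= j)%N) (F k)).
have kn : (k <= n)%N by rewrite -ltnS.
rewrite [RHS](big_cat_nat _ (n := k)) ?leqW //=.
rewrite [X in _ = X + _](_ : _ = 0) ?add0r; last first.
  rewrite big_nat_cond big1 // => j /andP[/andP[_ jk]].
  by rewrite leqNgt jk.
rewrite [RHS]big_nat_cond.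
rewrite [RHS](eq_bigl (fun j => (k <= j < n.+1)%N && true)); last first.
  by move=> j; case: (k <= j)%N; rewrite ?andbT ?andbF.
rewrite -big_nat_cond.
rewrite [RHS](_ : _ = \sum_(0 + k <= j < n.+1) F k j) // big_addn subSn //.
by apply: eq_bigr => j _; rewrite addnC.
Qed.

Lemma fmulA : associative fmul.
Proof.
move=> f g h; apply/funext => p; rewrite /fmul.
pose F k j := f (ptake k p) *
  (g (ptake (j - k) (pdrop k p)) * h (pdrop j p)).
transitivity (\sum_(k < (plen p).+1) \sum_(j < (plen p - k).+1) F k (k + j)%N).
  apply: eq_bigr => k _; rewrite mulr_sumr plen_drop; apply: eq_bigr => j _.
  by rewrite /F addKn pdrop_drop.
rewrite sum_exchange; apply: eq_bigr => j _.
have jn : (j <= plen p)%N by rewrite -ltnS.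
rewrite mulr_suml plen_take //; apply: eq_bigr => k _.
have kj : (k <= j)%N by rewrite -ltnS.
by rewrite /F ptake_take // pdrop_take // mulrA.
Qed.

Lemma fl_mul c f p : fmul (fl c) f p = c (pstart p) * f p.
Proof.
rewrite /fmul big_ord_recl /= pdrop0 big1 ?addr0 /fl => [|k _].
  by rewrite plen_take.
by rewrite plen_take //= mul0r.
Qed.

Lemma fmul_l c f p : fmul f (fl c) p = f p * c (pend p).
Proof.
rewrite /fmul big_ord_recr /= ptake_size big1 ?add0r /fl => [|k _].
  by rewrite plen_drop subnn /= /pstart /= take_size.
by rewrite plen_drop subn_eq0 leqNgt ltn_ord mulr0.
Qed.

Lemma fmul1l : left_id (fl (fun=> 1)) fmul.
Proof. by move=> f; apply/funext => p; rewrite fl_mul mul1r. Qed.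

Lemma fmul1r : right_id (fl (fun=> 1)) fmul.
Proof. by move=> f; apply/funext => p; rewrite fmul_l mulr1. Qed.

Lemma fmulDl : left_distributive fmul +%R.
Proof.
move=> f g h; apply/funext => p; rewrite /fmul.
transitivity (\sum_(k < (plen p).+1) f (ptake k p) * h (pdrop k p) +
              \sum_(k < (plen p).+1) g (ptake k p) * h (pdrop k p)) => //.
by rewrite -big_split; apply: eq_bigr => k _; exact: mulrDl.
Qed.

Lemma fmulDr : right_distributive fmul +%R.
Proof.
move=> f g h; apply/funext => p; rewrite /fmul.
transitivity (\sum_(k < (plen p).+1) f (ptake k p) * g (pdrop k p) +
              \sum_(k < (plen p).+1) f (ptake k p) * h (pdrop k p)) => //.
by rewrite -big_split; apply: eq_bigr => k _; exact: mulrDr.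
Qed.

HB.instance Definition _ :=
  GRing.Zmodule_isPzRing.Build fser fmulA fmul1l fmul1r fmulDl fmulDr.

Lemma fserME f g p :
  (f * g) p = \sum_(k < (plen p).+1) f (ptake k p) * g (pdrop k p).
Proof. by []. Qed.
Lemma fserDE f g p : (f + g) p = f p + g p. Proof. by []. Qed.
Lemma fserNE f p : (- f) p = - f p. Proof. by []. Qed.
Lemma fserZE c f p : (c *: f) p = c * f p. Proof. by []. Qed.
Lemma fser0E p : (0 : fser) p = 0. Proof. by []. Qed.

Lemma fscale_l c f : c *: f = fl (fun=> c) * f.
Proof. by apply/funext => p; rewrite [RHS]fl_mul. Qed.

End FormalSeries.

Section Rotations.
Variable Q : quiver.
Implicit Types (p c : qpath Q).

Lemma walk_end_drop k p :
  walk_end (walk_end (pstart p) (take k (parrows p))) (drop k (parrows p)) =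
  pend p.
Proof. by rewrite -walk_end_cat cat_take_drop. Qed.

Lemma val_prot k c : cyclic c ->
  pval (prot k c) = (pend (ptake k c), rot k (parrows c)).
Proof.
move=> /eqP cc; rewrite /prot val_insubd /=.
by rewrite /rot walk_cat walk_drop /= walk_end_drop -cc walk_take.
Qed.

Lemma pstart_prot k c : cyclic c -> pstart (prot k c) = pend (ptake k c).
Proof. by move=> cc; rewrite /pstart val_prot. Qed.

Lemma parrows_prot k c : cyclic c -> parrows (prot k c) = rot k (parrows c).
Proof. by move=> cc; rewrite /parrows val_prot. Qed.

Lemma plen_prot k c : plen (prot k c) = plen c.
Proof.
rewrite /plen /parrows -/(val (prot k c)) /prot val_insubd.
by case: ifP => //=; rewrite size_rot.
Qed.

Lemma cyclic_prot k c : cyclic c -> cyclic (prot k c).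
Proof.
move=> cc; rewrite /cyclic /pend /pstart /parrows val_prot //= /rot.
by rewrite walk_end_cat walk_end_drop -(eqP cc).
Qed.

Lemma prot_eqP k c q : cyclic c ->
  pend (ptake k c) = pstart q -> rot k (parrows c) = parrows q ->
  prot k c = q.
Proof.
by move=> cc h1 h2; apply: qpath_eqP; rewrite /pstart /parrows val_prot.
Qed.

Lemma prot0 c : cyclic c -> prot 0 c = c.
Proof.
by move=> cc; apply: prot_eqP; rewrite ?rot0 // /pend [parrows (ptake _ _)]take0.
Qed.

Lemma prot_plen c : cyclic c -> prot (plen c) c = c.
Proof.
move=> cc; apply: prot_eqP; rewrite ?rot_size //.
by rewrite ptake_size -(eqP cc).
Qed.

Lemma protS k c : cyclic c -> (k < plen c)%N ->
  prot k.+1 c = prot 1 (prot k c).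
Proof.
move=> cc kc; have cc' := cyclic_prot k cc.
apply: prot_eqP => //; rewrite ?[RHS]/pstart ?[RHS]/parrows val_prot //=.
  rewrite /pend /pstart /parrows /= /pstart /parrows val_prot //= /rot takel_cat.
    by rewrite /pend /= -walk_end_cat -takeD addn1.
  by rewrite size_drop subn_gt0.
by rewrite /parrows val_prot //= rotS.
Qed.

Local Notation r := (prot 1).

Lemma iter_prot k c : cyclic c -> (k <= plen c)%N -> iter k r c = prot k c.
Proof.
move=> cc; elim: k => [|k IH] h; first by rewrite prot0.
by rewrite iterS IH ?(ltnW h) // -protS.
Qed.

Lemma iter_plen c : cyclic c -> iter (plen c) r c = c.
Proof. by move=> cc; rewrite iter_prot ?prot_plen. Qed.

Lemma plen_iter k c : plen (iter k r c) = plen c.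
Proof. by elim: k => //= k <-; rewrite plen_prot. Qed.

Lemma cyclic_iter k c : cyclic c -> cyclic (iter k r c).
Proof. by move=> cc; elim: k => //= k; exact: cyclic_prot. Qed.

Lemma iterC j k c : iter j r (iter k r c) = iter k r (iter j r c).
Proof. by rewrite -!iterD addnC. Qed.

Lemma sum_shift (M : nmodType) (H : qpath Q -> M) j c : cyclic c ->
  \sum_(k < plen c) H (iter k r (iter j r c)) =
  \sum_(k < plen c) H (iter k r c).
Proof.
move=> cc; elim: j => [//|j <-]; rewrite iterS.
have := iter_plen (cyclic_iter j cc); rewrite plen_iter.
set d := iter j r c; case: (plen c) => [|n] dn; first by rewrite !big_ord0.
rewrite big_ord_recr big_ord_recl /= addrC -iterSr dn; congr (_ + _).
by apply: eq_bigr => k _; rewrite -iterSr.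
Qed.

Lemma take_prot j c : cyclic c -> (j <= plen c)%N ->
  ptake (plen c - j) (prot j c) = pdrop j c.
Proof.
move=> cc jc; apply: qpath_eqP.
  by rewrite [LHS](pstart_prot j cc).
rewrite parrows_take parrows_prot // /rot take_size_cat //.
by rewrite size_drop.
Qed.

Lemma drop_prot j c : cyclic c -> (j <= plen c)%N ->
  pdrop (plen c - j) (prot j c) = ptake j c.
Proof.
move=> cc jc; apply: qpath_eqP.
  rewrite pstart_drop pstart_prot //.
  rewrite parrows_prot // /rot take_size_cat ?size_drop //.
  by rewrite [LHS]walk_end_drop -(eqP cc).
rewrite parrows_drop parrows_prot // /rot drop_size_cat //.
by rewrite size_drop.
Qed.

Lemma count_rotations c q : cyclic c ->
  q \in [seq iter k r c | k <- iota 0 (plen c)] ->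
  count_mem q [seq iter k r c | k <- iota 0 (plen c)] =
  count_mem c [seq iter k r c | k <- iota 0 (plen c)].
Proof.
move=> cc /mapP[k0 k0n ->].
have c0 : (0 < plen c)%N.
  by move: k0n; rewrite mem_iota add0n => /andP[_]; exact: leq_trans.
have E d : count_mem d [seq iter k r c | k <- iota 0 (plen c)] =
    (\sum_(k < plen c) (iter k r c == d))%N.
  rewrite -sum1_count big_map big_mkcond /=.
  rewrite -(big_mkord xpredT (fun k => nat_of_bool (iter k r c == d))).
  by rewrite /index_iota subn0; apply: eq_bigr => k _; case: eqP.
rewrite !E.
apply: etrans (esym (sum_shift (fun q => (q == iter k0 r c) : nat) k0 cc)) _.
apply: eq_bigr => k _; congr nat_of_bool.
rewrite /= iterC; apply/eqP/eqP => [|->//].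
have inj (d e : qpath Q) : cyclic d -> cyclic e -> plen d = plen c -> plen e = plen c ->
    r d = r e -> d = e.
  move=> cd ce dc ec rde; rewrite -(iter_plen cd) -(iter_plen ce) dc ec.
  by rewrite -(prednK c0) !iterSr rde.
elim: k0 {k0n} => [//|k0 IH] /= h; apply: IH; apply: inj h.
- by rewrite !cyclic_iter.
- by rewrite !cyclic_iter.
- by rewrite !plen_iter.
- by rewrite !plen_iter.
Qed.

End Rotations.

Section Growth.
Variable K : numClosedFieldType.

(* [f] is a family of coefficients indexed by objects having a size, and
   [|f x| <= C ^ (sz x)] for some [C > 0] as soon as [sz x] is large. (In a
   [numClosedFieldType], [0 < C] forces [C] to be real.) *)
Definition growth (T : Type) (sz : T -> nat) (f : T -> K) : Prop :=
  exists2 C : K, 0 < C &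
    exists N, forall x, (N <= sz x)%N -> `|f x| <= C ^+ sz x.

Lemma growthB T (sz : T -> nat) f g :
  growth sz f -> growth sz g -> growth sz (fun x => f x - g x).
Proof.
move=> [C C0 [N hN]] [D D0 [M hM]]; exists (C + D); first exact: addr_gt0.
exists (maxn N M).+1 => x hx.
have pow n : (0 < n)%N -> C ^+ n + D ^+ n <= (C + D) ^+ n.
  case: n => // n _; elim: n => [|n IH]; first by rewrite !expr1.
  have C1 := ltW C0; have D1 := ltW D0.
  rewrite (exprS (C + D)) mulrDl !(exprS _ n.+1); apply: lerD.
    apply: ler_wpM2l => //; apply: le_trans IH.
    by rewrite lerDl exprn_ge0.
  apply: ler_wpM2l => //; apply: le_trans IH.
  by rewrite lerDr exprn_ge0.
apply: le_trans (ler_normB _ _) _; apply: le_trans (pow _ _); last first.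
  exact: leq_ltn_trans hx.
apply: lerD; [apply: hN|apply: hM]; apply: leq_trans (ltnW hx).
  exact: leq_maxl.
exact: leq_maxr.
Qed.

Lemma growth_of T (sz : T -> nat) f (C M : K) : 1 <= C -> 0 <= M ->
  (forall x, `|f x| <= (sz x).+1%:R * M * C ^+ sz x) -> growth sz f.
Proof.
move=> C1 M0 h; have C0 : 0 <= C by exact: le_trans C1.
exists (2%:R * (1 + M) * C).
  by rewrite !mulr_gt0 ?(lt_le_trans _ C1) // ltr_wpDr.
exists 1%N => x hx; apply: le_trans (h x) _.
rewrite !exprMn ler_wpM2r ?exprn_ge0 // ler_pM ?ler0n //.
  by rewrite -natrX ler_nat ltn_expl.
case: (sz x) hx => // n _; rewrite exprS -[leLHS]mulr1.
apply: ler_pM => //; first by rewrite lerDr.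
by rewrite exprn_ege1 // lerDl.
Qed.

Lemma growth_all (T : eqType) (sz : T -> nat) f :
  (forall N, exists s : seq T, forall x, (sz x < N)%N -> x \in s) ->
  growth sz f -> exists2 C : K, 1 <= C &
    exists2 M, 0 <= M & forall x, `|f x| <= M * C ^+ sz x.
Proof.
move=> fin [C C0 [N hN]]; have [s hs] := fin N.
exists (C + 1); first by rewrite lerDr ltW.
exists (1 + \sum_(x <- s) `|f x|).
  by rewrite addr_ge0 // sumr_ge0.
move=> x; have [Nx|xN] := leqP N (sz x).
  have C1 := ltW C0; apply: le_trans (hN x Nx) _; rewrite -[leLHS]mul1r.
  apply: ler_pM => //; rewrite ?exprn_ge0 //.
    by rewrite lerDl sumr_ge0.
  by rewrite lerXn2r ?nnegrE ?addr_ge0 // lerDl.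
rewrite -[leLHS]mulr1 ler_pM //; last by rewrite exprn_ege1 // lerDr ltW.
rewrite (perm_big _ (perm_to_rem (hs x xN))) big_cons addrCA lerDl.
by rewrite addr_ge0 // sumr_ge0.
Qed.

Lemma growth_conv (T1 T2 : eqType) (T : Type) (sz1 : T1 -> nat)
    (sz2 : T2 -> nat) (sz : T -> nat) (f : T1 -> K) (g : T2 -> K)
    (al : nat -> T -> T1) (be : nat -> T -> T2) (m : T -> nat) :
  (forall N, exists s : seq T1, forall x, (sz1 x < N)%N -> x \in s) ->
  (forall N, exists s : seq T2, forall x, (sz2 x < N)%N -> x \in s) ->
  (forall x, (m x <= sz x)%N) ->
  (forall x k, (k <= m x)%N -> (sz1 (al k x) + sz2 (be k x) = sz x)%N) ->
  growth sz1 f -> growth sz2 g ->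
  growth sz (fun x => \sum_(k < (m x).+1) f (al k x) * g (be k x)).
Proof.
move=> fin1 fin2 mz szE /(growth_all fin1)[C C1 [M M0 hf]].
move=> /(growth_all fin2)[D D1 [L L0 hg]].
have C0 : 0 <= C by exact: le_trans C1.
have D0 : 0 <= D by exact: le_trans D1.
apply: (@growth_of _ _ _ (C * D) (M * L)).
- by rewrite -[leLHS]mulr1 ler_pM.
- exact: mulr_ge0.
move=> x; apply: le_trans (ler_norm_sum _ _ _) _.
apply: le_trans (_ : \sum_(k < (m x).+1) (M * L) * (C * D) ^+ sz x <= _).
  apply: ler_sum => k _; rewrite normrM.
  apply: le_trans (ler_pM _ _ (hf _) (hg _)) _ => //.
  rewrite mulrACA ler_wpM2l ?mulr_ge0 // exprMn ler_pM ?exprn_ge0 //.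
    by rewrite ler_weXn2l // -(szE x k) ?leq_addr // -ltnS.
  by rewrite ler_weXn2l // -(szE x k) ?leq_addl // -ltnS.
rewrite sumr_const card_ord -[leLHS]mulr_natl -[leRHS]mulrA ler_wpM2r //.
  by rewrite mulr_ge0 ?mulr_ge0 ?exprn_ge0 ?mulr_ge0.
by rewrite ler_nat ltnS.
Qed.

End Growth.

Section AnalyticSeries.
Variables (K : numClosedFieldType) (Q : quiver).
Local Notation fser := (fseries K Q).

Definition analytic : {pred fser} := fun f => `[< growth (@plen Q) f >].

Lemma analytic_fl c : fl c \in analytic.
Proof.
apply/asboolP; exists 1 => //; exists 1%N => p hp; rewrite /fl.
by case: (plen p) hp => // n _; rewrite normr0 expr1n ler01.
Qed.

Lemma analyticM f g : f \in analytic -> g \in analytic -> f * g \in analytic.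
Proof.
move=> /asboolP hf /asboolP hg; apply/asboolP.
apply: (growth_conv (al := @ptake Q) (be := @pdrop Q)) hf hg => //.
- exact: short_paths.
- exact: short_paths.
- by move=> p k kp; rewrite plen_take // plen_drop subnKC.
Qed.

Lemma analytic_subring : subring_closed analytic.
Proof.
split; [exact: analytic_fl| |exact: analyticM].
by move=> f g /asboolP hf /asboolP hg; apply/asboolP; exact: growthB.
Qed.

Lemma analytic_scale : GRing.scaler_closed analytic.
Proof.
by move=> a f hf; rewrite fscale_l; apply: analyticM => //; exact: analytic_fl.
Qed.

HB.instance Definition _ :=
  GRing.isSubringClosed.Build fser analytic analytic_subring.
HB.instance Definition _ :=
  GRing.isScaleClosed.Build K fser analytic analytic_scale.

Record aseries := ASeries { aval : fser; avalP : aval \in analytic }.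

HB.instance Definition _ := [isSub for aval].
HB.instance Definition _ := [Choice of aseries by <:].
HB.instance Definition _ :=
  GRing.SubChoice_isSubPzRing.Build fser analytic aseries analytic_subring.
HB.instance Definition _ := [SubZmodule_isSubLmodule of aseries by <:].

Definition al (c : vert Q -> K) : aseries := ASeries (analytic_fl c).

End AnalyticSeries.

Section Potentials.
Variables (K : numClosedFieldType) (Q : quiver).
Local Notation fser := (fseries K Q).
Implicit Types (f g h : fser) (p c : qpath Q) (a : arrow Q).

Definition commutator_sum f : Prop := exists s : seq (fser * fser),
  f = \sum_(x <- s) (x.1 * x.2 - x.2 * x.1).

(* The closure of the commutator space for the adic topology: [f] is, modulo
   the [N]-th power of the arrow ideal, a sum of commutators, for every [N]. *)
Definition comm_closure : {pred fser} := fun f =>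
  `[< forall N, exists2 g, commutator_sum g &
        forall p, (plen p < N)%N -> f p = g p >].

Lemma comm_closure_zmod : zmod_closed comm_closure.
Proof.
split=> [|f g /asboolP hf /asboolP hg]; apply/asboolP => N.
  by exists 0 => //; exists [::]; rewrite big_nil.
have [f' [s ->] ff'] := hf N; have [g' [t ->] gg'] := hg N.
exists (\sum_(x <- s) (x.1 * x.2 - x.2 * x.1) -
        \sum_(x <- t) (x.1 * x.2 - x.2 * x.1)); last first.
  by move=> p pN; rewrite !fserDE !fserNE ff' // gg'.
exists (s ++ [seq (x.2, x.1) | x <- t]); rewrite big_cat big_map /=.
congr (_ + _); rewrite -sumrN; apply: eq_bigr => x _.
by rewrite opprB.
Qed.

HB.instance Definition _ :=
  GRing.isZmodClosed.Build fser comm_closure comm_closure_zmod.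

(* The quotient of [fser] in which [potential] is the image of [aseries]. *)
Definition fpot : zmodType :=
  Quotient.quot (comm_closure : zmodClosed fser).

Definition fclass f : fpot := \pi_fpot f.

Definition analytic_pot : {pred fpot} := fun x =>
  `[< exists f : aseries K Q, x = fclass (aval f) >].

Lemma analytic_pot_zmod : zmod_closed analytic_pot.
Proof.
split=> [|x y /asboolP[f ->] /asboolP[g ->]]; apply/asboolP.
  by exists 0; rewrite /fclass (raddf0 (\pi_fpot)).
by exists (f - g); rewrite /fclass -raddfB.
Qed.

HB.instance Definition _ :=
  GRing.isZmodClosed.Build fpot analytic_pot analytic_pot_zmod.

Record potential := Potential { potval : fpot; potvalP : potval \in analytic_pot }.

HB.instance Definition _ := [isSub for potval].
HB.instance Definition _ := [Choice of potential by <:].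
HB.instance Definition _ := [SubChoice_isSubZmodule of potential by <:].

Lemma aclass_subproof (f : aseries K Q) : fclass (aval f) \in analytic_pot.
Proof. by apply/asboolP; exists f. Qed.

Definition aclass (f : aseries K Q) : potential :=
  Potential (aclass_subproof f).

Lemma fclass_eq f g : fclass f = fclass g -> f - g \in comm_closure.
Proof. by move=> h; rewrite Quotient.idealrBE; apply/eqP. Qed.

(* The coefficient of the class of the cyclic path [c], two cyclic paths being
   identified when they are rotations of each other. *)
Definition fcyc_coef f c : K := \sum_(q <- rotations c) f q.

Definition rotsum f c : K := \sum_(k < plen c) f (iter k (prot 1) c).

Lemma rotsumM f g c : cyclic c -> rotsum (f * g) c = rotsum (g * f) c.
Proof.
move=> cc; rewrite /rotsum.
pose G j q := g (ptake (plen c - j) q) * f (pdrop (plen c - j) q).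
transitivity (\sum_(k < plen c) \sum_(j < (plen c).+1)
    G j (iter k (prot 1) (iter j (prot 1) c))).
  apply: eq_bigr => k _; rewrite fserME plen_iter; apply: eq_bigr => j _.
  have ci := cyclic_iter k cc; have pi := plen_iter k c.
  have jn : (j <= plen (iter k (prot 1) c))%N by rewrite pi -ltnS.
  rewrite -iterC (iter_prot ci) // /G.
  have := take_prot ci jn; have := drop_prot ci jn; rewrite pi => -> ->.
  exact: mulrC.
rewrite exchange_big /=.
transitivity (\sum_(j < (plen c).+1) \sum_(k < plen c) G j (iter k (prot 1) c)).
  by apply: eq_bigr => j _; exact: sum_shift.
rewrite exchange_big /=; apply: eq_bigr => k _.
rewrite fserME plen_iter (reindex_inj rev_ord_inj) /=.
by apply: eq_bigr => j _; rewrite /G subSS subKn // -ltnS.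
Qed.

Lemma rotsum_closure f c : f \in comm_closure -> cyclic c -> rotsum f c = 0.
Proof.
move=> /asboolP/(_ (plen c).+1)[_ [s ->] h] cc.
transitivity (rotsum (\sum_(x <- s) (x.1 * x.2 - x.2 * x.1)) c).
  by apply: eq_bigr => k _; rewrite h // plen_iter.
have rotsumB u v : rotsum (u - v) c = rotsum u c - rotsum v c.
  by rewrite /rotsum -sumrB; apply: eq_bigr.
have rotsumD u v : rotsum (u + v) c = rotsum u c + rotsum v c.
  by rewrite /rotsum -big_split; apply: eq_bigr.
elim: s {h} => [|x s IH]; first by rewrite big_nil; exact: big1.
by rewrite big_cons rotsumD IH rotsumB rotsumM // subrr addr0.
Qed.

Lemma rotsum_coef f c : cyclic c -> (0 < plen c)%N ->
  exists2 m, (0 < m)%N & rotsum f c = fcyc_coef f c *+ m.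
Proof.
move=> cc c0; pose s := [seq iter k (prot 1) c | k <- iota 0 (plen c)].
have cs : c \in s.
  by apply/mapP; exists 0 => //; rewrite mem_iota.
exists (count_mem c s); first by rewrite -has_count has_pred1.
have -> : fcyc_coef f c = \sum_(q <- undup s) f q.
  apply: perm_big; apply: uniq_perm; rewrite ?undup_uniq // => q.
  rewrite !mem_undup; apply/mapP/mapP => -[k]; rewrite mem_iota add0n.
    move=> /andP[_]; rewrite ltnS leq_eqVlt => /orP[/eqP ->|kn] ->.
      by rewrite prot_plen //; exists 0; rewrite // mem_iota.
    by exists k; rewrite ?mem_iota // iter_prot // ltnW.
  move=> /andP[_ kn] ->; exists k; last by rewrite iter_prot // ltnW.
  by rewrite mem_iota add0n ltnS; exact: ltnW.
rewrite -sumrMnl; transitivity (\sum_(q <- s) f q).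
  by rewrite big_map /rotsum -(big_mkord xpredT (fun k => f (iter k (prot 1) c)))
    /index_iota subn0.
rewrite -big_undup_iterop_count; apply: eq_big_seq => q.
by rewrite mem_undup => /(count_rotations cc) ->.
Qed.

Lemma fcyc_coef_closure f c : f \in comm_closure -> cyclic c ->
  fcyc_coef f c = 0.
Proof.
move=> fK cc; case: (posnP (plen c)) => [c0|cpos]; last first.
  have [m m0 h] := rotsum_coef f cc cpos; apply/eqP.
  have := rotsum_closure fK cc; rewrite h => /eqP.
  by rewrite mulrn_eq0 (gtn_eqF m0).
rewrite /fcyc_coef /rotations c0 /= prot0 // big_seq1.
move: fK => /asboolP/(_ 1%N)[_ [s ->] -> ]; last by rewrite c0.
elim: s => [|x s IH]; rewrite ?big_nil // big_cons fserDE IH addr0.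
rewrite fserDE fserNE !fserME c0 !big_ord1.
have -> : pdrop 0 c = ptake 0 c; last by rewrite mulrC subrr.
rewrite pdrop0; apply: qpath_eqP => //; rewrite parrows_take take0.
by move: c0; rewrite /plen; case: (parrows c).
Qed.

(* On classes; the choice of the representative is irrelevant by
   [cyc_coefE]. *)
Definition cyc_coef (x : fpot) c : K := fcyc_coef (repr x) c.

Lemma fclass_repr (x : fpot) : fclass (repr x) = x.
Proof. exact: reprK. Qed.

Lemma cyc_coefE f c : cyclic c -> cyc_coef (fclass f) c = fcyc_coef f c.
Proof.
move=> cc; apply/eqP; rewrite -subr_eq0 /cyc_coef /fcyc_coef -sumrB.
apply/eqP; apply: (fcyc_coef_closure (fclass_eq _) cc).
exact: fclass_repr.
Qed.

(* [x] has order at least [n] (the order of [0] being infinite). *)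
Definition order_ge (n : nat) (x : potential) : Prop :=
  forall c, cyclic c -> (plen c < n)%N -> cyc_coef (potval x) c = 0.

Definition fcoef f (x : vert Q * seq (arrow Q)) : K := oapp f 0 (insub x).

(* The cyclic derivative along [a], i.e. the continuous linear map sending a
   cyclic path [c] to [sum_(c = u a v) v u]: the coefficient of [p] is the sum
   of the coefficients of the cyclic paths [u a v] over the factorizations
   [p = v u], where [v = ptake k p] and [u = pdrop k p]. It is zero unless [p]
   goes from the target to the source of [a]. *)
Definition fder a f : fser := fun p =>
  if (pstart p == tgt a) && (pend p == src a) then
    \sum_(k < (plen p).+1)
      fcoef f (pstart (pdrop k p),
               parrows (pdrop k p) ++ a :: parrows (ptake k p))
  else 0.

Lemma fder_closure a f : f \in comm_closure -> fder a f = 0.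
Proof.
move=> fK; apply/funext => p; rewrite /fder fser0E.
case: ifP => // /andP[/eqP ps /eqP pt].
have wP : walk (pstart p) (parrows p ++ [:: a]).
  by rewrite walk_cat (pvalP p) /= -/(pend p) pt eqxx.
pose c := @QPath Q (pstart p, parrows p ++ [:: a]) wP.
have cc : cyclic c.
  by rewrite /cyclic /pend /pstart /parrows /= walk_end_cat /= ps.
have lc : plen c = (plen p).+1 by rewrite /plen /= size_cat addn1.
rewrite -[RHS](rotsum_closure fK cc) /rotsum lc; apply: eq_bigr => k _.
have kn : (k <= plen p)%N by rewrite -ltnS.
rewrite iter_prot ?lc 1?ltnW //.
rewrite /fcoef (_ : (_, _) = pval (prot k c)) ?valK //.
rewrite val_prot // /rot /= drop_cat take_cat -/(plen p).
congr pair; first by rewrite /pend /= /parrows /= takel_cat.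
case: ltnP => kp; first by rewrite -catA.
have -> : k = plen p :> nat by apply/eqP; rewrite eqn_leq kn.
by rewrite subnn /= cats0 !parrows_drop drop_size /= parrows_take take_size.
Qed.

Lemma fderB a f g : fder a (f - g) = fder a f - fder a g.
Proof.
apply/funext => p; rewrite fserDE fserNE /fder.
case: ifP => _; last by rewrite subrr.
rewrite -sumrB; apply: eq_bigr => k _; rewrite /fcoef.
by case: insub => //=; rewrite subrr.
Qed.

(* On classes; the choice of the representative is irrelevant by [derE]. *)
Definition der a (x : fpot) : fser := fder a (repr x).

Lemma derE a f : der a (fclass f) = fder a f.
Proof.
apply/eqP; rewrite -subr_eq0 -fderB fder_closure //.
by apply: fclass_eq; exact: fclass_repr.
Qed.

End Potentials.

Section Jacobi.
Variables (K : numClosedFieldType) (Q : quiver).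
Local Notation fser := (fseries K Q).
Local Notation aser := (aseries K Q).
Implicit Types (f g h : fser) (p : qpath Q) (a : arrow Q).
Implicit Types (A B : arrow Q -> qpath Q * qpath Q -> K).

(* [sum_a sum_(u, v) (A a (u, v)) u (D a) v], where the coefficient of [p]
   collects the factorizations [p = u w v], with [u = ptake i p],
   [w = pdrop i (ptake j p)] and [v = pdrop j p]. *)
Definition jcomb (D : arrow Q -> fser) A : fser := fun p =>
  \sum_a \sum_(j < (plen p).+1) \sum_(i < j.+1)
    A a (ptake i p, pdrop j p) * D a (pdrop i (ptake j p)).

Definition lslice A a (v : qpath Q) : fser := fun u => A a (u, v).
Definition rslice A a (u : qpath Q) : fser := fun v => A a (u, v).

Definition biplen (uv : qpath Q * qpath Q) : nat := plen uv.1 + plen uv.2.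

Lemma short_bipaths N : exists s : seq (qpath Q * qpath Q),
  forall uv, (biplen uv < N)%N -> uv \in s.
Proof.
have [s hs] := @short_paths Q N; exists [seq (u, v) | u <- s, v <- s].
move=> [u v] uvN; apply/allpairsP; exists (u, v); split=> //; apply: hs.
  exact: leq_ltn_trans (leq_addr _ _) uvN.
exact: leq_ltn_trans (leq_addl _ _) uvN.
Qed.

Lemma jcombE D A p : jcomb D A p =
  \sum_a \sum_(j < (plen p).+1)
     (lslice A a (pdrop j p) * D a) (ptake j p).
Proof.
apply: eq_bigr => a _; apply: eq_bigr => j _; rewrite fserME.
have jn : (j <= plen p)%N by rewrite -ltnS.
rewrite plen_take //; apply: eq_bigr => i _.
by rewrite ptake_take // -ltnS.
Qed.

Lemma jcombE' D A p : jcomb D A p =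
  \sum_a \sum_(i < (plen p).+1)
     (D a * rslice A a (ptake i p)) (pdrop i p).
Proof.
apply: eq_bigr => a _.
pose F i j := A a (ptake i p, pdrop j p) * D a (pdrop i (ptake j p)).
rewrite -(sum_exchange (plen p) F); apply: eq_bigr => i _.
rewrite fserME plen_drop; apply: eq_bigr => j _.
rewrite /F pdrop_drop pdrop_take ?leq_addr // addKn; exact: mulrC.
Qed.

Lemma jcombB D A B : jcomb D (fun a x => A a x - B a x) = jcomb D A - jcomb D B.
Proof.
apply/funext => p; rewrite fserDE fserNE -sumrB; apply: eq_bigr => a _.
rewrite -sumrB; apply: eq_bigr => j _; rewrite -sumrB; apply: eq_bigr => i _.
exact: mulrBl.
Qed.

Lemma jcombMl D A f :
  f * jcomb D A = jcomb D (fun a uv => (f * lslice A a uv.2) uv.1).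
Proof.
apply/funext => p; rewrite jcombE fserME.
under eq_bigr do rewrite jcombE mulr_sumr.
rewrite exchange_big; apply: eq_bigr => a _ /=.
pose F k j := f (ptake k p) *
  (lslice A a (pdrop j p) * D a) (pdrop k (ptake j p)).
transitivity (\sum_(k < (plen p).+1) \sum_(j < (plen p - k).+1) F k (k + j)%N).
  apply: eq_bigr => k _; rewrite mulr_sumr plen_drop; apply: eq_bigr => j _.
  by rewrite /F pdrop_drop pdrop_take ?leq_addr // addKn.
rewrite sum_exchange; apply: eq_bigr => j _.
have jn : (j <= plen p)%N by rewrite -ltnS.
rewrite [X in X * D a](_ : _ = f * lslice A a (pdrop j p)) // -mulrA.
rewrite [RHS]fserME plen_take //; apply: eq_bigr => k _.
by rewrite /F ptake_take // -ltnS.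
Qed.

Lemma jcombMr D A f :
  jcomb D A * f = jcomb D (fun a uv => (rslice A a uv.1 * f) uv.2).
Proof.
apply/funext => p; rewrite jcombE' fserME.
under eq_bigr do rewrite jcombE' mulr_suml.
rewrite exchange_big; apply: eq_bigr => a _ /=.
pose F i m := (D a * rslice A a (ptake i p)) (pdrop i (ptake m p)) *
  f (pdrop m p).
transitivity (\sum_(m < (plen p).+1) \sum_(i < m.+1) F i m).
  apply: eq_bigr => m _; have mn : (m <= plen p)%N by rewrite -ltnS.
  rewrite mulr_suml plen_take //; apply: eq_bigr => i _.
  by rewrite /F ptake_take // -ltnS.
rewrite -sum_exchange; apply: eq_bigr => i _.
rewrite [X in D a * X](_ : _ = rslice A a (ptake i p) * f) // mulrA.
rewrite [RHS]fserME plen_drop; apply: eq_bigr => m _.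
by rewrite /F pdrop_drop pdrop_take ?leq_addr // addKn.
Qed.

Variable Phi : potential K Q.

Definition jacobi_ideal : {pred aser} := fun f : aser =>
  `[< exists2 A, (forall a, growth biplen (A a)) &
        aval f = jcomb (fun a => der a (potval Phi)) A >].

Lemma jacobi_ideal_zmod : zmod_closed jacobi_ideal.
Proof.
split=> [|f g /asboolP[A hA fA] /asboolP[B hB gB]]; apply/asboolP.
  exists (fun _ _ => 0) => [a|].
    exists 1 => //; exists 0 => x _.
    by rewrite normr0 expr1n ler01.
  apply/funext => p; rewrite /jcomb /= big1 // => a _.
  by rewrite big1 // => j _; rewrite big1 // => i _; rewrite mul0r.
exists (fun a x => A a x - B a x); first by move=> a; exact: growthB.
by rewrite jcombB -fA -gB.
Qed.

HB.instance Definition _ :=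
  GRing.isZmodClosed.Build aser jacobi_ideal jacobi_ideal_zmod.

Lemma jacobi_idealMl (f g : aser) : g \in jacobi_ideal -> f * g \in jacobi_ideal.
Proof.
move=> /asboolP[A hA gA]; apply/asboolP.
exists (fun a uv => (aval f * lslice A a uv.2) uv.1).
  move=> a; have /asboolP hf := avalP f.
  apply: (growth_conv (al := fun k uv => ptake k uv.1)
    (be := fun k uv => (pdrop k uv.1, uv.2)) (m := fun uv => plen uv.1))
    hf (hA a).
  - exact: short_paths.
  - exact: short_bipaths.
  - by move=> uv; exact: leq_addr.
  - by move=> uv k kn; rewrite /biplen /= plen_take // plen_drop addnA subnKC.
by rewrite -jcombMl -gA.
Qed.

Lemma jacobi_idealMr (f g : aser) : g \in jacobi_ideal -> g * f \in jacobi_ideal.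
Proof.
move=> /asboolP[A hA gA]; apply/asboolP.
exists (fun a uv => (rslice A a uv.1 * aval f) uv.2).
  move=> a; have /asboolP hf := avalP f.
  apply: (growth_conv (al := fun k uv => (uv.1, ptake k uv.2))
    (be := fun k uv => pdrop k uv.2) (m := fun uv => plen uv.2))
    (hA a) hf.
  - exact: short_bipaths.
  - exact: short_paths.
  - by move=> uv; exact: leq_addl.
  - move=> uv k kn; rewrite /biplen /= plen_take // plen_drop -addnA.
    by rewrite subnKC.
by rewrite -jcombMr -gA.
Qed.

Definition jacobi : Type := Quotient.quot (jacobi_ideal : zmodClosed aser).

HB.instance Definition _ := GRing.Zmodule.on jacobi.

Definition jproj (f : aser) : jacobi :=
  \pi_(Quotient.quot (jacobi_ideal : zmodClosed aser)) f.

Lemma jproj_eq (f g : aser) : jproj f = jproj g <-> f - g \in jacobi_ideal.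
Proof. by rewrite Quotient.idealrBE; split=> [h|/eqP//]; apply/eqP. Qed.

Lemma jproj_repr (x : jacobi) : exists f : aser, x = jproj f.
Proof. by exists (repr x); rewrite /jproj reprK. Qed.

Lemma jprojD (f g : aser) : jproj (f + g) = jproj f + jproj g.
Proof. exact: raddfD. Qed.

Definition jmul (x y : jacobi) : jacobi := jproj (repr x * repr y).
Definition jscale (c : K) (x : jacobi) : jacobi := jproj (c *: repr x).

Lemma jrepr (f : aser) : repr (jproj f) - f \in jacobi_ideal.
Proof. by apply/jproj_eq; rewrite /jproj reprK. Qed.

Lemma jmulE (f g : aser) : jmul (jproj f) (jproj g) = jproj (f * g).
Proof.
apply/jproj_eq; set f' := repr _; set g' := repr _.
have -> : f' * g' - f * g = (f' - f) * g' + f * (g' - g).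
  by rewrite mulrBl mulrBr addrA subrK.
by apply: rpredD; [apply: jacobi_idealMr|apply: jacobi_idealMl]; exact: jrepr.
Qed.

Lemma ascale_l (c : K) (f : aser) : c *: f = al (fun=> c) * f.
Proof. by apply: val_inj; exact: fscale_l. Qed.

Lemma jscaleE c (f : aser) : jscale c (jproj f) = jproj (c *: f).
Proof.
by apply/jproj_eq; rewrite -scalerBr ascale_l jacobi_idealMl ?jrepr.
Qed.

Lemma jmulA : associative jmul.
Proof.
move=> x y z; have [f ->] := jproj_repr x; have [g ->] := jproj_repr y.
by have [h ->] := jproj_repr z; rewrite !jmulE mulrA.
Qed.

Lemma jmul1l : left_id (jproj 1) jmul.
Proof. by move=> x; have [f ->] := jproj_repr x; rewrite jmulE mul1r. Qed.

Lemma jmul1r : right_id (jproj 1) jmul.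
Proof. by move=> x; have [f ->] := jproj_repr x; rewrite jmulE mulr1. Qed.

Lemma jmulDl : left_distributive jmul +%R.
Proof.
move=> x y z; have [f ->] := jproj_repr x; have [g ->] := jproj_repr y.
by have [h ->] := jproj_repr z; rewrite -jprojD !jmulE -jprojD mulrDl.
Qed.

Lemma jmulDr : right_distributive jmul +%R.
Proof.
move=> x y z; have [f ->] := jproj_repr x; have [g ->] := jproj_repr y.
by have [h ->] := jproj_repr z; rewrite -jprojD !jmulE -jprojD mulrDr.
Qed.

HB.instance Definition _ :=
  GRing.Zmodule_isPzRing.Build jacobi jmulA jmul1l jmul1r jmulDl jmulDr.

Lemma jscaleA c d x : jscale c (jscale d x) = jscale (c * d) x.
Proof. by have [f ->] := jproj_repr x; rewrite !jscaleE scalerA. Qed.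

Lemma jscale1 : left_id 1 jscale.
Proof. by move=> x; have [f ->] := jproj_repr x; rewrite jscaleE scale1r. Qed.

Lemma jscaleDr : right_distributive jscale +%R.
Proof.
move=> c x y; have [f ->] := jproj_repr x; have [g ->] := jproj_repr y.
by rewrite -jprojD !jscaleE -jprojD scalerDr.
Qed.

Lemma jscaleDl x : {morph jscale^~ x : c d / c + d}.
Proof.
move=> c d; have [f ->] := jproj_repr x.
by rewrite !jscaleE -jprojD scalerDl.
Qed.

HB.instance Definition _ :=
  GRing.Zmodule_isLmodule.Build K jacobi jscaleA jscale1 jscaleDr jscaleDl.

Lemma jprojM (f g : aser) : jproj (f * g) = jproj f * jproj g.
Proof. by rewrite -jmulE. Qed.

Lemma jprojZ c (f : aser) : jproj (c *: f) = c *: jproj f.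
Proof. by rewrite -jscaleE. Qed.

Definition jl (c : vert Q -> K) : jacobi := jproj (al c).

Definition jacobi_finite : Prop :=
  exists n (b : 'I_n -> jacobi), forall x : jacobi,
    exists c : 'I_n -> K, x = \sum_i c i *: b i.

Definition jcyc_ideal : {pred potential K Q} := fun x =>
  `[< exists2 f, f \in jacobi_ideal & x = aclass f >].

Lemma aclassB (f g : aser) : aclass (f - g) = aclass f - aclass g.
Proof. by apply: val_inj; rewrite /= /fclass raddfB. Qed.

Lemma jcyc_ideal_zmod : zmod_closed jcyc_ideal.
Proof.
split=> [|x y /asboolP[f fJ ->] /asboolP[g gJ ->]]; apply/asboolP.
  by exists 0; rewrite ?rpred0 // -(subrr (0 : aser)) aclassB subrr.
by exists (f - g); rewrite ?rpredB // aclassB.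
Qed.

HB.instance Definition _ :=
  GRing.isZmodClosed.Build (potential K Q) jcyc_ideal jcyc_ideal_zmod.

Definition jacobi_cyc : zmodType :=
  Quotient.quot (jcyc_ideal : zmodClosed (potential K Q)).

Definition jcproj (x : potential K Q) : jacobi_cyc := \pi_jacobi_cyc x.

End Jacobi.

Section Isomorphisms.
Variables (K : numClosedFieldType) (Q : quiver).
Local Notation aser := (aseries K Q).

(* An [l]-algebra is a ring [A] with a structure map [l -> A]. *)
Definition l_algebra_iso (A B : pzRingType) (lA : (vert Q -> K) -> A)
    (lB : (vert Q -> K) -> B) (gamma : {rmorphism A -> B}) : Prop :=
  bijective gamma /\ forall c, gamma (lA c) = lB c.

(* [gammac] is the map induced by [gamma] on the quotients [jacobi_cyc]; it is
   determined by [gamma], since every class comes from an analytic series. *)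
Definition induced_cyc (Phi Psi : potential K Q)
    (gamma : jacobi Phi -> jacobi Psi)
    (gammac : jacobi_cyc Phi -> jacobi_cyc Psi) : Prop :=
  forall f g : aser, gamma (jproj Phi f) = jproj Psi g ->
    gammac (jcproj Phi (aclass f)) = jcproj Psi (aclass g).

(* [gammap] is the action of the automorphism [gamma] on potentials. *)
Definition induced_pot (gamma : aser -> aser)
    (gammap : potential K Q -> potential K Q) : Prop :=
  forall f, gammap (aclass f) = aclass (gamma f).

Definition right_equivalent (Phi Psi : potential K Q) : Prop :=
  exists (gamma : {rmorphism aser -> aser})
         (gammap : potential K Q -> potential K Q),
    [/\ l_algebra_iso (@al K Q) (@al K Q) gamma,
        induced_pot gamma gammap & gammap Phi = Psi].

End Isomorphisms.

(* Main.v *)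
Require Import Defs.
From HB Require Import structures.
From mathcomp Require Import all_boot all_order all_algebra.
From mathcomp Require Import reals complex.
From mathcomp Require Import boolp classical_sets zify ring lra.

(* (2) => (1) is the chain rule for cyclic derivatives. For (1) => (2), [gamma]
   lifts to an analytic endomorphism of the path algebra; as both Jacobi ideals
   lie in the square of the arrow ideal, its linear part is invertible, so it is
   an automorphism by the analytic inverse function theorem. It carries one
   Jacobi ideal to the other, which reduces the problem to potentials [phi] and
   [psi] having the same Jacobi ideal [J] and such that [theta = phi - psi] is
   the class of an element of [J]. Finite dimension makes [J] open, so that
   Nakayama's lemma applies.

   The potentials [psi + t theta] have Jacobi ideal [J] for all complex [t]
   outside a finite set avoiding [0] and [1]. Near such a [t], [theta] is the
   image of [psi + t theta] under a derivation [xi]; since [xi] preserves [J], it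
   has no constant terms, and the flow of a family of such derivations, which
   converges for small times, moves [psi + t theta] along the segment. Moser's
   method thus gives local triviality, and a path from [0] to [1] avoiding the
   finite set gives the result. *)

Set Implicit Arguments.
Unset Strict Implicit.
Unset Printing Implicit Defensive.

Import Order.TTheory GRing.Theory Num.Theory.
Local Open Scope ring_scope.

(** * Formal series and substitutions *)

(** Jacobi ideals consist of infinite combinations with prescribed growth. Rather than following the
    growth conditions through automorphisms and derivations, inclusions of ideals are proved up to
    adic closure, where it suffices to place the cyclic derivatives, and are made exact by openness.
    Analysis is confined to fixed points (substitutions, linear systems, inverses) and to the flow.

    Near [psi] the time-dependent vector field is explicit. Expressing the cyclic derivatives of
    [theta] through those of [psi] yields an operator [T] ([transport]) such that [T xi] acts on
    [psi] as [xi] acts on [theta], modulo commutators; hence the sum of the [(-t)^k T^k xi] sends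
    [psi + t theta] to [theta]. Binomial weights keep one radius of convergence for all powers of
    [t].

    The exceptional times are zeros of a determinant: modulo [m J + J m], with [m] the arrow ideal,
    the cyclic derivatives of the segment are combinations of those of [psi], with a matrix that is
    affine in [t] and is the identity at [t = 0]. *)

Section Series.
Variables (K : numClosedFieldType) (Q : quiver).
Local Notation fser := (fseries K Q).
Implicit Types (f g x y : fser) (p q : qpath Q) (a b : arrow Q) (i : vert Q).

Definition triv i : qpath Q := @QPath Q (i, [::]) isT.

Definition arr a : fser := fun p => (parrows p == [:: a])%:R.

Definition ev i : fser := fl (fun j => (j == i)%:R).

(** Left division by [a], the analogue of a Fox derivative. Together with the constant terms these
    quotients determine [f] ([fser_decomp]), and the recursions on series below follow them. *)
Definition lder a f : fser := fun p =>
  if pstart p == tgt a then fcoef f (src a, a :: parrows p) else 0.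

Definition const f i : K := f (triv i).

Definition ordge k f := forall p, (plen p < k)%N -> f p = 0.

Lemma fser_sumE (I : Type) (r : seq I) (P : pred I) (F : I -> fser) p :
  (\sum_(i <- r | P i) F i) p = \sum_(i <- r | P i) F i p.
Proof. exact: (big_morph (fun h : fser => h p)). Qed.

Lemma trivE p : plen p = 0 -> p = triv (pstart p).
Proof. by move=> h; apply: qpath_eqP => //; apply: size0nil. Qed.

Lemma fcoefE f p : fcoef f (pval p) = f p.
Proof. by rewrite /fcoef valK. Qed.

Lemma fcoef_walkN f i w : ~~ walk i w -> fcoef f (i, w) = 0.
Proof. by move=> h; rewrite /fcoef insubF //; apply: negbTE. Qed.

Lemma pval_eq p i w : pstart p = i -> parrows p = w -> pval p = (i, w).
Proof. by rewrite /pstart /parrows; case: (pval p) => /= ? ? -> ->. Qed.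

Lemma walk_p p : walk (pstart p) (parrows p).
Proof. exact: pvalP. Qed.

Lemma fcoef_p f p i w : pstart p = i -> parrows p = w -> fcoef f (i, w) = f p.
Proof. by move=> h1 h2; rewrite -(pval_eq h1 h2) fcoefE. Qed.

Lemma arr_src p a w : parrows p = a :: w -> pstart p = src a.
Proof. by have := walk_p p => /[swap] -> /= /andP[/eqP->]. Qed.

Lemma lder_drop1 f p a w : parrows p = a :: w -> lder a f (pdrop 1 p) = f p.
Proof.
move=> pw; have ps := arr_src pw; rewrite /lder pstart_drop parrows_drop pw /=.
by rewrite take0 /= eqxx drop0 (@fcoef_p f p).
Qed.

Lemma arrM a g p : (arr a * g) p =
  if parrows p is b :: _ then if b == a then g (pdrop 1 p) else 0 else 0.
Proof.
rewrite fserME /arr; case E: (parrows p) => [|b w].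
  by rewrite /plen E big_ord1 parrows_take E mul0r.
rewrite /plen E /= big_ord_recl parrows_take E take0 mul0r add0r.
rewrite big_ord_recl parrows_take E /= take0 big1 ?addr0.
  by rewrite eqseq_cons eqxx andbT; case: eqP; rewrite ?mul1r ?mul0r.
move=> k _; rewrite parrows_take E /bump /= !add1n /=.
by case: w k E => [|c w] //= [] //= k; rewrite eqseq_cons andbF mul0r.
Qed.

Lemma fser_decomp f : f = fl (const f) + \sum_a arr a * lder a f.
Proof.
apply/funext => p; rewrite fserDE fser_sumE.
under eq_bigr do rewrite arrM; rewrite /fl.
case E: (parrows p) => [|b w]; rewrite /plen E /=.
  by rewrite big1 ?addr0 // /const -trivE // /plen E.
rewrite add0r (bigD1 b) //= eqxx (lder_drop1 f E) big1 ?addr0 // => c /negbTE.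
by rewrite eq_sym => ->.
Qed.

Lemma lderB a f g : lder a (f - g) = lder a f - lder a g.
Proof.
apply/funext => p; rewrite fserDE fserNE /lder; case: ifP => _; rewrite ?subr0 //.
by rewrite /fcoef; case: insub => //=; rewrite ?subr0.
Qed.

Lemma lderM a f g :
  lder a (f * g) = const f (src a) *: lder a g + lder a f * g.
Proof.
apply/funext => p; rewrite fserDE fserZE /lder.
have [ps|ps] := eqVneq (pstart p) (tgt a); last first.
  rewrite mulr0 add0r fserME big1 // => k _.
  by rewrite (_ : pstart (ptake k p) = pstart p) // (negbTE ps) mul0r.
have W : walk (src a) (a :: parrows p) by rewrite /= eqxx -ps walk_p.
pose q := @QPath Q (src a, a :: parrows p) W.
have lq : plen q = (plen p).+1 by [].
rewrite !(@fcoef_p _ q) // fserME lq big_ord_recl; congr (_ + _).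
  by congr (_ * _); [congr f|congr g]; apply: qpath_eqP.
rewrite fserME; apply: eq_bigr => k _; congr (_ * _).
  rewrite (_ : pstart _ = pstart p) // ps eqxx.
  by symmetry; apply: fcoef_p.
by congr g; apply: qpath_eqP; rewrite // !pstart_drop /= ps.
Qed.

Lemma lder_fl a c : lder a (fl c) = 0.
Proof.
apply/funext => p; rewrite /lder fser0E; case: ifP => // _.
rewrite /fcoef; case: insubP => //= q _ qE.
by rewrite /fl /plen /parrows qE.
Qed.

Lemma lder_arr a b : lder a (arr b) = if a == b then ev (tgt a) else 0.
Proof.
apply/funext => p; rewrite /lder.
have [ps|ps] := eqVneq (pstart p) (tgt a); last first.
  case: eqP; rewrite ?fser0E // => _.
  by rewrite /ev /fl; case: ifP => // _; rewrite (negbTE ps).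
have W : walk (src a) (a :: parrows p) by rewrite /= eqxx -ps walk_p.
rewrite (@fcoef_p _ (@QPath Q (src a, a :: parrows p) W)) // /arr /parrows /=.
rewrite -/(parrows p) eqseq_cons; case: eqP => // _.
by rewrite /ev /fl ps eqxx /= /plen size_eq0; case: eqP.
Qed.

Lemma constM f g i : const (f * g) i = const f i * const g i.
Proof.
rewrite /const fserME big_ord1; congr (f _ * g _); apply: qpath_eqP => //.
Qed.

Lemma const_fl c i : const (fl c) i = c i. Proof. by []. Qed.

Lemma fl_lmul c f : fl c * f = (fun p => c (pstart p) * f p).
Proof. by apply/funext => p; exact: fl_mul. Qed.

Lemma fl_rmul c f : f * fl c = (fun p => f p * c (pend p)).
Proof. by apply/funext => p; exact: fmul_l. Qed.

Lemma scale_mull (c : K) f g : (c *: f) * g = c *: (f * g).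
Proof. by rewrite (fscale_l c f) (fscale_l c (f * g)) mulrA. Qed.

Lemma scale_mulr (c : K) f g : f * (c *: g) = c *: (f * g).
Proof.
apply/funext => p; rewrite fserZE !fserME mulr_sumr.
by apply: eq_bigr => k _; rewrite fserZE mulrCA.
Qed.

Lemma fl1 : fl (fun=> 1) = 1 :> fser. Proof. by []. Qed.

Lemma fl_sum c : fl c = \sum_i c i *: ev i :> fser.
Proof.
apply/funext => p; rewrite fser_sumE /ev /fl; case: ifP => pl.
  rewrite (bigD1 (pstart p)) //= fserZE pl eqxx mulr1 big1 ?addr0 // => j.
  by rewrite eq_sym fserZE pl => /negbTE ->; rewrite mulr0.
by rewrite big1 // => j _; rewrite fserZE pl mulr0.
Qed.

Lemma ordge0 f : ordge 0 f. Proof. by []. Qed.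
Lemma ordge_zero k : ordge k 0. Proof. by []. Qed.
Lemma ordge_inf f : (forall k, ordge k f) -> f = 0.
Proof. by move=> h; apply/funext => p; apply: (h (plen p).+1). Qed.
Lemma ordgeD k f g : ordge k f -> ordge k g -> ordge k (f + g).
Proof. by move=> hf hg p pk; rewrite fserDE hf // hg // addr0. Qed.
Lemma ordgeN k f : ordge k f -> ordge k (- f).
Proof. by move=> hf p pk; rewrite fserNE hf // oppr0. Qed.
Lemma ordgeB k f g : ordge k f -> ordge k g -> ordge k (f - g).
Proof. by move=> hf hg; apply: ordgeD hf (ordgeN hg). Qed.
Lemma ordgeZ k (c : K) f : ordge k f -> ordge k (c *: f).
Proof. by move=> hf p pk; rewrite fserZE hf // mulr0. Qed.
Lemma ordge_sum (I : Type) (r : seq I) (P : pred I) (F : I -> fser) k :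
  (forall j, P j -> ordge k (F j)) -> ordge k (\sum_(j <- r | P j) F j).
Proof. by move=> h p pk; rewrite fser_sumE big1 // => j Pj; apply: (h j Pj p pk). Qed.
Lemma ordge_le k l f : (l <= k)%N -> ordge k f -> ordge l f.
Proof. by move=> lk hf p pl; apply/hf/(leq_trans pl). Qed.

Lemma ordgeM k l f g : ordge k f -> ordge l g -> ordge (k + l) (f * g).
Proof.
move=> hf hg p pkl; rewrite fserME big1 // => j _.
have jn : (j <= plen p)%N by rewrite -ltnS.
have [jk|kj] := ltnP j k; first by rewrite hf ?mul0r // plen_take.
rewrite [g _]hg ?mulr0 // plen_drop; rewrite -(ltn_add2l j) subnKC //.
by apply: leq_trans pkl _; rewrite leq_add2r.
Qed.

Lemma ordgeMl k f g : ordge k g -> ordge k (f * g).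
Proof. exact: ordgeM (@ordge0 f). Qed.
Lemma ordgeMr k f g : ordge k f -> ordge k (f * g).
Proof. by rewrite -{2}[k]addn0 => h; exact: ordgeM h (@ordge0 g). Qed.

Lemma ordge_arr a : ordge 1 (arr a).
Proof. by move=> p; rewrite ltnS leqn0 /plen /arr; case: (parrows p). Qed.

Lemma ordge_lder k a f : ordge k f -> ordge k.-1 (lder a f).
Proof.
case: k => [//|k] hf p pk; rewrite /lder; case: ifP => // _.
rewrite /fcoef; case: insubP => //= q _ qE.
by apply: hf; rewrite /plen /parrows qE.
Qed.

Lemma ordge1P f : ordge 1 f <-> forall i, const f i = 0.
Proof.
split=> [h i|h p]; first exact: h.
by rewrite ltnS leqn0 => /eqP/trivE ->; exact: h.
Qed.

(** Support on the paths parallel to [a]: the form of the image of [a] under an [l]-algebra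
    endomorphism. *)
Definition par a f := forall p,
  ~~ ((pstart p == src a) && (pend p == tgt a)) -> f p = 0.

Definition cut a f : fser := ev (src a) * f * ev (tgt a).

Lemma evM i f : ev i * f = (fun p => if pstart p == i then f p else 0).
Proof. by rewrite fl_lmul; apply/funext => p; case: eqP; rewrite ?mul1r ?mul0r. Qed.
Lemma mul_ev i f : f * ev i = (fun p => if pend p == i then f p else 0).
Proof. by rewrite fl_rmul; apply/funext => p; case: eqP; rewrite ?mulr1 ?mulr0. Qed.

Lemma cutE a f p :
  cut a f p = if (pstart p == src a) && (pend p == tgt a) then f p else 0.
Proof. by rewrite /cut mul_ev evM; do 2 case: eqP. Qed.

Lemma par_cut a f : par a (cut a f).
Proof. by move=> p /negbTE h; rewrite cutE h. Qed.

Lemma cut_par a f : par a f -> cut a f = f.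
Proof. by move=> h; apply/funext => p; rewrite cutE; case: ifPn => // /h ->. Qed.

Lemma cutB a f g : cut a (f - g) = cut a f - cut a g.
Proof. by rewrite /cut mulrBr mulrBl. Qed.

Lemma ordge_cut k a f : ordge k f -> ordge k (cut a f).
Proof. by move=> h; apply/ordgeMr/ordgeMl. Qed.

Lemma par_arr a : par a (arr a).
Proof.
move=> p; rewrite /arr; case: (parrows p =P [:: a]) => // pw.
rewrite (arr_src pw) eqxx /=.
by rewrite (_ : pend p = tgt a) ?eqxx // /pend pw.
Qed.

Lemma par_lmul a f c : par a f -> fl c * f = c (src a) *: f.
Proof.
move=> h; rewrite fl_lmul; apply/funext => p; rewrite fserZE.
have [/andP[/eqP-> _]//|/h->] := boolP ((pstart p == src a) && (pend p == tgt a)).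
by rewrite !mulr0.
Qed.

Lemma par_rmul a f c : par a f -> f * fl c = c (tgt a) *: f.
Proof.
move=> h; rewrite fl_rmul; apply/funext => p; rewrite fserZE.
have [/andP[_ /eqP->]|/h->] := boolP ((pstart p == src a) && (pend p == tgt a)).
  by rewrite mulrC.
by rewrite mulr0 mul0r.
Qed.

Lemma par_rev a f : par a f -> f * ev (tgt a) = f.
Proof. by move=> h; rewrite (par_rmul _ h) eqxx scale1r. Qed.
Lemma par_lev a f : par a f -> ev (src a) * f = f.
Proof. by move=> h; rewrite (par_lmul _ h) eqxx scale1r. Qed.

Section Sub.
Variable h : arrow Q -> fser.

(* [sub h f] is the series [f] with [h a] substituted for each arrow [a], and
   [subtr n f] agrees with it on the paths of length less than [n]. *)
Fixpoint subtr n f : fser :=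
  if n is n'.+1 then fl (const f) + \sum_a h a * subtr n' (lder a f) else 0.

Definition sub f : fser := fun p => subtr (plen p).+1 f p.

Hypothesis h1 : forall a, ordge 1 (h a).

Lemma subtr_stable n m f : (n <= m)%N -> ordge n (subtr n f - subtr m f).
Proof.
elim: n m f => [//|n IH] [//|m] f nm /=.
rewrite opprD addrACA subrr add0r -sumrB; apply: ordge_sum => a _.
by rewrite -mulrBr -[n.+1]add1n; apply: ordgeM => //; exact: IH.
Qed.

Lemma sub_subtr n f : ordge n (sub f - subtr n f).
Proof.
move=> p pn; rewrite fserDE fserNE /sub.
have /(_ p) := @subtr_stable (plen p).+1 n f pn.
by rewrite fserDE fserNE; apply.
Qed.

Lemma sub_rec f : sub f = fl (const f) + \sum_a h a * sub (lder a f).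
Proof.
apply/funext => p; rewrite /sub -/sub /= !fserDE !fser_sumE; congr (_ + _).
apply: eq_bigr => a _; apply/eqP; rewrite -subr_eq0 -fserNE -fserDE -mulrBr.
rewrite -opprB mulrN fserNE oppr_eq0; apply/eqP.
by apply: (ordgeM (h1 a) (@sub_subtr (plen p) (lder a f))); rewrite add1n.
Qed.

(* The recursion of [sub_rec] has a unique solution, since each [h a] lies in
   the arrow ideal. *)
Lemma sub_uniq (T : Type) (G v : T -> fser) (sh : arrow Q -> T -> T) :
  (forall a t, v (sh a t) = lder a (v t)) ->
  (forall t, G t = fl (const (v t)) + \sum_a h a * G (sh a t)) ->
  forall t, G t = sub (v t).
Proof.
move=> hsh hG t; apply/eqP; rewrite -subr_eq0; apply/eqP/ordge_inf => k.
elim: k t => [//|k IH] t; rewrite hG sub_rec opprD addrACA subrr add0r -sumrB.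
apply: ordge_sum => a _; rewrite -mulrBr -hsh -[k.+1]add1n.
exact: ordgeM (h1 a) (IH _).
Qed.

Lemma subtrB n f g : subtr n (f - g) = subtr n f - subtr n g.
Proof.
elim: n f g => [|n IH] f g /=; first by rewrite subr0.
rewrite opprD addrACA -sumrB; congr (_ + _).
  by apply/funext => p; rewrite fserDE fserNE /fl; case: ifP; rewrite ?subr0.
by apply: eq_bigr => a _; rewrite lderB IH mulrBr.
Qed.

Lemma subB f g : sub (f - g) = sub f - sub g.
Proof. by apply/funext => p; rewrite fserDE fserNE /sub subtrB. Qed.

Lemma sub0 : sub 0 = 0.
Proof. by have := subB 0 0; rewrite !subrr. Qed.

Lemma lderZ a (c : K) f : lder a (c *: f) = c *: lder a f.
Proof.
apply/funext => p; rewrite fserZE /lder; case: ifP => _; rewrite ?mulr0 //.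
by rewrite /fcoef; case: insub => //=; rewrite ?mulr0.
Qed.

Lemma subtrZ n (c : K) f : subtr n (c *: f) = c *: subtr n f.
Proof.
elim: n f => [|n IH] f /=; first by rewrite scaler0.
rewrite scalerDr scaler_sumr; congr (_ + _).
  by apply/funext => p; rewrite fserZE /fl; case: ifP; rewrite ?mulr0.
by apply: eq_bigr => a _; rewrite lderZ IH scale_mulr.
Qed.

Lemma subZ (c : K) f : sub (c *: f) = c *: sub f.
Proof. by apply/funext => p; rewrite fserZE /sub subtrZ. Qed.

Lemma subD f g : sub (f + g) = sub f + sub g.
Proof. by rewrite -{1}[g]opprK -[- g]sub0r !subB sub0 sub0r opprK. Qed.

Lemma sub_sum (I : Type) (r : seq I) (P : pred I) (F : I -> fser) :
  sub (\sum_(j <- r | P j) F j) = \sum_(j <- r | P j) sub (F j).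
Proof. exact: (big_morph sub subD sub0). Qed.

Lemma sub_fl c : sub (fl c) = fl c.
Proof.
rewrite sub_rec big1 ?addr0 // => a _.
by rewrite lder_fl sub0 mulr0.
Qed.

Lemma ordge_sub k f : ordge k f -> ordge k (sub f).
Proof.
elim: k f => [//|k IH] f hf; rewrite sub_rec; apply: ordgeD.
  by move=> p _; rewrite /fl; case: ifP => // /eqP _; exact: hf.
apply: ordge_sum => a _; rewrite -[k.+1]add1n; apply: ordgeM => //.
exact/IH/(ordge_lder (k := k.+1)).
Qed.

Hypothesis hpar : forall a, par a (h a).

Lemma sub_arr a : sub (arr a) = h a.
Proof.
rewrite sub_rec (bigD1 a) //= lder_arr eqxx sub_fl (par_rev (@hpar a)).
rewrite big1 ?addr0; last first.
  by move=> b /negbTE ba; rewrite lder_arr ba sub0 mulr0.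
rewrite (_ : fl _ = 0) ?add0r //; apply/funext => p; rewrite /fl fser0E.
by case: ifP => // _; rewrite (@ordge_arr a).
Qed.

(** The defect of multiplicativity at [(f, g)] is the sum over [a] of [h a] times the defect at
    [(lder a f, g)], so its order is infinite. As [h a] is parallel to [a], left multiplication by
    the constants of [f] becomes the scalar occurring in [lderM]. *)
Lemma subM f g : sub (f * g) = sub f * sub g.
Proof.
apply/eqP; rewrite -subr_eq0; apply/eqP/ordge_inf => k.
elim: k f g => [//|k IH] f g.
rewrite (sub_rec (f * g)) [in sub f * _]sub_rec mulrDl {1}[sub g]sub_rec mulrDr.
have -> : fl (const f) * fl (const g) = fl (const (f * g)).
  rewrite fl_lmul; apply/funext => p; rewrite /fl; case: ifP => _; rewrite ?mulr0 //.
  by rewrite constM.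
rewrite -[X in _ - X]addrA opprD addrACA subrr add0r mulr_sumr mulr_suml -big_split -sumrB.
apply: ordge_sum => a _; rewrite lderM subD subZ mulrDr scale_mulr.
rewrite [fl _ * _]mulrA (par_lmul _ (@hpar a)) scale_mull opprD addrACA subrr add0r.
by rewrite -[h a * _ * _]mulrA -mulrBr -[k.+1]add1n; exact: ordgeM (h1 a) (IH _ _).
Qed.
End Sub.

Lemma par_sub h k a : (forall a, ordge 1 (h a)) -> (forall a, par a (h a)) ->
  par a k -> par a (sub h k).
Proof.
move=> h1 hp /cut_par <-; rewrite /cut !subM // !sub_fl // -/(ev _) -/(ev _).
exact: par_cut.
Qed.

Lemma sub_comp h k f : (forall a, ordge 1 (h a)) -> (forall a, par a (h a)) ->
  (forall a, ordge 1 (k a)) ->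
  sub h (sub k f) = sub (fun a => sub h (k a)) f.
Proof.
move=> h1 hp k1; have hk1 a : ordge 1 (sub h (k a)) by exact: ordge_sub.
apply: (sub_uniq hk1 (G := fun f => sub h (sub k f)) (v := id) (sh := @lder)) => // g.
rewrite [in LHS](sub_rec k1) subD // sub_fl // sub_sum //; congr (_ + _).
by apply: eq_bigr => a _; rewrite subM.
Qed.

Lemma sub_id f : sub arr f = f.
Proof.
symmetry; apply: (sub_uniq (@ordge_arr) (G := id) (v := id) (sh := @lder)) => // g.
exact: fser_decomp.
Qed.

End Series.

(** * Kernels, cyclic derivatives and derivations *)

Section Kernels.
Variables (K : numClosedFieldType) (Q : quiver).
Local Notation fser := (fseries K Q).
Local Notation ker := (qpath Q * qpath Q -> K).
Local Notation ev := (@ev K Q).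
Local Notation arr := (@arr K Q).
Implicit Types (f g x y D : fser) (p q u v : qpath Q) (a b : arrow Q) (i : vert Q).
Implicit Types (A B : ker).

Lemma sum_factor3 (T : qpath Q -> qpath Q -> qpath Q -> K) p :
  \sum_(k < (plen p).+1) \sum_(j < (plen (pdrop k p)).+1)
     T (ptake k p) (ptake j (pdrop k p)) (pdrop j (pdrop k p)) =
  \sum_(j < (plen p).+1) \sum_(k < (plen (ptake j p)).+1)
     T (ptake k (ptake j p)) (pdrop k (ptake j p)) (pdrop j p).
Proof.
pose F k j := T (ptake k p) (ptake (j - k) (pdrop k p)) (pdrop j p).
transitivity (\sum_(k < (plen p).+1) \sum_(j < (plen p - k).+1) F k (k + j)%N).
  apply: eq_bigr => k _; rewrite plen_drop; apply: eq_bigr => j _.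
  by rewrite /F addKn pdrop_drop.
rewrite sum_exchange; apply: eq_bigr => j _.
have jn : (j <= plen p)%N by rewrite -ltnS.
rewrite plen_take //; apply: eq_bigr => k _.
have kj : (k <= j)%N by rewrite -ltnS.
by rewrite /F ptake_take // pdrop_take.
Qed.

(** A kernel stands for the infinite sum of the [A (u, v)] times [u] tensor [v], and [mulK] is the
    multiplication map. [lmulK] and [rmulK] multiply on the outer sides, [rinK] and [linK] on the
    inner ones. *)
Definition mulK A : fser := fun p => \sum_(k < (plen p).+1) A (ptake k p, pdrop k p).
Definition swapK A : ker := fun uv => A (uv.2, uv.1).
Definition lsl A v : fser := fun u => A (u, v).
Definition rsl A u : fser := fun v => A (u, v).
Definition lmulK f A : ker := fun uv => (f * lsl A uv.2) uv.1.
Definition rmulK A f : ker := fun uv => (rsl A uv.1 * f) uv.2.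
Definition rinK A D : ker := fun uv => (lsl A uv.2 * D) uv.1.
Definition linK D A : ker := fun uv => (D * rsl A uv.1) uv.2.
(* [ins A D] is [sum_(u, v) (A (u, v)) u D v]. *)
Definition ins A D : fser := mulK (rinK A D).
Definition lderK a A : ker := fun uv => lder a (lsl A uv.2) uv.1.

Lemma insE' A D : ins A D = mulK (linK D A).
Proof.
apply/funext => p; rewrite /ins /mulK /rinK /linK /=.
under eq_bigr do rewrite fserME.
under [RHS]eq_bigr do rewrite fserME.
rewrite [RHS](sum_factor3 (fun u w v => D w * A (u, v))).
by apply: eq_bigr => j _; apply: eq_bigr => k _; exact: mulrC.
Qed.

Lemma mulK_l f A : f * mulK A = mulK (lmulK f A).
Proof.
apply/funext => p; rewrite fserME /mulK /lmulK /=.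
under [RHS]eq_bigr do rewrite fserME.
under eq_bigr do rewrite mulr_sumr.
exact: (sum_factor3 (fun u w v => f u * A (w, v))).
Qed.

Lemma mulK_r f A : mulK A * f = mulK (rmulK A f).
Proof.
apply/funext => p; rewrite fserME /mulK /rmulK /=.
under [RHS]eq_bigr do rewrite fserME.
under eq_bigr do rewrite mulr_suml.
by rewrite -(sum_factor3 (fun u w v => A (u, w) * f v)).
Qed.

Lemma insMl f A D : f * ins A D = ins (lmulK f A) D.
Proof.
rewrite /ins mulK_l; congr mulK; apply/funext => -[u v].
exact: (congr1 (fun z : fser => z u) (mulrA f (lsl A v) D)).
Qed.

Lemma insMr f A D : ins A D * f = ins (rmulK A f) D.
Proof.
rewrite !insE' mulK_r; congr mulK; apply/funext => -[u v].
exact: (congr1 (fun z : fser => z v) (esym (mulrA D (rsl A u) f))).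
Qed.

Lemma ins_swap_l f A D : ins (swapK (lmulK f A)) D = ins (swapK A) (D * f).
Proof.
rewrite !insE'; congr mulK; apply/funext => -[u v].
exact: (congr1 (fun z : fser => z v) (mulrA D f (lsl A u))).
Qed.

Lemma ins_swap_r f A D : ins (swapK (rmulK A f)) D = ins (swapK A) (f * D).
Proof.
rewrite /ins; congr mulK; apply/funext => -[u v].
exact: (congr1 (fun z : fser => z u) (esym (mulrA (rsl A v) f D))).
Qed.

Lemma ins1 A : ins A 1 = mulK A.
Proof.
by rewrite /ins; congr mulK; apply/funext => -[u v]; rewrite /rinK /= mulr1.
Qed.

Lemma ins_tensor x y D : ins (fun uv => x uv.1 * y uv.2) D = x * D * y.
Proof.
apply/funext => p; rewrite /ins /mulK fserME; apply: eq_bigr => k _.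
rewrite /rinK /= (_ : lsl _ _ = y (pdrop k p) *: x).
  by rewrite scale_mull fserZE mulrC.
by apply/funext => u; rewrite fserZE mulrC.
Qed.

Lemma insDl A B D : ins (fun uv => A uv + B uv) D = ins A D + ins B D.
Proof.
apply/funext => p; rewrite fserDE -big_split; apply: eq_bigr => k _ /=.
by rewrite /rinK /= -fserDE -mulrDl.
Qed.

Lemma insZl (c : K) A D : ins (fun uv => c * A uv) D = c *: ins A D.
Proof.
apply/funext => p; rewrite fserZE mulr_sumr; apply: eq_bigr => k _ /=.
by rewrite /rinK /= -fserZE -scale_mull.
Qed.

Lemma ins0l D : ins (fun=> 0) D = 0.
Proof.
apply/funext => p; rewrite /ins /mulK fser0E big1 // => k _.
by rewrite /rinK (_ : lsl _ _ = 0) // mul0r.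
Qed.

Lemma insDr A x y : ins A (x + y) = ins A x + ins A y.
Proof.
apply/funext => p; rewrite fserDE -big_split; apply: eq_bigr => k _ /=.
by rewrite /rinK /= -fserDE -mulrDr.
Qed.

Lemma insZr (c : K) A x : ins A (c *: x) = c *: ins A x.
Proof.
apply/funext => p; rewrite fserZE mulr_sumr; apply: eq_bigr => k _ /=.
by rewrite /rinK /= -fserZE -scale_mulr.
Qed.

Lemma ins0r A : ins A 0 = 0.
Proof. by rewrite -(scale0r 0) insZr !scale0r. Qed.

Lemma ins_suml (I : Type) (r : seq I) (F : I -> ker) D :
  ins (fun uv => \sum_(j <- r) F j uv) D = \sum_(j <- r) ins (F j) D.
Proof.
elim: r => [|j r IH].
  rewrite big_nil -(ins0l D); congr ins; apply/funext => uv; exact: big_nil.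
rewrite big_cons -IH -insDl; congr ins; apply/funext => uv; exact: big_cons.
Qed.

Lemma ins_sumr (I : Type) (r : seq I) (F : I -> fser) A :
  ins A (\sum_(j <- r) F j) = \sum_(j <- r) ins A (F j).
Proof. exact: (big_morph (ins A) (insDr A) (ins0r A)). Qed.

Lemma ordge_ins k l A D : (forall uv, (biplen uv < l)%N -> A uv = 0) ->
  ordge k D -> ordge (l + k) (ins A D).
Proof.
move=> hA hD p pk; rewrite /ins /mulK big1 // => j _.
have jn : (j <= plen p)%N by rewrite -ltnS.
rewrite /rinK /= fserME big1 // => i _.
have ij : (i <= j)%N by rewrite -ltnS -[X in (_ < X.+1)%N](plen_take jn).
rewrite /lsl /=; have [h|h] := ltnP (biplen (ptake i (ptake j p), pdrop j p)) l.
  by rewrite hA ?mul0r.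
have E : plen (pdrop i (ptake j p)) = (j - i)%N by rewrite plen_drop; congr subn; exact: plen_take.
have F : plen (ptake i (ptake j p)) = i by apply: plen_take; rewrite -ltnS.
rewrite [D _]hD ?mulr0 // E; move: h.
rewrite /biplen /= F plen_drop; lia.
Qed.

Lemma ordge_ins0 k A D : ordge k D -> ordge k (ins A D).
Proof. by move=> h; apply: (@ordge_ins k 0). Qed.

(** Splits off the first letter of the left factors. Iterated [k] times, it writes [ins A D] as
    finitely many ordinary products plus a remainder of order [k], which replaces convergence
    arguments for two-sided combinations. *)
Lemma ins_peel A D : ins A D =
  \sum_i ev i * D * rsl A (triv i) + \sum_a arr a * ins (lderK a A) D.
Proof.
under eq_bigr do rewrite -ins_tensor.
under [X in _ + X]eq_bigr do rewrite insMl.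
rewrite -!ins_suml -insDl; congr ins; apply/funext => -[u v] /=.
rewrite -[LHS]/(lsl A v u) {1}[lsl A v]fser_decomp fserDE fl_sum !fser_sumE.
by congr (_ + _); apply: eq_bigr => i _; rewrite fserZE mulrC.
Qed.

(* The coefficient of [(u, v)] is that of [u b v] in [f]. *)
Definition dker b f : ker := fun uv =>
  if pstart uv.2 == tgt b then
    fcoef f (pstart uv.1, parrows uv.1 ++ b :: parrows uv.2) else 0.

Lemma dkerN b f u v : (pstart v != tgt b) || (pend u != src b) ->
  dker b f (u, v) = 0.
Proof.
rewrite /dker /=; case: eqP => //= vb ub; rewrite fcoef_walkN //.
by rewrite walk_cat /= -/(pend u) eq_sym (negbTE ub) andbF.
Qed.

Lemma dker_p b f u v p : pstart v = tgt b -> pstart p = pstart u ->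
  parrows p = parrows u ++ b :: parrows v -> dker b f (u, v) = f p.
Proof. by move=> vb h1 h2; rewrite /dker /= vb eqxx (@fcoef_p _ _ f p). Qed.

Lemma pend_drop k p : pend (pdrop k p) = pend p.
Proof. exact: walk_end_drop. Qed.

Lemma dker_path b u v : pstart v = tgt b -> pend u = src b ->
  exists2 p, pstart p = pstart u & parrows p = parrows u ++ b :: parrows v.
Proof.
move=> vb ub.
have W : walk (pstart u) (parrows u ++ b :: parrows v).
  by rewrite walk_cat walk_p /= -/(pend u) ub eqxx -vb walk_p.
by exists (@QPath Q (pstart u, parrows u ++ b :: parrows v) W).
Qed.

Lemma dkerM b f g :
  dker b (f * g) = fun uv => lmulK f (dker b g) uv + rmulK (dker b f) g uv.
Proof.
apply/funext => -[u v].
have [h|] := boolP ((pstart v != tgt b) || (pend u != src b)).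
  rewrite dkerN // /lmulK /rmulK /= !fserME !big1 ?addr0 // => k _; last first.
    by rewrite /lsl dkerN ?mulr0 // pend_drop.
  by rewrite /rsl dkerN ?mul0r.
rewrite negb_or !negbK => /andP[/eqP vb /eqP ub].
have [p ps pw] := dker_path vb ub.
rewrite (dker_p _ vb ps pw) /lmulK /rmulK /= !fserME.
have lp : (plen p).+1 = ((plen u).+1 + (plen v).+1)%N.
  by rewrite /plen pw size_cat /= addSn addnS.
(* Of the [plen u + plen v + 2] cuts of the path [u b v], those before [b] leave it in the factor
   [g], the others in the factor [f]. *)
rewrite lp big_split_ord /=; congr (_ + _); apply: eq_bigr => k _.
  have ku : (k <= plen u)%N by rewrite -ltnS.
  congr (f _ * _).
    by apply: qpath_eqP => //; rewrite !parrows_take pw takel_cat.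
  rewrite /lsl (@dker_p _ _ _ _ (pdrop k p)) //.
    by rewrite !pstart_drop ps pw takel_cat.
  rewrite !parrows_drop pw drop_cat -/(plen u).
  by case: ltnP => // uk; rewrite (@anti_leq k (plen u)) ?ku // subnn drop0 drop_size.
have E : parrows p = rcons (parrows u) b ++ parrows v by rewrite cat_rcons.
have S : size (rcons (parrows u) b) = (plen u).+1 by rewrite size_rcons.
congr (_ * g _).
  rewrite /rsl (@dker_p _ _ _ _ (ptake (plen u + k).+1 p)) //.
  by rewrite !parrows_take E -addSn -S takeD take_size_cat // drop_size_cat // cat_rcons.
apply: qpath_eqP.
  rewrite !pstart_drop E -S takeD take_size_cat // drop_size_cat //.
  by rewrite walk_end_cat -cats1 walk_end_cat /= ps -/(pend u) {1}/walk_end /= vb.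
by rewrite !parrows_drop E -S addnC -drop_drop drop_size_cat.
Qed.

Lemma dker_fl b c uv : dker b (fl c) uv = 0.
Proof.
case: uv => u v; have [h|] := boolP ((pstart v != tgt b) || (pend u != src b)).
  exact: dkerN.
rewrite negb_or !negbK => /andP[/eqP vb /eqP ub].
have [p ps pw] := dker_path vb ub.
by rewrite (dker_p _ vb ps pw) /fl /plen pw size_cat addnS.
Qed.

Lemma dker_arr b a uv :
  dker b (arr a) uv = if a == b then ev (src b) uv.1 * ev (tgt b) uv.2 else 0.
Proof.
case: uv => u v; have [h|] := boolP ((pstart v != tgt b) || (pend u != src b)).
  rewrite dkerN // /ev /fl /=; case: ifP => // _.
  case: ifP; rewrite ?mul0r //; case: ifP; rewrite ?mulr0 // => v0 u0.
  move: h; rewrite (_ : pend u = pstart u).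
    by case: eqP => /=; rewrite ?mulr0 // => _; case: eqP => //; rewrite mul0r.
  by rewrite {1}(trivE (eqP u0)).
rewrite negb_or !negbK => /andP[/eqP vb /eqP ub].
have [p ps pw] := dker_path vb ub.
rewrite (dker_p _ vb ps pw) /arr pw /ev /fl /= vb eqxx.
have [u0|u0] := eqVneq (plen u) 0; last first.
  rewrite mul0r if_same; case: eqP => // h.
  move/(congr1 size): h; rewrite size_cat /= addnS -/(plen u) => /eqP.
  by rewrite eqSS addn_eq0 (negbTE u0).
have us : pstart u = src b by rewrite -ub [in RHS](trivE u0).
rewrite us eqxx (size0nil u0) /= eqseq_cons eq_sym; case: eqP => //= _.
by rewrite mul1r /plen size_eq0; case: eqP.
Qed.

Lemma dkerB b f g uv : dker b (f - g) uv = dker b f uv - dker b g uv.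
Proof.
case: uv => u v; rewrite /dker; case: ifP => _; rewrite ?subr0 //.
by rewrite /fcoef; case: insub => //=; rewrite ?subr0.
Qed.

Lemma dkerZ b (c : K) f uv : dker b (c *: f) uv = c * dker b f uv.
Proof.
case: uv => u v; rewrite /dker; case: ifP => _; rewrite ?mulr0 //.
by rewrite /fcoef; case: insub => //=; rewrite ?mulr0.
Qed.

Lemma dkerD b f g uv : dker b (f + g) uv = dker b f uv + dker b g uv.
Proof. by rewrite -{1}[g]opprK dkerB -scaleN1r dkerZ mulN1r opprK. Qed.

Lemma dker_ord k b f uv : ordge k f -> (biplen uv < k.-1)%N -> dker b f uv = 0.
Proof.
case: uv => u v hf hk; have [h|] := boolP ((pstart v != tgt b) || (pend u != src b)).
  exact: dkerN.
rewrite negb_or !negbK => /andP[/eqP vb /eqP ub].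
have [p ps pw] := dker_path vb ub.
rewrite (dker_p _ vb ps pw) hf // /plen pw size_cat /= addnS.
by case: k hk {hf}.
Qed.

(* [cdr b f x] is the sum of [v x u] over the occurrences [u b v] of [b] in
   [f]; the cyclic derivative is the case [x = 1]. *)
Definition cdr b f x : fser := ins (swapK (dker b f)) x.

Lemma fder_cdr b f : fder b f = cdr b f 1.
Proof.
rewrite /cdr ins1; apply/funext => p; rewrite /fder /mulK /swapK.
case: ifPn => [/andP[/eqP pb /eqP pe]|h].
  apply: eq_bigr => k _; have e : pstart (ptake k p) = tgt b by exact: pb.
  by rewrite /dker /= e eqxx.
rewrite big1 // => k _; rewrite dkerN // pend_drop.
by rewrite (_ : pstart (ptake k p) = pstart p) // -negb_and.
Qed.

(** The reason for the argument [x]: the cyclic derivative by itself has no product rule, but here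
    the factor not containing the letter is moved cyclically next to [x]. *)
Lemma cdrM b f g x : cdr b (f * g) x = cdr b f (g * x) + cdr b g (x * f).
Proof.
rewrite /cdr dkerM -[ins _ (g * x)]ins_swap_r -[ins _ (x * f)]ins_swap_l addrC -insDl.
by congr ins.
Qed.

Lemma cdr_fl b c x : cdr b (fl c) x = 0.
Proof.
rewrite /cdr -(ins0l x); congr ins; apply/funext => uv.
by rewrite /swapK dker_fl.
Qed.

Lemma cdr_arr b a x :
  cdr b (arr a) x = if a == b then ev (tgt b) * x * ev (src b) else 0.
Proof.
rewrite /cdr; case: eqP => [<-|/eqP/negbTE ab].
  rewrite -ins_tensor; congr ins; apply/funext => uv.
  by rewrite /swapK dker_arr eqxx mulrC.
by rewrite -(ins0l x); congr ins; apply/funext => uv; rewrite /swapK dker_arr ab.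
Qed.

Lemma cdrDl b f g x : cdr b (f + g) x = cdr b f x + cdr b g x.
Proof.
by rewrite /cdr -insDl; congr ins; apply/funext => uv; rewrite /swapK dkerD.
Qed.

Lemma cdrZl b (c : K) f x : cdr b (c *: f) x = c *: cdr b f x.
Proof.
by rewrite /cdr -insZl; congr ins; apply/funext => uv; rewrite /swapK dkerZ.
Qed.

Lemma cdr0l b x : cdr b 0 x = 0.
Proof. by rewrite -(scale0r 0) cdrZl !scale0r. Qed.

Lemma cdr_suml b (I : Type) (r : seq I) (F : I -> fser) x :
  cdr b (\sum_(j <- r) F j) x = \sum_(j <- r) cdr b (F j) x.
Proof. exact: (big_morph (cdr b ^~ x) (fun f g => cdrDl b f g x) (cdr0l b x)). Qed.

Lemma cdrDr b f x y : cdr b f (x + y) = cdr b f x + cdr b f y.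
Proof. exact: insDr. Qed.

Lemma cdr0r b f : cdr b f 0 = 0.
Proof. exact: ins0r. Qed.

Lemma cdr_sumr b f (I : Type) (r : seq I) (F : I -> fser) :
  cdr b f (\sum_(j <- r) F j) = \sum_(j <- r) cdr b f (F j).
Proof. exact: ins_sumr. Qed.

Lemma cdr_lmul b c f x : fl c * cdr b f x = c (tgt b) *: cdr b f x.
Proof.
rewrite /cdr insMl -insZl; congr ins; apply/funext => -[u v].
rewrite /lmulK /= fl_lmul /lsl /swapK /=.
by have [->//|h] := eqVneq (pstart u) (tgt b); rewrite dkerN ?h // !mulr0.
Qed.

Lemma cdr_rmul b c f x : cdr b f x * fl c = c (src b) *: cdr b f x.
Proof.
rewrite /cdr insMr -insZl; congr ins; apply/funext => -[u v].
rewrite /rmulK /= fl_rmul /rsl /swapK /= mulrC.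
by have [->//|h] := eqVneq (pend v) (src b); rewrite dkerN ?h ?orbT // !mulr0.
Qed.

(* The continuous derivation mapping each arrow [a] to [xi a]. *)
Definition vder (xi : arrow Q -> fser) f : fser := \sum_a ins (dker a f) (xi a).

Section Derivations.
Variable xi : arrow Q -> fser.
Local Notation d := (vder xi).

Lemma vderD f g : d (f + g) = d f + d g.
Proof.
rewrite /vder -big_split; apply: eq_bigr => a _ /=; rewrite -insDl.
by congr ins; apply/funext => uv; exact: dkerD.
Qed.

Lemma vderZ (c : K) f : d (c *: f) = c *: d f.
Proof.
rewrite /vder scaler_sumr; apply: eq_bigr => a _; rewrite -insZl.
by congr ins; apply/funext => uv; exact: dkerZ.
Qed.

Lemma vder0 : d 0 = 0.
Proof. by rewrite -(scale0r 0) vderZ !scale0r. Qed.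

Lemma vderN f : d (- f) = - d f.
Proof. by rewrite -scaleN1r vderZ scaleN1r. Qed.

Lemma vderB f g : d (f - g) = d f - d g.
Proof. by rewrite vderD vderN. Qed.

Lemma vder_sum (I : Type) (r : seq I) (F : I -> fser) :
  d (\sum_(j <- r) F j) = \sum_(j <- r) d (F j).
Proof. exact: (big_morph d vderD vder0). Qed.

Lemma vderM f g : d (f * g) = d f * g + f * d g.
Proof.
rewrite /vder mulr_sumr mulr_suml -big_split; apply: eq_bigr => a _.
by rewrite /= dkerM insDl insMl insMr addrC.
Qed.

Lemma vder_fl c : d (fl c) = 0.
Proof.
rewrite /vder big1 // => a _; rewrite -(ins0l (xi a)); congr ins.
by apply/funext => uv; exact: dker_fl.
Qed.

Lemma vder_arr a : d (arr a) = cut a (xi a).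
Proof.
rewrite /vder (bigD1 a) //= big1 ?addr0 => [|b /negbTE ba].
  rewrite /cut -ins_tensor; congr ins.
  by apply/funext => uv; rewrite dker_arr eqxx.
rewrite -(ins0l (xi b)); congr ins.
by apply/funext => uv; rewrite dker_arr eq_sym ba.
Qed.

Lemma ordge_vder_pred k f : ordge k f -> ordge k.-1 (d f).
Proof.
move=> hf; apply: ordge_sum => a _; rewrite -[k.-1]addn0.
by apply: ordge_ins => // uv; exact: dker_ord.
Qed.

End Derivations.

Lemma cdr_cut b a f x : cdr b (cut a f) x = cdr b f (ev (tgt a) * x * ev (src a)).
Proof. by rewrite /cut !cdrM !cdr_fl addr0 add0r. Qed.

Section Chain.
Variable h : arrow Q -> fser.
Hypothesis h1 : forall a, ordge 1 (h a).
Hypothesis hpar : forall a, par a (h a).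
Local Notation H := (sub h).

(* Downward induction on the order of [g]: the cyclic Leibniz rule moves the
   letters of [f] into [g]. *)
Lemma cdr_sub b f g : cdr b (H f) (H g) = \sum_a cdr b (h a) (H (cdr a f g)).
Proof.
apply/eqP; rewrite -subr_eq0; apply/eqP/ordge_inf => n.
have [k kn] : {k | (n - k <= k)%N} by exists n; rewrite subnn.
suff: forall m f g, ordge (n - m) g ->
   ordge n (cdr b (H f) (H g) - \sum_a cdr b (h a) (H (cdr a f g))).
  by move=> /(_ n f g); apply; rewrite subnn.
move=> {k kn} m; elim: m => [|m IH] {}f {}g.
  rewrite subn0 => gn; apply: ordgeB; first exact/ordge_ins0/ordge_sub.
  by apply: ordge_sum => a _; apply/ordge_ins0/ordge_sub => //; exact: ordge_ins0.
move=> gn; rewrite (sub_rec h1) cdrDl cdr_fl add0r cdr_suml.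
have -> : \sum_a cdr b (h a) (H (cdr a f g)) =
  \sum_c (cdr b (h c) (H (lder c f * g)) +
     \sum_a cdr b (h a) (H (cdr a (lder c f) (g * arr c)))).
  rewrite big_split exchange_big -big_split; apply: eq_bigr => a _ /=.
  rewrite [in LHS](fser_decomp f) cdrDl cdr_fl add0r cdr_suml.
  rewrite (eq_bigr _ (fun j _ => cdrM a (arr j) (lder j f) g)).
  rewrite big_split /= subD sub_sum // cdrDr cdr_sumr; congr (_ + _).
  rewrite (bigD1 a) //= big1 ?addr0; last first.
    by move=> c /negbTE ca; rewrite cdr_arr ca sub0 cdr0r.
  - rewrite cdr_arr eqxx !subM // !sub_fl //.
    by rewrite -cdr_cut cut_par.
  by rewrite sub_sum // cdr_sumr.
rewrite -sumrB; apply: ordge_sum => c _.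
rewrite cdrM -subM // opprD addrACA subrr add0r.
rewrite -{1}(sub_arr h1 hpar c) -subM //; apply: IH.
apply: ordge_le (ordgeM gn (@ordge_arr _ _ c)).
by rewrite subnS addn1 leqSpred.
Qed.
End Chain.

(* The infinitesimal version of [cdr_sub]. *)
Lemma cdr_vder xi b f g : (forall a, par a (xi a)) ->
  cdr b (vder xi f) g + cdr b f (vder xi g) =
  vder xi (cdr b f g) + \sum_a cdr b (xi a) (cdr a f g).
Proof.
move=> hpar; apply/eqP; rewrite -subr_eq0; apply/eqP/ordge_inf => n.
pose E f g : fser := cdr b (vder xi f) g + cdr b f (vder xi g) -
  (vder xi (cdr b f g) + \sum_a cdr b (xi a) (cdr a f g)).
(* The base case starts from order [n.+1], not [n], because [vder xi] may lose one degree: the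
   [xi a] may have constant terms. *)
suff: forall m f g, ordge (n.+1 - m) g -> ordge n (E f g).
  by move=> /(_ n.+1 f g); apply; rewrite subnn.
elim=> [|m IH] {}f {}g; rewrite /E.
  rewrite subn0 => gn; have gn' := ordge_le (leqnSn n) gn.
  apply: ordgeB; apply: ordgeD.
  - exact: ordge_ins0.
  - by apply: ordge_ins0; exact: (@ordge_vder_pred _ n.+1).
  - by apply: (@ordge_vder_pred _ n.+1); exact: ordge_ins0.
  - by apply: ordge_sum => a _; do 2 apply: ordge_ins0.
move=> gn.
have E0 c y : E (fl c) y = 0.
  rewrite /E vder_fl !cdr_fl cdr0l vder0 !add0r big1 ?oppr0 // => a _.
  by rewrite cdr_fl cdr0r.
have ED x y z : E (x + y) z = E x z + E y z.
  rewrite /E vderD !cdrDl vderD.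
  under eq_bigr do rewrite cdrDl cdrDr.
  rewrite big_split /=.
  by apply/funext => p; rewrite !(fserDE, fserNE); ring.
have Es (F : arrow Q -> fser) z : E (\sum_c F c) z = \sum_c E (F c) z.
  apply: (big_morph (E ^~ z)) => [x y|]; first exact: ED.
  by have := E0 (fun=> 0) z; congr (E _ _ = _); apply/funext => p; rewrite /fl if_same.
rewrite -/(E f g) (fser_decomp f) ED E0 add0r Es; apply: ordge_sum => c _.
(* A cocycle identity: the first letter of [f] is moved cyclically behind [g], whose order it
   raises. *)
have -> : E (arr c * lder c f) g = E (arr c) (lder c f * g) + E (lder c f) (g * arr c).
  rewrite /E !vderM !cdrM !cdrDl !cdrM !cdrDr !vderD.
  under eq_bigr do rewrite cdrM cdrDr.
  rewrite big_split /=.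
  by apply/funext => p; rewrite !(fserDE, fserNE); ring.
have -> : E (arr c) (lder c f * g) = 0.
  move: (lder c f * g) => x; rewrite /E vder_arr cut_par // !cdr_arr.
  have -> : vder xi (if c == b then ev (tgt b) * x * ev (src b) else 0) =
      if c == b then ev (tgt b) * vder xi x * ev (src b) else 0.
    by case: eqP => _; rewrite ?vder0 // !vderM !vder_fl mul0r mulr0 add0r addr0.
  rewrite (bigD1 c) //= big1 ?addr0 => [|a /negbTE ac].
    by rewrite cdr_arr eqxx -cdr_cut cut_par // [X in _ - X]addrC subrr.
  by rewrite cdr_arr eq_sym ac cdr0r.
rewrite add0r; apply: IH; apply: ordge_le (ordgeM gn (@ordge_arr _ _ c)).
by rewrite subnS addn1 leqSpred.
Qed.

End Kernels.

(** * Majorant estimates *)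

Section Estimates.
Variables (K : numClosedFieldType) (Q : quiver).
Local Notation fser := (fseries K Q).
Local Notation analytic := (@analytic K Q).
Implicit Types (f g x y : fser) (p q : qpath Q) (a b : arrow Q).
Implicit Types (r c C D M L : K).

Lemma geo_le N (x : K) : 0 <= x -> x *+ 2 <= 1 -> \sum_(n < N) x ^+ n <= 2%:R.
Proof.
move=> x0 x1; elim: N => [|N IH]; first by rewrite big_ord0.
rewrite big_ord_recl expr0 -[X in _ <= X]/(1 + 1) lerD2l.
under eq_bigr do rewrite exprS.
rewrite -mulr_sumr; apply: le_trans x1; rewrite -mulr_natr; exact: ler_wpM2l.
Qed.

Lemma sum_widen_le n N (G : nat -> K) : (n <= N)%N -> (forall j, 0 <= G j) ->
  \sum_(j < n) G j <= \sum_(j < N) G j.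
Proof.
move=> nN G0; rewrite -(subnKC nN) big_split_ord /= lerDl.
exact: sumr_ge0.
Qed.

(* The weighted [l^1] norm of a majorant of [f], truncated at [N], is at most
   [c]: majorants depending on the length only make the norm submultiplicative
   whatever the quiver, and truncation makes it available for fixpoint
   iterations before their limit is known to be analytic. *)
Definition bnd N r c f := exists F : nat -> K,
  [/\ forall n, 0 <= F n,
      forall p, (plen p < N)%N -> `|f p| <= F (plen p) &
      \sum_(n < N) F n * r ^+ n <= c].

Lemma bnd_le N r c c' f : c <= c' -> bnd N r c f -> bnd N r c' f.
Proof. by move=> cc [F [F0 Ff Fc]]; exists F; split=> //; exact: le_trans cc. Qed.

Lemma bndN0 r c f : 0 <= c -> bnd 0 r c f.
Proof. by move=> c0; exists (fun=> 0); split=> //; rewrite big_ord0. Qed.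

Lemma bnd_coef N r c f p : 0 < r -> (plen p < N)%N -> bnd N r c f ->
  `|f p| <= c * r^-1 ^+ plen p.
Proof.
move=> r0 pN [F [F0 Ff Fc]]; apply: le_trans (Ff p pN) _.
rewrite exprVn ler_pdivlMr ?exprn_gt0 //; apply: le_trans Fc.
rewrite (bigD1 (Ordinal pN)) //= lerDl sumr_ge0 // => n _.
by rewrite mulr_ge0 // exprn_ge0 // ltW.
Qed.

Section Fixed.
Variable r : K.
Hypothesis r0 : 0 <= r.

Lemma bnd_ge0 N c f : bnd N r c f -> 0 <= c.
Proof.
move=> [F [F0 _ Fc]]; apply: le_trans Fc; apply: sumr_ge0 => n _.
by rewrite mulr_ge0 // exprn_ge0.
Qed.

Lemma bnd_dom N c f g : (forall p, `|g p| <= `|f p|) -> bnd N r c f -> bnd N r c g.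
Proof.
move=> gf [F [F0 Ff Fc]]; exists F; split=> // p pN.
exact: le_trans (gf p) (Ff p pN).
Qed.

Lemma bndD N c d f g : bnd N r c f -> bnd N r d g -> bnd N r (c + d) (f + g).
Proof.
move=> [F [F0 Ff Fc]] [G [G0 Gf Gc]]; exists (fun n => F n + G n); split.
- by move=> n; rewrite addr_ge0.
- move=> p pN; rewrite fserDE; apply: le_trans (ler_normD _ _) _.
  by rewrite lerD // (Ff, Gf).
under eq_bigr do rewrite mulrDl.
by rewrite big_split lerD.
Qed.

Lemma bndN N c f : bnd N r c f -> bnd N r c (- f).
Proof. by apply: bnd_dom => p; rewrite fserNE normrN. Qed.

Lemma bnd_zero N c : 0 <= c -> bnd N r c 0.
Proof.
move=> c0; exists (fun=> 0); split=> // [p _|]; first by rewrite normr0.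
by rewrite big1 // => n _; rewrite mul0r.
Qed.

Lemma bndZ N c (z : K) f : bnd N r c f -> bnd N r (`|z| * c) (z *: f).
Proof.
move=> [F [F0 Ff Fc]]; exists (fun n => `|z| * F n); split.
- by move=> n; rewrite mulr_ge0.
- by move=> p pN; rewrite fserZE normrM ler_wpM2l // Ff.
under eq_bigr do rewrite -mulrA.
by rewrite -mulr_sumr ler_wpM2l.
Qed.

Lemma bnd_sum N c (I : finType) (F : I -> fser) :
  (forall j, bnd N r c (F j)) -> bnd N r (#|I|%:R * c) (\sum_j F j).
Proof.
move=> h; rewrite -sum1_card natr_sum mulr_suml.
elim/big_rec2: _ => [|j x y _ xy]; first exact: bnd_zero.
by rewrite mul1r; exact: bndD.
Qed.

(* The factor [k] has no constant term, which costs one degree of truncation. *)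
Lemma bndM1 N c d k g : ordge 1 k -> bnd N.+1 r c k -> bnd N r d g ->
  bnd N.+1 r (c * d) (k * g).
Proof.
move=> k1 [F [F0 Ff Fc]] [G [G0 Gf Gc]].
pose F' (n : nat) := if n == 0%N then 0 else F n.
have F'0 n : 0 <= F' n by rewrite /F'; case: ifP.
have FF' n : F' n <= F n by rewrite /F'; case: ifP.
exists (fun n => \sum_(j < n.+1) F' j * G (n - j)%N); split.
- by move=> n; apply: sumr_ge0 => j _; rewrite mulr_ge0.
- move=> p pN; rewrite fserME; apply: le_trans (ler_norm_sum _ _ _) _.
  apply: ler_sum => j _; have jp : (j <= plen p)%N by rewrite -ltnS.
  rewrite normrM /F'; case: eqP => [j0|/eqP j0].
    by rewrite [k _]k1 ?normr0 ?mul0r // plen_take // j0.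
  apply: ler_pM => //.
    by rewrite -{2}(plen_take jp) Ff // plen_take // (leq_ltn_trans jp).
  by rewrite -plen_drop Gf // plen_drop; lia.
pose T (i n : nat) := (F' i * r ^+ i) * (G (n - i)%N * r ^+ (n - i)).
rewrite (eq_bigr (fun n : 'I_N.+1 => \sum_(i < n.+1) T i n)); last first.
  move=> n _; rewrite mulr_suml; apply: eq_bigr => i _; rewrite /T.
  have i_n : (i <= n)%N by rewrite -ltnS.
  by rewrite mulrACA -exprD subnKC.
rewrite -sum_exchange.
apply: le_trans (_ : \sum_(i < N.+1) (F' i * r ^+ i) * d <= _).
  apply: ler_sum => i _; rewrite /T.
  under eq_bigr do rewrite addKn.
  rewrite -mulr_sumr {1 2}/F'; case: eqP => [_|/eqP i0]; first by rewrite !mul0r.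
  apply: ler_wpM2l; first by rewrite mulr_ge0 ?exprn_ge0.
  apply: le_trans Gc.
  have iN : ((N - i).+1 <= N)%N by have := ltn_ord i; lia.
  apply: (@sum_widen_le _ _ (fun j => G j * r ^+ j) iN) => j; by rewrite mulr_ge0 ?exprn_ge0.
rewrite -mulr_suml; apply: ler_wpM2r.
  apply: le_trans Gc; apply: sumr_ge0 => j _.
  by rewrite mulr_ge0 ?exprn_ge0.
apply: le_trans Fc; apply: ler_sum => j _; apply: ler_wpM2r => //.
exact: exprn_ge0.
Qed.

(** As [D r] is at most [1/2], summing the geometric tail from degree [m] on costs a factor two. For
    [m = 1] the bound is proportional to [r], which is how series without constant term are made
    small. *)
Lemma bnd_exp m N L D f : 0 <= L -> 0 <= D -> (D * r) *+ 2 <= 1 -> ordge m f ->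
  (forall p, `|f p| <= L * D ^+ plen p) -> bnd N r (L * (D * r) ^+ m *+ 2) f.
Proof.
move=> L0 D0 Dr fm hf.
exists (fun n => if (n < m)%N then 0 else L * D ^+ n); split.
- by move=> n; case: ifP => // _; rewrite mulr_ge0 ?exprn_ge0.
- by move=> p _; case: ifP => // pm; rewrite fm // normr0.
have Dr0 : 0 <= D * r by exact: mulr_ge0.
apply: le_trans (_ : \sum_(n < N) (L * (D * r) ^+ m) * (if (n < m)%N then 0 else (D * r) ^+ (n - m)) <= _).
  apply: ler_sum => n _; case: ltnP => nm; first by rewrite mul0r mulr0.
  by rewrite -!mulrA -exprD subnKC // exprMn.
rewrite -mulr_sumr -mulr_natr; apply: ler_wpM2l.
  by rewrite mulr_ge0 ?exprn_ge0.
have := @geo_le N _ Dr0 Dr; apply: le_trans.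
have [Nm|mN] := leqP N m.
  rewrite big1 ?sumr_ge0 // => n _; rewrite ?exprn_ge0 //.
  by rewrite (leq_trans (ltn_ord n) Nm).
rewrite -(big_mkord xpredT (fun n => if (n < m)%N then 0 else (D * r) ^+ (n - m))).
rewrite (big_cat_nat _ (n := m)) ?(ltnW mN) //= big_nat big1 ?add0r; last first.
  by move=> n /andP[_ ->].
rewrite -[m in X in X <= _]add0n big_addn big_mkord.
apply: le_trans (@sum_widen_le _ _ (fun n => (D * r) ^+ n) (leq_subr m N) _); last first.
  by move=> n; exact: exprn_ge0.
by apply: ler_sum => n _; rewrite addnK ltnNge leq_addl.
Qed.

Lemma fl_const_bnd f p : `|fl (const f) p| <= (if plen p == 0%N then `|f p| else 0).
Proof.
by rewrite /fl; case: ifP => [/eqP/trivE e|]; rewrite ?normr0 // e.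
Qed.

Lemma lder_bnd M C a f : 0 <= M -> 0 <= C -> (forall p, `|f p| <= M * C ^+ plen p) ->
  forall p, `|lder a f p| <= (M * C) * C ^+ plen p.
Proof.
move=> M0 C0 hf p; have R : 0 <= M * C * C ^+ plen p by rewrite !mulr_ge0 ?exprn_ge0.
rewrite /lder; case: ifP => _; rewrite ?normr0 //.
rewrite /fcoef; case: insubP => [q _ qE|] /=; last by rewrite normr0.
apply: le_trans (hf q) _; rewrite /plen [parrows q]/parrows qE /= -/(plen p).
by rewrite exprS mulrA.
Qed.

(** Passing from [f] to [lder a f] multiplies [M] by [C], and the factor [h a] contributes [c].
    Summed over the arrows, each round of [sub_rec] at least halves the bound, whence
    [M (1 + 1/2 + 1/4 + ...)]. *)
Lemma bnd_sub h c C M f : (forall a, ordge 1 (h a)) ->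
  (forall N a, bnd N r c (h a)) -> 0 <= M -> 0 <= C ->
  (#|arrow Q|%:R * C * c) *+ 2 <= 1 -> (forall p, `|f p| <= M * C ^+ plen p) ->
  forall N, bnd N r (M *+ 2) (sub h f).
Proof.
move=> h1 hb M0 C0 small hf N; elim: N M M0 f hf => [|N IH] M M0 f hf.
  by apply: bndN0; rewrite mulrn_wge0.
rewrite sub_rec //; have MC : 0 <= M * C by exact: mulr_ge0.
apply: (@bnd_le _ _ (M + #|arrow Q|%:R * (c * (M * C *+ 2)))).
  rewrite [X in _ <= X]mulr2n lerD2l.
  rewrite (_ : _ * _ = M * (#|arrow Q|%:R * C * c *+ 2)); last by ring.
  by rewrite ler_piMr.
apply: bndD.
  exists (fun n => if n == 0%N then M else 0); split.
  - by move=> n; case: ifP.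
  - move=> p _; apply: le_trans (fl_const_bnd _ _) _; case: eqP => // p0.
    by have := hf p; rewrite p0 mulr1.
  rewrite big_ord_recl /= mulr1 big1 ?addr0 // => n _.
  by rewrite mul0r.
by apply: bnd_sum => a; apply: bndM1 => //; apply: IH => //; exact: lder_bnd.
Qed.

(** The first [m] rounds of the recursion meet no constant term and only contribute their factors.
    The case [m = 2] is the quadratic smallness behind the inverse function theorem. *)
Lemma bnd_sub_ord h c C M f m : (forall a, ordge 1 (h a)) ->
  (forall N a, bnd N r c (h a)) -> 0 <= M -> 0 <= C ->
  (#|arrow Q|%:R * C * c) *+ 2 <= 1 -> (forall p, `|f p| <= M * C ^+ plen p) ->
  ordge m f ->
  forall N, bnd N r ((M * (#|arrow Q|%:R * C * c) ^+ m) *+ 2) (sub h f).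
Proof.
move=> h1 hb M0 C0 small hf fm N.
elim: m N M M0 f hf fm => [|m IH] N M M0 f hf fm.
  rewrite mulr1; exact: (bnd_sub h1 hb M0 C0 small hf).
have [a0|noa] := pickP (@predT (arrow Q)); last first.
  rewrite sub_rec // big_pred0 // addr0 (_ : fl _ = 0).
    by rewrite eq_card0 // !mul0r exprS !mul0r mulr0 mul0rn; exact: bnd_zero.
  by apply/funext => p; rewrite /fl; case: ifP => // _; rewrite /const fm.
move=> _; have c0 := bnd_ge0 (hb 0%N a0).
case: N => [|N].
  apply: bndN0; rewrite mulrn_wge0 // mulr_ge0 // exprn_ge0 //.
  by rewrite !mulr_ge0.
rewrite sub_rec // (_ : fl _ = 0) ?add0r; last first.
  by apply/funext => p; rewrite /fl; case: ifP => // _; rewrite /const fm.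
have MC : 0 <= M * C by exact: mulr_ge0.
rewrite (_ : _ *+ 2 = #|arrow Q|%:R * (c * ((M * C) * (#|arrow Q|%:R * C * c) ^+ m *+ 2))).
  apply: bnd_sum => a; apply: bndM1 => //; apply: IH => //; first exact: lder_bnd.
  exact: (ordge_lder (k := m.+1)).
by rewrite exprS; ring.
Qed.

End Fixed.

Lemma growth_fin (I : finType) (T : eqType) (sz : T -> nat) (A : I -> T -> K) :
  (forall N, exists s : seq T, forall t, (sz t < N)%N -> t \in s) ->
  (forall j, growth sz (A j)) -> exists2 C : K, 1 <= C &
  exists2 M : K, 0 <= M & forall j t, `|A j t| <= M * C ^+ sz t.
Proof.
move=> fin hA.
have /fin_all_exists[F hF] j : exists CM : K * K, [/\ 1 <= CM.1, 0 <= CM.2 &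
    forall t, `|A j t| <= CM.2 * CM.1 ^+ sz t].
  by have [C C1 [M M0 h]] := growth_all fin (hA j); exists (C, M).
have F0 j : 0 <= (F j).1 by have [h _ _] := hF j; exact: le_trans h.
have F2 j : 0 <= (F j).2 by have [_ h _] := hF j.
exists (1 + \sum_j (F j).1); first by rewrite lerDl sumr_ge0.
exists (\sum_j (F j).2); first exact: sumr_ge0.
move=> j t; have [_ _ h] := hF j; apply: le_trans (h t) _.
apply: ler_pM => //; first exact: exprn_ge0.
  by rewrite (bigD1 j) //= lerDl sumr_ge0.
apply: lerXn2r; rewrite ?nnegrE ?addr_ge0 ?sumr_ge0 //.
by rewrite (bigD1 j) //= addrCA lerDl addr_ge0 ?sumr_ge0.
Qed.

Lemma analytic_fin (I : finType) (F : I -> fser) :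
  (forall j, F j \in analytic) -> exists2 C : K, 1 <= C &
  exists2 M : K, 0 <= M & forall j p, `|F j p| <= M * C ^+ plen p.
Proof.
move=> h; apply: (growth_fin (@short_paths Q)) => j.
by apply/asboolP; exact: h.
Qed.

Lemma analytic_of C M f : 0 <= C -> 0 <= M -> (forall p, `|f p| <= M * C ^+ plen p) ->
  f \in analytic.
Proof.
move=> C0 M0 hf; apply/asboolP; apply: (@growth_of _ _ _ _ (1 + C) M) => //.
  by rewrite lerDl.
move=> p; apply: le_trans (hf p) _; apply: ler_pM; rewrite ?exprn_ge0 //.
  by rewrite -[leLHS]mul1r ler_wpM2r // ler1n.
by apply: lerXn2r; rewrite ?nnegrE ?addr_ge0 // lerDr.
Qed.

Lemma analytic1 f : f \in analytic -> exists2 C : K, 1 <= C &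
  exists2 M : K, 0 <= M & forall p, `|f p| <= M * C ^+ plen p.
Proof. by move=> /asboolP/(growth_all (@short_paths Q)). Qed.

Lemma bnd_analytic r c f : 0 < r -> (forall N, bnd N r c f) -> f \in analytic.
Proof.
move=> r0 hf; apply: (@analytic_of r^-1 c).
- by rewrite invr_ge0 ltW.
- exact (bnd_ge0 (ltW r0) (hf 0%N)).
by move=> p; exact: bnd_coef (ltnSn _) (hf _).
Qed.

Lemma bnd_small (I : finType) (h : I -> fser) c : 0 < c ->
  (forall j, ordge 1 (h j)) -> (forall j, h j \in analytic) ->
  exists2 r : K, 0 < r & forall N j, bnd N r c (h j).
Proof.
move=> c0 h1 /analytic_fin[D D1 [L L0 hL]].
have D0 : 0 < D by exact: lt_le_trans D1.
have Lc : 0 < L + c by rewrite ltr_wpDl.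
(* For this radius [D r] is [c / (2 (L + c))]: it is at most [1/2], and the bound [2 L D r] of
   [bnd_exp] is at most [c]. *)
have E : D * (c / (D * (L + c) *+ 2)) = c / (L + c) / 2%:R.
  by field; rewrite !gt_eqF ?pnatr_eq0.
have r0 : 0 < c / (D * (L + c) *+ 2).
  by rewrite divr_gt0 // mulrn_wgt0 // mulr_gt0.
exists (c / (D * (L + c) *+ 2)) => // N j.
have small : D * (c / (D * (L + c) *+ 2)) *+ 2 <= 1.
  by rewrite E -mulr_natr divfK ?pnatr_eq0 // ler_pdivrMr // mul1r lerDr.
refine (bnd_le _ (bnd_exp (ltW r0) N L0 (ltW D0) small (h1 j) (hL j))).
rewrite E expr1 -mulr_natr mulrA divfK ?pnatr_eq0 // mulrA ler_pdivrMr //.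
by rewrite mulrDr mulrC lerDl mulr_ge0 ?ltW.
Qed.

Lemma bnd_mono N r r' c f : 0 <= r' -> r' <= r -> bnd N r c f -> bnd N r' c f.
Proof.
move=> r'0 rr [F [F0 Ff Fc]]; exists F; split=> //; apply: le_trans Fc.
apply: ler_sum => n _; apply: ler_wpM2l => //.
by apply: lerXn2r; rewrite ?nnegrE // (le_trans r'0).
Qed.

Lemma bnd_ex (I : finType) (e : I -> fser) : (forall j, e j \in analytic) ->
  exists2 M : K, 0 <= M & exists2 r : K, 0 < r & forall N j, bnd N r M (e j).
Proof.
move=> /analytic_fin[D D1 [L L0 hL]]; have D0 : 0 < D by exact: lt_le_trans D1.
exists (L *+ 2); first by rewrite mulrn_wge0.
exists (D *+ 2)^-1; first by rewrite invr_gt0 mulrn_wgt0.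
move=> N j; have := @bnd_exp (D *+ 2)^-1 _ 0 N L D (e j) L0 (ltW D0).
rewrite mulr1; apply => //.
  by rewrite invr_ge0 mulrn_wge0 // ltW.
by rewrite -mulrnAl mulfV // mulrn_eq0 /= gt_eqF.
Qed.

Lemma sub_analytic h f : (forall a, ordge 1 (h a)) ->
  (forall a, h a \in analytic) -> f \in analytic ->
  sub h f \in analytic.
Proof.
move=> h1 han /analytic1[C C1 [M M0 hM]].
have C0 : 0 < C by exact: lt_le_trans C1.
pose n0 : K := 1 + #|arrow Q|%:R.
have n00 : 0 < n0 by rewrite ltr_wpDr.
have c0 : 0 < (n0 * C *+ 2)^-1 by rewrite invr_gt0 mulrn_wgt0 // mulr_gt0.
have [r r0 hb] := bnd_small c0 h1 han.
apply: (bnd_analytic r0) => N; move: N; apply: (bnd_sub (ltW r0) h1 hb M0 (ltW C0)) hM.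
rewrite -mulrnAl ler_pdivrMr ?mulrn_wgt0 // ?mulr_gt0 // mul1r.
by rewrite lerMn2r /= ler_wpM2r ?(ltW C0) // lerDr.
Qed.

(** A diagonal limit: if [s n.+1 - s n] has order [n] for all [n], the coefficients of the paths of
    length [n] are stationary from stage [n.+1] on. *)
Definition flim (s : nat -> fser) : fser := fun p => s (plen p).+1 p.

Lemma flim_ord (s : nat -> fser) : (forall n, ordge n (s n.+1 - s n)) ->
  forall n, ordge n (flim s - s n).
Proof.
move=> hs n p pn; rewrite fserDE fserNE /flim.
have [m ->] : exists m, n = ((plen p).+1 + m)%N by exists (n - (plen p).+1)%N; lia.
elim: m => [|m IH]; first by rewrite addn0 subrr.
have := hs ((plen p).+1 + m)%N p (leq_addr _ _).
by rewrite fserDE fserNE addnS => /eqP; rewrite subr_eq0 => /eqP ->.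
Qed.

Lemma flim_bnd (s : nat -> fser) r c : 0 < r -> (forall n N, bnd N r c (s n)) ->
  flim s \in analytic.
Proof.
move=> r0 h; apply: (@analytic_of r^-1 c).
- by rewrite invr_ge0 ltW.
- exact (bnd_ge0 (ltW r0) (h 0%N 0%N)).
by move=> p; exact: bnd_coef (ltnSn _) (h _ _).
Qed.

Lemma flim_ordge (s : nat -> fser) k : (forall n, ordge k (s n)) -> ordge k (flim s).
Proof. by move=> h p pk; exact: h. Qed.

Section Neumann.
Variables (I : finType) (c : I -> I -> fser) (e : I -> fser).
Hypothesis c1 : forall i j, ordge 1 (c i j).
Hypothesis can : forall i j, c i j \in analytic.
Hypothesis ean : forall i, e i \in analytic.

Fixpoint neumann n i : fser :=
  if n is n'.+1 then e i + \sum_j c i j * neumann n' j else 0.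

Lemma neumann_step n i : ordge n (neumann n.+1 i - neumann n i).
Proof.
elim: n i => [//|n IH] i /=.
rewrite opprD addrACA subrr add0r -sumrB; apply: ordge_sum => j _.
by rewrite -mulrBr -[n.+1]add1n; apply: ordgeM => //; exact: IH.
Qed.

(** At a radius where the entries of [c] have norm at most [1 / (2 n0)], all the iterates stay in
    the ball of radius [2 M]; their coefficients, hence those of the limit, are thereby bounded
    geometrically. *)
Lemma neumann_solve : exists2 G : I -> fser,
  forall i, G i \in analytic &
  forall i, G i = e i + \sum_j c i j * G j.
Proof.
exists (fun i => flim (neumann ^~ i)) => i; last first.
  apply/eqP; rewrite -subr_eq0; apply/eqP/ordge_inf => n.
  have -> : flim (neumann^~ i) - (e i + \sum_j c i j * flim (neumann^~ j)) =
     (flim (neumann^~ i) - neumann n.+1 i) - \sum_j c i j * (flim (neumann^~ j) - neumann n j).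
    rewrite (eq_bigr _ (fun j _ => mulrBr _ _ _)) sumrB /=.
    by apply/funext => p; rewrite !(fserDE, fserNE); ring.
  apply: ordgeB; first exact: ordge_le (leqnSn n) (@flim_ord (neumann^~ i) (fun n => @neumann_step n i) n.+1).
  apply: ordge_sum => j _; apply: ordgeMl.
  exact: (@flim_ord (neumann^~ j) (fun n => @neumann_step n j) n).
have [M M0 [r1 r10 he]] := bnd_ex ean.
pose n0 : K := 1 + #|I|%:R.
have n00 : 0 < n0 by rewrite ltr_wpDr.
have eps0 : 0 < (n0 *+ 2)^-1 by rewrite invr_gt0 mulrn_wgt0.
have [r2 r20 hc] : exists2 r : K, 0 < r &
    forall N (ij : I * I), bnd N r (n0 *+ 2)^-1 (c ij.1 ij.2).
  apply: bnd_small eps0 _ _ => ij; [exact: c1|exact: can].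
have r120 : 0 < r1 + r2 by rewrite addr_gt0.
(* A radius below both [r1] and [r2] that avoids comparing them in the partially ordered field. *)
pose r : K := r1 * r2 / (r1 + r2).
have r0 : 0 < r by rewrite divr_gt0 ?mulr_gt0.
have rr1 : r <= r1 by rewrite ler_pdivrMr // mulrDr lerDr mulr_ge0 // ltW.
have rr2 : r <= r2 by rewrite ler_pdivrMr // mulrC mulrDr lerDl mulr_ge0 // ltW.
apply: (@flim_bnd _ r (M *+ 2)) => // n; elim: n i => [|n IH] i N.
  by apply: bnd_zero; rewrite mulrn_wge0.
case: N => [|N]; first by apply: bndN0; rewrite mulrn_wge0.
apply: (@bnd_le _ _ (M + #|I|%:R * ((n0 *+ 2)^-1 * (M *+ 2)))).
  rewrite [X in _ <= X]mulr2n lerD2l.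
  rewrite (_ : _ * _ = M * (#|I|%:R / n0)); last first.
    by field; rewrite gt_eqF.
  by rewrite ler_piMr // ler_pdivrMr // mul1r lerDr.
apply: bndD; first exact: bnd_mono (ltW r0) rr1 (he _ _).
apply: bnd_sum => j; apply: (bndM1 (ltW r0)) => //.
exact: bnd_mono (ltW r0) rr2 (hc _ (i, j)).
Qed.
End Neumann.
End Estimates.

(** * The analytic inverse function theorem *)

Lemma subrBB (V : zmodType) (u x y : V) : u - x - (u - y) = - (x - y).
Proof. by rewrite !opprB addrC addrA subrK. Qed.

Section Inverse.
Variables (K : numClosedFieldType) (Q : quiver).
Local Notation fser := (fseries K Q).
Local Notation ev := (@ev K Q).
Local Notation arr := (@arr K Q).
Local Notation analytic := (@analytic K Q).
Implicit Types (f g x y : fser) (p q : qpath Q) (a b c : arrow Q).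

Lemma arr_walk a : walk (src a) [:: a]. Proof. by rewrite /= eqxx. Qed.

Definition apath a : qpath Q := @QPath Q (src a, [:: a]) (arr_walk a).

Definition lin f a : K := f (apath a).

Lemma apathP p : plen p = 1%N -> exists a, p = apath a.
Proof.
rewrite /plen; case E: (parrows p) => [|a [|]] // _; exists a.
by apply: qpath_eqP; rewrite // (arr_src E).
Qed.

Lemma lin_arr a b : lin (arr a) b = (b == a)%:R.
Proof. by rewrite /lin /arr /parrows /= eqseq_cons andbT. Qed.

Lemma lin_par a f b : par a f ->
  ~~ ((src b == src a) && (tgt b == tgt a)) -> lin f b = 0.
Proof. by move=> fa ab; apply: fa. Qed.

Lemma linM f g b : ordge 1 f -> lin (f * g) b = lin f b * const g (tgt b).
Proof.
move=> f1; rewrite /lin fserME big_ord_recr big_ord1 /= [f _]f1 // mul0r add0r.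
by congr (f _ * g _); apply: qpath_eqP.
Qed.

Lemma const_sub h f i : (forall a, ordge 1 (h a)) -> const (sub h f) i = const f i.
Proof.
move=> h1; rewrite sub_rec // /const fserDE fser_sumE big1 ?addr0 // => a _.
exact: (@ordgeMr _ _ 1 (h a) (sub h (lder a f)) (h1 a)).
Qed.

Lemma const_lder a f : const (lder a f) (tgt a) = lin f a.
Proof. by rewrite /const /lder eqxx /= (@fcoef_p _ _ f (apath a)). Qed.

Lemma const_lderN a f i : i != tgt a -> const (lder a f) i = 0.
Proof. by rewrite /const /lder => /negbTE ->. Qed.

Lemma lin_sub k f b : (forall a, ordge 1 (k a)) -> (forall a, par a (k a)) ->
  lin (sub k f) b = \sum_a lin f a * lin (k a) b.
Proof.
move=> k1 kp; rewrite sub_rec // /lin fserDE fser_sumE {1}/fl /= add0r.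
apply: eq_bigr => a _; rewrite -/(lin _ _) linM // const_sub // mulrC.
have [tb|tb] := eqVneq (tgt b) (tgt a).
  by rewrite tb const_lder.
by rewrite const_lderN // mul0r -/(lin (k a) b) (lin_par (@kp a)) ?mulr0 // (negbTE tb) andbF.
Qed.

(** Changing one letter of a path with at least [l + 1] letters gives the order [m], and the other
    letters contribute [l]. For [f] of order two this is a contraction. *)
Lemma sub_close k k' m l f : (forall a, ordge 1 (k a)) -> (forall a, ordge 1 (k' a)) ->
  (forall a, ordge m (k a - k' a)) -> ordge l.+1 f ->
  ordge (m + l) (sub k f - sub k' f).
Proof.
move=> k1 k1' kk.
have E f0 : sub k f0 - sub k' f0 =
    \sum_a ((k a - k' a) * sub k (lder a f0) +
            k' a * (sub k (lder a f0) - sub k' (lder a f0))).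
  rewrite !(sub_rec _ f0) // opprD addrACA subrr add0r -sumrB.
  by apply: eq_bigr => a _; rewrite mulrBl mulrBr addrA subrK.
have base f0 : ordge m (sub k f0 - sub k' f0).
  (* [E] reproduces the statement for [lder a] behind a factor of order one, so the order grows
     until it is capped by that of [k a - k' a]. *)
  suff H n f1 : ordge (minn n m) (sub k f1 - sub k' f1).
    by rewrite -[m]minnn.
  elim: n f1 => [|n IH] f1; first by rewrite min0n.
  rewrite E; apply: ordge_sum => a _; apply: ordgeD.
    by apply: ordgeMr; apply: ordge_le (geq_minr _ _) _; exact: kk.
  apply: ordge_le (ordgeM (@k1' a) (@IH (lder a f1))).
  by rewrite add1n; lia.
elim: l f => [|l IH] f fl; first by rewrite addn0.
rewrite E; apply: ordge_sum => a _; apply: ordgeD.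
  apply: ordgeM => //; apply: ordge_sub => //.
  exact: (ordge_lder (k := l.+2)).
rewrite addnS -add1n; apply: ordgeM => //; apply: IH.
exact: (ordge_lder (k := l.+2)).
Qed.

Lemma cutZ a (z : K) f : cut a (z *: f) = z *: cut a f.
Proof. by rewrite /cut scale_mulr scale_mull. Qed.

Lemma cut_sum a (I : Type) (r : seq I) (P : pred I) (F : I -> fser) :
  cut a (\sum_(j <- r | P j) F j) = \sum_(j <- r | P j) cut a (F j).
Proof. by rewrite /cut mulr_sumr mulr_suml. Qed.

Lemma cut_dom a f p : `|cut a f p| <= `|f p|.
Proof. by rewrite cutE; case: ifP => _ //; rewrite normr0. Qed.

Lemma arr_analytic a : arr a \in analytic.
Proof.
apply: (@analytic_of _ _ 1 1) => // p; rewrite expr1n mulr1 /arr.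
by case: eqP => _; rewrite ?normr1 ?normr0.
Qed.

Lemma bnd_arr N r a : 0 <= r -> bnd N r r (arr a).
Proof.
move=> r0; exists (fun n => (n == 1%N)%:R); split=> [n|p _|]; first exact: ler0n.
  rewrite /arr /plen; case: eqP => [->|_]; first by rewrite /= normr1.
  by rewrite normr0 ler0n.
have [N1|N2] := leqP N 1.
  rewrite big1 // => n _; have := ltn_ord n; case: (val n) => [|m] /=; rewrite ?mul0r //.
  by case: m => [|m]; rewrite ?mul0r //; lia.
rewrite (bigD1 (Ordinal N2)) //= expr1 mul1r big1 ?addr0 // => n.
by rewrite -val_eqE /= => /negbTE ->; rewrite mul0r.
Qed.

Section Construction.
Variables (h : arrow Q -> fser) (L' : arrow Q -> arrow Q -> K).
Hypothesis h1 : forall a, ordge 1 (h a).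
Hypothesis hpar : forall a, par a (h a).
Hypothesis han : forall a, h a \in analytic.
Hypothesis LL' : forall a c, \sum_b lin (h a) b * L' b c = (a == c)%:R.

Let q a : fser := h a - \sum_b lin (h a) b *: arr b.

Lemma inv_q2 a : ordge 2 (q a).
Proof.
have q1 : ordge 1 (q a).
  apply: ordgeB => //; apply: ordge_sum => b _; apply: ordgeZ; exact: ordge_arr.
move=> p; rewrite ltnS leq_eqVlt ltnS leqn0 => /orP[/eqP/apathP[b ->]|/eqP p0].
  rewrite -/(lin _ _) /q /lin fserDE fserNE fser_sumE (bigD1 b) //= fserZE.
  rewrite -/(lin (arr b) b) lin_arr eqxx mulr1 big1 ?addr0 ?subrr // => c cb.
  by rewrite fserZE -/(lin (arr c) b) lin_arr eq_sym (negbTE cb) mulr0.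
by rewrite q1 // p0.
Qed.

Lemma inv_qan a : q a \in analytic.
Proof.
rewrite /q rpredB // rpred_sum // => b _; rewrite rpredZ //; exact: arr_analytic.
Qed.

(** Picard iteration for [sub k (h a) = arr a], rewritten as [k = L' (arr - sub k q)] with [q] the
    nonlinear part of [h]. *)
Fixpoint invn n b : fser := if n is n'.+1
  then cut b (\sum_a L' b a *: (arr a - sub (invn n') (q a))) else 0.

Lemma invn1 n b : ordge 1 (invn n b).
Proof.
elim: n b => [//|n IH] b /=; apply: ordge_cut; apply: ordge_sum => a _.
apply: ordgeZ; apply: ordgeB; first exact: ordge_arr.
by apply: ordge_sub => //; apply: ordge_le (inv_q2 a).
Qed.

Lemma invn_step n b : ordge n (invn n.+1 b - invn n b).
Proof.
elim: n b => [//|n IH] b.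
rewrite [invn n.+2 b]/= [invn n.+1 b in X in _ - X]/= -cutB -sumrB; apply: ordge_cut.
apply: ordge_sum => a _; rewrite -scalerBr; apply: ordgeZ.
rewrite subrBB -addn1 -/(invn n.+1).
apply: ordgeN; apply: sub_close; try exact: invn1; [exact: IH | exact: inv_q2].
Qed.

Definition invs b : fser := flim (invn ^~ b).

Lemma invs1 b : ordge 1 (invs b).
Proof. by apply: flim_ordge => n; exact: invn1. Qed.

Lemma invs_fix b : invs b = cut b (\sum_a L' b a *: (arr a - sub invs (q a))).
Proof.
have kk n c : ordge n (invs c - invn n c).
  exact: (@flim_ord _ _ (invn ^~ c) (fun n => @invn_step n c)).
apply/eqP; rewrite -subr_eq0; apply/eqP/ordge_inf => n.
rewrite -[invs b](subrK (invn n.+1 b)) -addrA; apply: ordgeD.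
  exact: ordge_le (leqnSn n) (@kk _ _).
rewrite /= -cutB -sumrB; apply: ordge_cut; apply: ordge_sum => a _.
rewrite -scalerBr; apply: ordgeZ; rewrite subrBB.
apply: ordgeN; apply: ordge_le (leq_addr 1 n) _; apply: sub_close.
- exact: invn1.
- exact: invs1.
- by move=> c; rewrite -opprB; apply/ordgeN/kk.
- exact: inv_q2.
Qed.

Lemma invs_par b : par b (invs b).
Proof. by rewrite invs_fix; exact: par_cut. Qed.

Lemma invs_analytic b : invs b \in analytic.
Proof.
have [C C1 [M M0 hM]] := analytic_fin inv_qan.
have C0 : 0 < C by exact: lt_le_trans C1.
have [La La0 hLa] : exists2 La : K, 1 <= La & forall a b, `|L' a b| <= La.
  exists (1 + \sum_a \sum_b `|L' a b|).
    by rewrite lerDl sumr_ge0 // => a _; rewrite sumr_ge0.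
  move=> a c; apply: (@le_trans _ _ (\sum_b0 `|L' a b0|)).
    by rewrite (bigD1 c) //= lerDl sumr_ge0.
  rewrite [X in _ <= 1 + X](bigD1 a) //= addrCA lerDl addr_ge0 // sumr_ge0 // => d _.
  exact: sumr_ge0.
have La1 : 0 < La by exact: lt_le_trans La0.
pose n0 : K := 1 + #|arrow Q|%:R.
have n01 : 1 <= n0 by rewrite lerDl.
have n00 : 0 < n0 by exact: lt_le_trans n01.
have nA : #|arrow Q|%:R <= n0 by rewrite lerDr.
(* With this [c] and the [r] below, the linear term [n0 La r] and the quadratic term
   [2 n0 La (1 + M) (n0 C c)^2] both equal [c / 2]: the iteration preserves the ball of radius
   [c]. *)
pose c := (4%:R * n0 ^+ 3 * La * (1 + M) * C ^+ 2)^-1.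
have M1 : 0 < 1 + M by rewrite ltr_wpDr.
have E0 : 0 < 4%:R * n0 ^+ 3 * La * (1 + M) * C ^+ 2.
  by rewrite !mulr_gt0 ?exprn_gt0 ?ltr0n.
have c0 : 0 < c by rewrite invr_gt0.
pose r := c / (n0 * La *+ 2).
have r0 : 0 < r by rewrite divr_gt0 // mulrn_wgt0 // mulr_gt0.
have nC : 0 <= #|arrow Q|%:R * C by rewrite mulr_ge0 // ltW.
have ge1 : forall u v : K, 1 <= u -> 1 <= v -> 1 <= u * v.
  by move=> u v u1 v1; rewrite -[leLHS]mulr1 ler_pM.
have small : #|arrow Q|%:R * C * c *+ 2 <= 1.
  rewrite -mulrnAl ler_pdivrMr // mul1r.
  apply: le_trans (_ : n0 * C *+ 2 <= _).
    by rewrite lerMn2r /= ler_wpM2r // ltW.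
  rewrite (_ : 4%:R * _ * _ * _ * _ = n0 * C *+ 2 * (2%:R * n0 ^+ 2 * La * (1 + M) * C)); last by ring.
  apply: ler_peMr; first by rewrite mulrn_wge0 // mulr_ge0 // ltW.
  do 4 (apply: (ge1); rewrite ?exprn_ege1 ?lerDl ?ler1n //).
have B N n a : bnd N r c (invn n a).
  elim: n N a => [|n IH] N a; first by apply: bnd_zero; exact: ltW.
  apply: bnd_dom (@cut_dom _ _) _.
  apply: (@bnd_le _ _ _ _ (#|arrow Q|%:R * (La * (r + M * (#|arrow Q|%:R * C * c) ^+ 2 *+ 2)))).
    apply: le_trans (_ : n0 * (La * (r + (1 + M) * (n0 * C * c) ^+ 2 *+ 2)) <= _).
      apply: ler_pM => //.
        by rewrite mulr_ge0 ?(ltW La1) // addr_ge0 ?(ltW r0) // mulrn_wge0 // mulr_ge0 // exprn_ge0 // mulr_ge0 // ltW.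
      apply: ler_wpM2l; rewrite ?(ltW La1) // lerD2l lerMn2r /=.
      apply: ler_pM; rewrite ?exprn_ge0 ?mulr_ge0 ?(ltW c0) ?(ltW C0) // ?lerDr //.
      by apply: lerXn2r; rewrite ?nnegrE ?mulr_ge0 ?(ltW c0) ?(ltW C0) ?(ltW n00) // ?ler_wpM2r ?(ltW c0) ?(ltW C0).
    rewrite le_eqVlt; apply/orP; left; apply/eqP; rewrite /r.
    rewrite (_ : (n0 * C * c) ^+ 2 = c * (n0 ^+ 2 * C ^+ 2 * c)); last by ring.
    rewrite /c; field; rewrite !gt_eqF //.
  apply: bnd_sum => d; apply: bnd_le (bndZ _ _); last first.
    apply: bndD; last apply: bndN.
      have := @bnd_arr N (r) d; apply.
      exact: ltW.
    exact: (bnd_sub_ord (ltW r0) (@invn1 n) IH M0 (ltW C0) small (hM d) (@inv_q2 d)).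
  apply: ler_wpM2r => //.
  by rewrite addr_ge0 ?(ltW r0) // mulrn_wge0 // mulr_ge0 // exprn_ge0 // mulr_ge0 // ltW.
exact: (flim_bnd r0 (fun n N => B N n b)).
Qed.

Lemma invsK a : sub invs (h a) = arr a.
Proof.
have -> : h a = \sum_b lin (h a) b *: arr b + q a by rewrite addrC subrK.
have s1 := invs1; rewrite subD // sub_sum //.
rewrite (eq_bigr (fun b => lin (h a) b *: invs b)); last first.
  by move=> b _; rewrite subZ // sub_arr //; exact: invs_par.
pose z c := arr c - sub invs (q c).
have qpar c : par c (q c).
  move=> p cp; rewrite /q fserDE fserNE hpar // fser_sumE sub0r big1 ?oppr0 // => b _.
  rewrite fserZE; have [e|/(lin_par (@hpar c)) ->] :=
    boolP ((src b == src c) && (tgt b == tgt c)); last by rewrite mul0r.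
  by rewrite (@par_arr _ _ b) ?mulr0 //; case/andP: e => /eqP -> /eqP ->.
have zpar c : cut c (z c) = z c.
  rewrite cutB cut_par; last exact: par_arr.
  congr (_ - _); rewrite cut_par //.
  by apply: par_sub => //; exact: invs_par.
suff -> : \sum_b lin (h a) b *: invs b = z a by rewrite subrK.
(* Since [lin (h a) b] vanishes unless [b] is parallel to [a], every [cut b] may be replaced by the
   one linear map [cut a], after which [LL'] applies. *)
transitivity (cut a (\sum_c (\sum_b lin (h a) b * L' b c) *: z c)).
  rewrite cut_sum; under [RHS]eq_bigr do rewrite scaler_suml cut_sum.
  rewrite exchange_big; apply: eq_bigr => b _ /=.
  rewrite invs_fix cut_sum scaler_sumr; apply: eq_bigr => c _.
  rewrite -scalerA !cutZ; have [/andP[/eqP e1 /eqP e2]|/(lin_par (@hpar a)) ->] :=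
    boolP ((src b == src a) && (tgt b == tgt a)); last by rewrite !scale0r.
  by rewrite /cut e1 e2.
under eq_bigr do rewrite LL'; rewrite (bigD1 a) //= eqxx scale1r big1 ?addr0 //.
by move=> c /negbTE; rewrite eq_sym => ->; rewrite scale0r.
Qed.
End Construction.

Local Notation aser := (aseries K Q).

Lemma avalD (f g : aser) : aval (f + g) = aval f + aval g. Proof. by []. Qed.
Lemma avalB (f g : aser) : aval (f - g) = aval f - aval g. Proof. by []. Qed.
Lemma avalM (f g : aser) : aval (f * g) = aval f * aval g. Proof. by []. Qed.
Lemma aval1 : aval (1 : aser) = 1. Proof. by []. Qed.
Lemma aval0 : aval (0 : aser) = 0. Proof. by []. Qed.
Lemma avalZ (z : K) (f : aser) : aval (z *: f) = z *: aval f. Proof. by []. Qed.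
Lemma aval_al (z : vert Q -> K) : aval (al z : aser) = fl z. Proof. by []. Qed.
Lemma aval_sum (I : Type) (r : seq I) (P : pred I) (F : I -> aser) :
  aval (\sum_(j <- r | P j) F j) = \sum_(j <- r | P j) aval (F j).
Proof. exact: (big_morph (@aval K Q) avalD aval0). Qed.

Lemma aval_inj (f g : aser) : aval f = aval g -> f = g.
Proof. exact: val_inj. Qed.

Definition aarr a : aser := ASeries (arr_analytic a).

Lemma lder_analytic a f : f \in analytic -> lder a f \in analytic.
Proof.
move=> /analytic1[C C1 [M M0 hM]]; have C0 : 0 <= C by exact: le_trans C1.
apply: (@analytic_of _ _ C (M * C)) => //; first exact: mulr_ge0.
exact: lder_bnd.
Qed.

Definition alder a (f : aser) : aser := ASeries (lder_analytic a (avalP f)).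

Lemma aser_decomp (f : aser) :
  f = al (const (aval f)) + \sum_a aarr a * alder a f.
Proof. by apply: aval_inj; rewrite avalD aval_sum /= -fser_decomp. Qed.

(** An algebraic way of detecting constant terms: a homomorphism must preserve this invertibility
    even before it is known to be continuous. *)
Lemma quasi_regular (f : aser) : ordge 1 (aval f) -> exists v : aser, (1 - f) * v = 1.
Proof.
move=> f1; have [|||G Gan GE] := @neumann_solve K Q unit (fun _ _ => aval f) (fun=> 1).
- by [].
- by move=> _ _; exact: avalP.
- by move=> _; exact: (avalP (1 : aser)).
exists (ASeries (Gan tt)); apply: aval_inj.
rewrite avalM avalB aval1 mulrBl mul1r /= {1}(GE tt).
by rewrite (bigD1 tt) //= big1 ?addr0 ?addrK // => -[].
Qed.
End Inverse.

Lemma mk_rmorphism (A B : pzRingType) (f : A -> B) :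
  (forall x y, f (x - y) = f x - f y) -> f 1 = 1 ->
  (forall x y, f (x * y) = f x * f y) -> exists g : {rmorphism A -> B}, g =1 f.
Proof.
move=> fB f1 fM.
pose m1 := GRing.isZmodMorphism.Build A B f fB.
pose m2 := GRing.isMonoidMorphism.Build A B f (conj f1 fM).
pose g : {rmorphism A -> B} := HB.pack f m1 m2.
by exists g.
Qed.

(** * Endomorphisms as substitutions *)

Section Automorphisms.
Variables (K : numClosedFieldType) (Q : quiver).
Local Notation fser := (fseries K Q).
Local Notation arr := (@arr K Q).
Local Notation analytic := (@analytic K Q).
Local Notation aser := (aseries K Q).
Implicit Types (f : aser) (p q : qpath Q) (a b : arrow Q).

(* An analytic [l]-algebra endomorphism; that [g] preserves the arrow ideal is
   automatic when it is bijective, see [aut_aend]. *)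
Definition aend (g : aser -> aser) (h : arrow Q -> fser) :=
  [/\ forall a, ordge 1 (h a), forall a, par a (h a),
      forall a, h a \in analytic & forall f, aval (g f) = sub h (aval f)].

Lemma sub_aend h : (forall a, ordge 1 (h a)) -> (forall a, par a (h a)) ->
  (forall a, h a \in analytic) -> exists g : {rmorphism aser -> aser}, aend g h.
Proof.
move=> h1 hp han.
pose g0 f : aser := ASeries (sub_analytic h1 han (avalP f)).
have [||| g gE] := @mk_rmorphism _ _ g0.
- by move=> x y; apply: aval_inj; exact: subB.
- by apply: aval_inj; exact: sub_fl.
- by move=> x y; apply: aval_inj; exact: subM.
by exists g; split=> // f; rewrite gE.
Qed.

Lemma aend_al (g : aser -> aser) h : aend g h -> forall c, g (al c) = al c.
Proof. by case=> h1 hp han gE c; apply: aval_inj; rewrite gE sub_fl. Qed.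

(** [invs] provides a left inverse [sub k] of [sub h]. The linear part of [k] is [L'], which is
    again invertible, so [sub k] has a left inverse as well; both are therefore bijective and
    inverse to each other. *)
Lemma aend_inverse (h : arrow Q -> fser) (L' : arrow Q -> arrow Q -> K) :
  (forall a, ordge 1 (h a)) -> (forall a, par a (h a)) ->
  (forall a, h a \in analytic) ->
  (forall a c, \sum_b lin (h a) b * L' b c = (a == c)%:R) ->
  (forall a c, \sum_b L' a b * lin (h b) c = (a == c)%:R) ->
  exists k, [/\ forall a, ordge 1 (k a), forall a, par a (k a),
    forall a, k a \in analytic, (forall x, sub k (sub h x) = x) &
    (forall x, sub h (sub k x) = x)].
Proof.
move=> h1 hp han LL' L'L; pose k := invs h L'.
have k1 a : ordge 1 (k a) by exact: invs1.
have kp a : par a (k a) by exact: invs_par.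
have kan a : k a \in analytic by exact: invs_analytic.
have kh a : sub k (h a) = arr a by exact: invsK.
have LK a c : \sum_b lin (h a) b * lin (k b) c = (a == c)%:R.
  by rewrite -lin_sub // kh lin_arr eq_sym.
have kL' b c : lin (k b) c = L' b c.
  transitivity (\sum_a L' b a * \sum_d lin (h a) d * lin (k d) c).
    under eq_bigr do rewrite mulr_sumr; rewrite exchange_big.
    under eq_bigr do [under eq_bigr do rewrite mulrA; rewrite -mulr_suml L'L].
    rewrite (bigD1 b) //= eqxx mul1r big1 ?addr0 // => d.
    by rewrite eq_sym => /negbTE ->; rewrite mul0r.
  under eq_bigr do rewrite LK.
  by rewrite (bigD1 c) //= eqxx mulr1 big1 ?addr0 // => d /negbTE ->; rewrite mulr0.
pose j := invs k (fun a b => lin (h a) b).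
have kLK a c : \sum_b lin (k a) b * lin (h b) c = (a == c)%:R.
  by under eq_bigr do rewrite kL'; exact: L'L.
have jk a : sub j (k a) = arr a by apply: invsK.
have j1 a : ordge 1 (j a) by exact: invs1.
have jp a : par a (j a) by exact: invs_par.
have skh x : sub k (sub h x) = x.
  rewrite sub_comp // (_ : (fun a => _) = arr) ?sub_id //.
  by apply/funext => a; exact: kh.
have sjk x : sub j (sub k x) = x.
  rewrite sub_comp // (_ : (fun a => _) = arr) ?sub_id //.
  by apply/funext => a; exact: jk.
exists k; split=> // x; rewrite -{2}(sjk x) -[sub k x]skh sjk skh.
by [].
Qed.

Lemma rmorphZ_l (g : {rmorphism aser -> aser}) : (forall c, g (al c) = al c) ->
  forall (z : K) f, g (z *: f) = z *: g f.
Proof. move=> gl z f; by rewrite !ascale_l rmorphM gl. Qed.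

(* [1 - z ev_i a] is invertible for all [z], which forces the image of [a]
   to have no constant term. *)
Lemma aut_ordge1 (g : {rmorphism aser -> aser}) : (forall c, g (al c) = al c) ->
  forall a, ordge 1 (aval (g (aarr K a))).
Proof.
move=> gl a; apply/ordge1P => i; apply/eqP; apply: contraT => ni.
set z := const _ i in ni.
pose x : aser := z^-1 *: (al (fun j => (j == i)%:R) * aarr K a).
have [|y xy] := @quasi_regular K Q x.
  by rewrite /x avalZ avalM; apply/ordgeZ/ordgeMl/ordge_arr.
have /(congr1 (fun f : aser => const (aval f) i)) := congr1 g xy.
rewrite rmorphM rmorphB rmorph1 avalM constM avalB aval1 /x rmorphZ_l //.
rewrite rmorphM gl avalZ avalM aval_al /const fserDE fserNE fserZE -!/(const _ i).
rewrite constM const_fl eqxx mul1r -/z mulVf // -fl1 const_fl subrr mul0r.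
by move/eqP; rewrite eq_sym oner_eq0.
Qed.

(** Continuity of [g] is automatic: by [aser_decomp] it obeys the recursion of [sub], whose solution
    is unique once the images of the arrows have no constant terms. *)
Lemma aut_aend (g : {rmorphism aser -> aser}) : (forall c, g (al c) = al c) ->
  aend g (fun a => aval (g (aarr K a))).
Proof.
move=> gl; have h1 := aut_ordge1 gl; split=> // [a|a|].
- rewrite (_ : aarr K a = al (fun j => (j == src a)%:R) * aarr K a * al (fun j => (j == tgt a)%:R)).
    by rewrite !rmorphM !gl; exact: par_cut.
  by apply: aval_inj; rewrite !avalM; symmetry; apply/cut_par/par_arr.
- exact: avalP.
apply: (sub_uniq h1 (sh := @alder K Q)) => // f.
rewrite {1}(aser_decomp f) rmorphD rmorph_sum gl avalD aval_sum; congr (_ + _).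
by apply: eq_bigr => a _; rewrite rmorphM.
Qed.

End Automorphisms.

(** * Jacobi ideals and Nakayama's lemma *)

Section Ideals.
Variables (K : numClosedFieldType) (Q : quiver).
Local Notation fser := (fseries K Q).
Local Notation ker := (qpath Q * qpath Q -> K).
Local Notation aarr := (@aarr K Q).
Local Notation analytic := (@analytic K Q).
Local Notation aser := (aseries K Q).
Local Notation biplen := (@biplen Q).
Implicit Types (f g : aser) (p q u v : qpath Q) (a b : arrow Q) (A : ker).
Implicit Types (I : aser -> Prop).

Lemma ker_growth1 A : growth biplen A -> exists2 C : K, 1 <= C &
  exists2 M : K, 0 <= M & forall uv, `|A uv| <= M * C ^+ biplen uv.
Proof. exact: (growth_all (@short_bipaths Q)). Qed.

Lemma ker_growth_of (C M : K) A : 0 <= C -> 0 <= M ->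
  (forall uv, `|A uv| <= M * C ^+ biplen uv) -> growth biplen A.
Proof.
move=> C0 M0 hA; apply: (@growth_of _ _ _ _ (1 + C) M) => //.
  by rewrite lerDl.
move=> p; apply: le_trans (hA p) _; apply: ler_pM; rewrite ?exprn_ge0 //.
  by rewrite -[leLHS]mul1r ler_wpM2r // ler1n.
by apply: lerXn2r; rewrite ?nnegrE ?addr_ge0 // lerDr.
Qed.

Lemma mulK_analytic A : growth biplen A -> mulK A \in analytic.
Proof.
move=> /ker_growth1[C C1 [M M0 hA]]; apply/asboolP.
apply: (growth_of C1 M0) => p; apply: le_trans (ler_norm_sum _ _ _) _.
apply: le_trans (_ : \sum_(k < (plen p).+1) M * C ^+ plen p <= _).
  apply: ler_sum => k _; apply: le_trans (hA _) _.
  have kp : (k <= plen p)%N by rewrite -ltnS.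
  by rewrite /biplen /= plen_take // plen_drop subnKC.
by rewrite sumr_const card_ord -[X in X <= _]mulr_natl mulrA.
Qed.

Lemma rinK_growth A (D : fser) : growth biplen A -> D \in analytic ->
  growth biplen (rinK A D).
Proof.
move=> hA /asboolP hD.
apply: (growth_conv (al := fun k uv => (ptake k uv.1, uv.2))
  (be := fun k uv => pdrop k uv.1) (m := fun uv => plen uv.1)) hA hD.
- exact: short_bipaths.
- exact: short_paths.
- by move=> uv; exact: leq_addr.
- by move=> uv k kn; rewrite /biplen /= plen_take // plen_drop addnAC subnKC.
Qed.

Lemma ins_analytic A (D : fser) : growth biplen A -> D \in analytic ->
  ins A D \in analytic.
Proof. by move=> hA hD; apply/mulK_analytic/rinK_growth. Qed.

Lemma swapK_growth A : growth biplen A -> growth biplen (swapK A).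
Proof.
move=> [C C0 [N hN]]; exists C => //; exists N => -[u v]; rewrite /swapK /biplen /= addnC.
by move=> h; exact: (hN (v, u) h).
Qed.

Lemma dker_growth b (f : fser) : f \in analytic -> growth biplen (dker b f).
Proof.
move=> /analytic1[C C1 [M M0 hM]]; have C0 : 0 <= C by exact: le_trans C1.
apply: (@ker_growth_of C (M * C)) => //; first exact: mulr_ge0.
move=> [u v]; have R : 0 <= M * C * C ^+ biplen (u, v).
  by rewrite mulr_ge0 ?mulr_ge0 ?exprn_ge0.
have [h|] := boolP ((pstart v != tgt b) || (pend u != src b)).
  by rewrite dkerN // normr0.
rewrite negb_or !negbK => /andP[/eqP vb /eqP ub].
have [p ps pw] := dker_path vb ub.
rewrite (dker_p _ vb ps pw); apply: le_trans (hM p) _.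
by rewrite /plen pw size_cat /= addnS exprS mulrA.
Qed.

Lemma cdr_analytic b (f x : fser) : f \in analytic -> x \in analytic ->
  cdr b f x \in analytic.
Proof. by move=> hf hx; apply: ins_analytic => //; apply/swapK_growth/dker_growth. Qed.

Lemma fder_analytic b f : fder b (aval f) \in analytic.
Proof.
by rewrite fder_cdr cdr_analytic //; [exact: avalP|exact: (avalP (1 : aser))].
Qed.

Definition afder b f : aser := ASeries (fder_analytic b f).

Lemma rsl_analytic A u : growth biplen A -> rsl A u \in analytic.
Proof.
move=> /ker_growth1[C C1 [M M0 hA]]; have C0 : 0 <= C by exact: le_trans C1.
apply: (@analytic_of _ _ C (M * C ^+ plen u)) => //.
  by rewrite mulr_ge0 ?exprn_ge0.
by move=> v; apply: le_trans (hA _) _; rewrite /biplen /= exprD mulrA.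
Qed.

Lemma lderK_growth a A : growth biplen A -> growth biplen (lderK a A).
Proof.
move=> /ker_growth1[C C1 [M M0 hA]]; have C0 : 0 <= C by exact: le_trans C1.
apply: (@ker_growth_of C (M * C)) => //; first exact: mulr_ge0.
move=> [u v]; rewrite /biplen /= addnC exprD mulrA.
rewrite (_ : M * C * _ = (M * C ^+ plen v) * C); last by ring.
apply: lder_bnd => //; first by rewrite mulr_ge0 ?exprn_ge0.
by move=> p; apply: le_trans (hA _) _; rewrite /biplen /= addnC exprD mulrA.
Qed.

Definition tideal I := [/\ I 0, forall f g, I f -> I g -> I (f - g),
  forall f g, I g -> I (f * g) & forall f g, I g -> I (g * f)].

Section TwoSided.
Variable I : aser -> Prop.
Hypothesis tI : tideal I.

Lemma tideal0 : I 0. Proof. by case: tI. Qed.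
Lemma tidealB f g : I f -> I g -> I (f - g). Proof. by case: tI => _ h _ _; exact: h. Qed.
Lemma tidealN f : I f -> I (- f).
Proof. by move=> hf; rewrite -sub0r; apply: tidealB => //; exact: tideal0. Qed.
Lemma tidealD f g : I f -> I g -> I (f + g).
Proof. by move=> hf hg; rewrite -[g]opprK; apply/tidealB/tidealN. Qed.
Lemma tidealMl f g : I g -> I (f * g). Proof. by case: tI => _ _ h _; exact: h. Qed.
Lemma tidealMr f g : I g -> I (g * f). Proof. by case: tI => _ _ _ h; exact: h. Qed.
Lemma tidealZ (z : K) f : I f -> I (z *: f).
Proof. by rewrite ascale_l; exact: tidealMl. Qed.
Lemma tideal_sum (T : Type) (r : seq T) (P : pred T) (F : T -> aser) :
  (forall t, P t -> I (F t)) -> I (\sum_(t <- r | P t) F t).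
Proof. by move=> h; apply: big_ind => //; [exact: tideal0|exact: tidealD]. Qed.

End TwoSided.

Definition cl I f := forall k, exists2 g, I g & ordge k (aval (f - g)).

Lemma cl_incl I f : I f -> cl I f.
Proof. by move=> h k; exists f; rewrite // subrr; exact: ordge_zero. Qed.

Lemma cl_tideal I : tideal I -> tideal (cl I).
Proof.
move=> tI; split=> [|f g hf hg k|f g hg k|f g hg k].
- exact: (cl_incl (tideal0 tI)).
- have [f' If' ff'] := hf k; have [g' Ig' gg'] := hg k.
  exists (f' - g'); first exact: tidealB.
  rewrite (_ : _ - _ = (f - f') - (g - g')); first exact: ordgeB.
  by apply: aval_inj; apply/funext => p; rewrite !(avalB, fserDE, fserNE); ring.
- have [g' Ig' gg'] := hg k; exists (f * g'); first exact: tidealMl.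
  by rewrite -mulrBr; exact: ordgeMl.
- have [g' Ig' gg'] := hg k; exists (g' * f); first exact: tidealMr.
  by rewrite -mulrBl; exact: ordgeMr.
Qed.

(** Peeling [k] letters leaves finitely many products in [I] and a remainder of order [k]. Only the
    closure is reached, as an arbitrary ideal is not stable under infinite combinations. *)
Lemma ins_cl I A (D f : aser) : tideal I -> growth biplen A -> I D ->
  aval f = ins A (aval D) -> cl I f.
Proof.
move=> tI hA ID fE k; elim: k A hA f fE => [|k IH] A hA f fE.
  by exists 0; [exact: tideal0|exact: ordge0].
have /fin_all_exists[G hG] a : exists g, I g /\
    ordge k (aval (ASeries (ins_analytic (lderK_growth a hA) (avalP D)) - g)).
  by have [g Ig gk] := IH _ (lderK_growth a hA)
      (ASeries (ins_analytic (lderK_growth a hA) (avalP D))) erefl; exists g.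
exists (\sum_i al (fun j => (j == i)%:R) * D * ASeries (rsl_analytic (triv i) hA)
   + \sum_a aarr a * G a).
  apply: tidealD => //; apply: tideal_sum => // j _.
    by apply: (tidealMr tI); apply: (tidealMl tI).
  by apply: (tidealMl tI); have [] := hG j.
rewrite avalB avalD fE ins_peel !aval_sum opprD addrACA.
rewrite subrr add0r -sumrB; apply: ordge_sum => a _.
rewrite avalM -mulrBr -[k.+1]add1n; apply: ordgeM; first exact: ordge_arr.
by have [_] := hG a.
Qed.

Definition opn I := exists N, forall f, ordge N (aval f) -> I f.

Lemma cl_opn I f : tideal I -> opn I -> cl I f -> I f.
Proof.
move=> tI [N hN] /(_ N)[g Ig fg]; rewrite -[f](subrK g).
by apply: tidealD => //; exact: hN.
Qed.

Lemma cl_incl2 I I' f : (forall g, I g -> cl I' g) -> cl I f -> cl I' f.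
Proof.
move=> h hf k; have [g Ig fg] := hf k; have [g' Ig' gg'] := h g Ig k.
by exists g' => //; rewrite -[f](subrK g) -addrA; exact: ordgeD.
Qed.

Lemma jcomb_ins (D : arrow Q -> fser) (A : arrow Q -> ker) :
  jcomb D A = \sum_a ins (A a) (D a).
Proof. by apply/funext => p; rewrite jcombE fser_sumE. Qed.

Definition jac (phi : aser) f := f \in jacobi_ideal (aclass phi).

Lemma jacP (phi f : aser) : jac phi f <-> exists2 A : arrow Q -> ker,
  forall a, growth biplen (A a) &
  aval f = \sum_a ins (A a) (aval (afder a phi)).
Proof.
have E : (fun a => der a (potval (aclass phi))) = (fun a => aval (afder a phi)).
  by apply/funext => a; exact: derE.
split=> [/asboolP[A hA fA]|[A hA fA]].
  by exists A; rewrite // fA E jcomb_ins.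
by apply/asboolP; exists A => //; rewrite fA E jcomb_ins.
Qed.

Lemma jac_tideal phi : tideal (jac phi).
Proof.
split=> [|f g|f g|f g]; rewrite /jac.
- exact: rpred0.
- exact: rpredB.
- exact: jacobi_idealMl.
- exact: jacobi_idealMr.
Qed.

Lemma jac_afder phi a : jac phi (afder a phi).
Proof.
apply/jacP; exists (fun b uv => if b == a then (1 : fser) uv.1 * (1 : fser) uv.2 else 0).
  move=> b; apply: (@ker_growth_of 1 1) => // uv; rewrite expr1n mulr1.
  case: eqP => _; last by rewrite normr0.
  rewrite -!fl1 /fl; do 2 case: ifP => _; rewrite ?mulr1 ?mulr0 ?mul0r ?normr0 ?normr1 //.
rewrite (bigD1 a) //= eqxx ins_tensor mul1r mulr1 big1 ?addr0 // => b /negbTE ->.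
exact: ins0l.
Qed.

(** At this point the growth condition on the coefficients of Jacobi elements is forgotten:
    comparing ideals reduces to placing the cyclic derivatives. *)
Lemma jac_cl phi I f : tideal I -> (forall a, I (afder a phi)) -> jac phi f -> cl I f.
Proof.
move=> tI ID /jacP[A hA fA].
have -> : f = \sum_a ASeries (ins_analytic (hA a) (avalP (afder a phi))).
  by apply: aval_inj; rewrite aval_sum.
apply: tideal_sum; first exact: cl_tideal.
by move=> a _; apply: (ins_cl tI (hA a) (ID a)).
Qed.

Lemma jac_opn phi I f : tideal I -> opn I -> (forall a, I (afder a phi)) ->
  jac phi f -> I f.
Proof. by move=> tI oI ID hf; apply: cl_opn => //; exact: jac_cl hf. Qed.

(** The generators are the products of [N] arrows, and the coefficients arise by repeated left
    division. Their order is recorded so that a Neumann series can be formed with them. *)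
Lemma power_gens N : exists (T : finType) (e : T -> aser),
  (forall t, ordge N (aval (e t))) /\
  forall m f, ordge (N + m) (aval f) -> exists2 c : T -> aser,
    f = \sum_t e t * c t & forall t, ordge m (aval (c t)).
Proof.
elim: N => [|N [T [e [eN gen]]]].
  exists unit, (fun=> 1); split=> // m f fm; exists (fun=> f) => //.
  by rewrite (bigD1 tt) //= big1 ?addr0 ?mul1r // => -[].
exists (arrow Q * T)%type, (fun at_ => aarr at_.1 * e at_.2); split.
  move=> [a t]; rewrite -[N.+1]add1n avalM.
  by apply: ordgeM; [exact: ordge_arr|exact: eN].
move=> m f fm.
have /fin_all_exists[C hC] a : exists c : T -> aser,
    alder a f = \sum_t e t * c t /\ forall t, ordge m (aval (c t)).
  have /gen[c] : ordge (N + m) (aval (alder a f)).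
    exact: (@ordge_lder _ _ (N.+1 + m)).
  by exists c.
exists (fun at_ => C at_.1 at_.2) => [|[a t]]; last by have [_] := hC a.
rewrite {1}(aser_decomp f) (_ : al _ = 0) ?add0r.
  rewrite -(pair_bigA _ (fun a t => aarr a * e t * C a t)) /=.
  apply: eq_bigr => a _; have [-> _] := hC a; rewrite mulr_sumr.
  by apply: eq_bigr => t _; rewrite mulrA.
apply: aval_inj; apply/funext => p; rewrite aval_al /fl.
by case: ifP => // _; apply: fm.
Qed.

(** By hypothesis the generators of the [N]-th power satisfy [e = g + e c], with [g] in [I] and [c]
    a matrix of positive order. Solving for the columns of the inverse of [1 - c] over the analytic
    series puts [e] in [I]. *)
Lemma nakayama I N : tideal I ->
  (forall f, ordge N (aval f) -> exists2 g, I g & ordge N.+1 (aval (f - g))) ->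
  forall f, ordge N (aval f) -> I f.
Proof.
move=> tI h; have [T [e [eN gen]]] := power_gens N.
have /fin_all_exists[G hG] t : exists gc : aser * (T -> aser),
    [/\ I gc.1, e t = gc.1 + \sum_s e s * gc.2 s & forall s, ordge 1 (aval (gc.2 s))].
  have [g Ig eg] := h _ (eN t).
  have [|c ec c1] := gen 1%N (e t - g); first by rewrite addn1.
  by exists (g, c); split=> //=; rewrite -ec addrC subrK.
have et t : I (e t).
  have [|||X Xan XE] := @neumann_solve K Q T (fun i j => aval ((G j).2 i))
      (fun i => if i == t then 1 else 0).
  - by move=> i j; have [_ _] := hG j.
  - by move=> i j; exact: avalP.
  - by move=> i; case: eqP => _; [exact: (avalP (1 : aser))|exact: (avalP (0 : aser))].
  pose x i : aser := ASeries (Xan i).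
  have -> : e t = \sum_s (G s).1 * x s.
    transitivity (\sum_i e i * (x i - \sum_j (G j).2 i * x j)).
      rewrite (bigD1 t) //= (_ : x t - _ = 1) ?mulr1.
        rewrite big1 ?addr0 // => i it; rewrite (_ : x i - _ = 0) ?mulr0 //.
        by apply: aval_inj; rewrite avalB aval_sum {1}/x /= XE (negbTE it) add0r subrr.
      by apply: aval_inj; rewrite avalB aval_sum {1}/x /= {1}XE eqxx addrK.
    under eq_bigr do rewrite mulrBr mulr_sumr.
    rewrite sumrB exchange_big -sumrB; apply: eq_bigr => s _ /=.
    under eq_bigr do rewrite mulrA.
    rewrite -mulr_suml -mulrBl; congr (_ * _).
    by have [_ {1}-> _] := hG s; rewrite addrK.
  by apply: tideal_sum => // s _; apply: tidealMr => //; have [] := hG s.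
move=> f fN; have [|c -> _] := gen 0%N f; first by rewrite addn0.
by apply: tideal_sum => // t _; exact: tidealMr.
Qed.

Lemma nakayama_cl I N : tideal I -> (forall f, ordge N (aval f) -> cl I f) ->
  forall f, ordge N (aval f) -> I f.
Proof. by move=> tI h; apply: nakayama => // f /h/(_ N.+1). Qed.

(** Openness passes from [I'] to [I]: a power of the arrow ideal lies in [I'], hence in the closure
    of [I], hence in [I] by Nakayama. *)
Lemma cl_opn' I I' : tideal I -> opn I' -> (forall f, I' f -> cl I f) ->
  forall f, I' f -> I f.
Proof.
move=> tI [N hN] h f If; apply: cl_opn (h f If) => //.
by exists N; apply: nakayama_cl => // g /hN; exact: h.
Qed.

Lemma left_kernel n (M : 'M[K]_(n.+1, n)) : exists2 c : 'rV_n.+1, c != 0 & c *m M = 0.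
Proof.
have : kermx M != 0.
  rewrite -mxrank_eq0 mxrank_ker subn_eq0 -ltnNge.
  exact: leq_ltn_trans (rank_leq_col _) _.
case/rowV0Pn => c /sub_kermxP cM c0; by exists c.
Qed.

(** Otherwise Nakayama yields, for each [k], some [F k] of order [k] that is not in the ideal modulo
    order [k.+1]. A linear relation in the quotient between [n.+1] of them is contradicted by its
    term of lowest index. *)
Lemma jacobi_finite_opn phi : jacobi_finite (aclass phi) -> opn (jac phi).
Proof.
case=> n [b hb]; apply: contrapT => no.
have step k : exists f, ordge k (aval f) /\
    forall g, jac phi g -> ~ ordge k.+1 (aval (f - g)).
  apply: contrapT => nk; apply: no; exists k; apply: nakayama.
    exact: jac_tideal.
  move=> f fk; apply: contrapT => nf; apply: nk; exists f; split=> // g gJ gk.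
  by apply: nf; exists g.
have [F hF] := choice step.
have [M hM] : exists M : 'M[K]_(n.+1, n), forall k : 'I_n.+1,
    jproj (aclass phi) (F k) = \sum_i M k i *: b i.
  have /fin_all_exists[c hc] (k : 'I_n.+1) := hb (jproj (aclass phi) (F k)).
  exists (\matrix_(k, i) c k i) => k; rewrite hc; apply: eq_bigr => i _.
  by rewrite mxE.
have [c c0 cM] := left_kernel M.
have JS : jac phi (\sum_(k < n.+1) c 0 k *: F k).
  rewrite /jac -[\sum_k _]subr0; apply/jproj_eq.
  have j0 : jproj (aclass phi) 0 = 0.
    by have := jprojZ (aclass phi) 0 0; rewrite !scale0r.
  rewrite (big_morph (jproj (aclass phi)) (@jprojD _ _ _) j0) j0.
  transitivity (\sum_i (\sum_(k < n.+1) c 0 k * M k i) *: b i).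
    under eq_bigr do rewrite jprojZ hM scaler_sumr.
    rewrite exchange_big; apply: eq_bigr => i _; rewrite scaler_suml.
    by apply: eq_bigr => k _; rewrite scalerA.
  rewrite big1 // => i _.
  by have /rowP/(_ i) := cM; rewrite !mxE => ->; rewrite scale0r.
have [k0 ck0] : exists k, c 0 k != 0.
  by apply: contrapT => nc; move/negP: c0; apply; apply/eqP/rowP => k; rewrite mxE;
    apply/eqP; apply: contraT => ck; case: nc; exists k.
case: (@arg_minnP _ k0 (fun k => c 0 k != 0) (fun k => k : nat) ck0) => k ck kmin.
have [_ /(_ ((c 0 k)^-1 *: \sum_(j < n.+1) c 0 j *: F j))] := hF k; apply.
  exact: (tidealZ (jac_tideal phi)).
rewrite (bigD1 k) //= scalerDr scalerA mulVf // scale1r opprD addrA subrr sub0r.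
rewrite aval_sum; apply/ordgeN/ordgeZ.
apply: ordge_sum => j jk; have [cj|cj] := eqVneq (c 0 j) 0.
  by rewrite avalZ cj scale0r; exact: ordge_zero.
have [Fj _] := hF j; apply: ordgeZ; apply: ordge_le Fj.
by rewrite ltn_neqAle eq_sym -val_eqE /= in jk *; rewrite jk kmin.
Qed.

End Ideals.

(** * The closure of the commutators *)

Section Commutators.
Variables (K : numClosedFieldType) (Q : quiver).
Local Notation fser := (fseries K Q).
Local Notation ker := (qpath Q * qpath Q -> K).
Local Notation ev := (@ev K Q).
Local Notation arr := (@arr K Q).
Local Notation cc := (@comm_closure K Q).
Implicit Types (f g x y D : fser) (p q u v : qpath Q) (a b : arrow Q) (A : ker).

Lemma cc_comm f g : f * g - g * f \in cc.
Proof.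
apply/asboolP => N; exists (f * g - g * f) => //.
by exists [:: (f, g)]; rewrite big_seq1.
Qed.

Lemma cc_lim f : (forall N, exists2 g, g \in cc & ordge N (f - g)) -> f \in cc.
Proof.
move=> h; apply/asboolP => N; have [g gcc fg] := h N.
have /asboolP/(_ N)[g' cg' gg'] := gcc; exists g' => // p pN.
rewrite -gg' //; have := fg p pN; rewrite fserDE fserNE => /eqP.
by rewrite subr_eq0 => /eqP.
Qed.

(** [e] is a modulus of adic continuity for [d]. *)
Lemma cc_additive (d : fser -> fser) (e : nat -> nat) :
  (forall f g, d (f - g) = d f - d g) ->
  (forall f g, d (f * g - g * f) \in cc) ->
  (forall N f, ordge (e N) f -> ordge N (d f)) ->
  forall f, f \in cc -> d f \in cc.
Proof.
move=> dB dcc de f fcc; apply: cc_lim => N.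
have d0 : d 0 = 0 by have := dB 0 0; rewrite !subrr.
have dD x y : d (x + y) = d x + d y.
  by rewrite -{1}[y]opprK dB -[- y]sub0r dB d0 sub0r opprK.
have /asboolP/(_ (e N))[g [s gE] fg] := fcc; exists (d g).
  rewrite gE (big_morph d dD d0); apply: rpred_sum => x _; exact: dcc.
rewrite -dB; apply: de => p pN.
by rewrite fserDE fserNE fg // subrr.
Qed.

Lemma vder_cc (xi : arrow Q -> fser) f : f \in cc -> vder xi f \in cc.
Proof.
apply: (cc_additive (e := S)) => [x y|x y|N x xN].
- exact: vderB.
- rewrite vderB !vderM (_ : _ - _ = (vder xi x * y - y * vder xi x) + (x * vder xi y - vder xi y * x)).
    by apply: rpredD; exact: cc_comm.
  by apply/funext => p; rewrite !(fserDE, fserNE); ring.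
- exact: (@ordge_vder_pred _ _ _ N.+1).
Qed.

Lemma sub_cc (h : arrow Q -> fser) f : (forall a, ordge 1 (h a)) ->
  (forall a, par a (h a)) -> f \in cc -> sub h f \in cc.
Proof.
move=> h1 hp; apply: (cc_additive (e := id)) => [x y|x y|N x xN].
- exact: subB.
- by rewrite subB !subM //; exact: cc_comm.
- exact: ordge_sub.
Qed.

Lemma cc_scale (z : K) f : f \in cc -> z *: f \in cc.
Proof.
apply: (cc_additive (e := id)) => [x y|x y|N x xN].
- exact: scalerBr.
- rewrite scalerBr -scale_mull -scale_mulr; exact: cc_comm.
- exact: ordgeZ.
Qed.

(* The bimodule element [A] acts on the left factor as well as, flipped, on the
   right factor, up to commutators. *)
Lemma ins_cc A D x : ins A D * x - D * ins (swapK A) x \in cc.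
Proof.
apply: cc_lim => n.
suff: forall m A x, ordge (n - m) x ->
    exists2 g, g \in cc & ordge n (ins A D * x - D * ins (swapK A) x - g).
  by move=> /(_ n A x); apply; rewrite subnn.
elim=> [|m IH] {}A {}x.
  rewrite subn0 => xn; exists 0; rewrite ?rpred0 // subr0.
  by apply: ordgeB; apply: ordgeMl => //; exact: ordge_ins0.
move=> xn.
have /fin_all_exists[G hG] a : exists g, g \in cc /\
    ordge n (ins (lderK a A) D * (x * arr a) - D * ins (swapK (lderK a A)) (x * arr a) - g).
  have [|g gcc gn] := IH (lderK a A) (x * arr a); last by exists g.
  by apply: ordge_le (ordgeM xn (@ordge_arr _ _ a)); rewrite subnS addn1 leqSpred.
pose y i := D * rsl A (triv i) * x; pose z a := ins (lderK a A) D * x.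
exists (\sum_i (ev i * y i - y i * ev i) +
  \sum_a ((arr a * z a - z a * arr a) + G a)).
  apply: rpredD; apply: rpred_sum => j _; first exact: cc_comm.
  by apply: rpredD; [exact: cc_comm|have [] := hG j].
have -> : ins (swapK A) x = \sum_i rsl A (triv i) * x * ev i
    + \sum_a ins (swapK (lderK a A)) (x * arr a).
  under eq_bigr do rewrite -ins_tensor.
  under [X in _ + X]eq_bigr do rewrite -ins_swap_l.
  rewrite -!ins_suml -insDl; congr ins; apply/funext => -[u v] /=.
  rewrite -[LHS]/(lsl A u v) {1}[lsl A u]fser_decomp fserDE fl_sum !fser_sumE.
  by congr (_ + _); apply: eq_bigr => i _; rewrite fserZE.
rewrite ins_peel mulrDl mulrDr !mulr_suml !mulr_sumr.
rewrite opprD addrACA -!sumrB opprD addrACA -!sumrB; apply: ordgeD.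
  apply: ordge_sum => i _; rewrite /y !mulrA subrr; exact: ordge_zero.
apply: ordge_sum => a _; have [_] := hG a.
congr ordge; rewrite /z !mulrA.
by apply/funext => p; rewrite !(fserDE, fserNE); ring.
Qed.

(** Modulo commutators, a vector field acts on a potential by pairing with its cyclic derivatives.
    This links elements of the Jacobi ideal to infinitesimal deformations of the potential. *)
Lemma vder_cdr (xi : arrow Q -> fser) f :
  vder xi f - \sum_a xi a * fder a f \in cc.
Proof.
rewrite /vder -sumrB; apply: rpred_sum => a _.
by have := ins_cc (dker a f) (xi a) 1; rewrite mulr1 -/(cdr _ _ _) fder_cdr.
Qed.

Lemma cc_const f i : f \in cc -> const f i = 0.
Proof.
move=> /asboolP/(_ 1%N)[_ [s ->] h]; rewrite /const h //.
rewrite fser_sumE big1 // => x _.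
by rewrite fserDE fserNE -!/(const _ i) !constM mulrC subrr.
Qed.

Definition rotr f : fser := \sum_a lder a f * arr a.

Lemma rotr_cc f : f - fl (const f) - rotr f \in cc.
Proof.
have -> : f - fl (const f) = \sum_a arr a * lder a f.
  by rewrite {1}(fser_decomp f) addrC addKr.
rewrite /rotr -sumrB.
by apply: rpred_sum => a _; exact: cc_comm.
Qed.

Lemma mul_arr g a p w : parrows p = rcons w a ->
  (g * arr a) p = g (ptake (plen p).-1 p).
Proof.
move=> pw; have lp : plen p = (size w).+1 by rewrite /plen pw size_rcons.
rewrite fserME lp /= 2!big_ord_recr /= big1 ?add0r => [|k _].
  rewrite {1}/arr parrows_drop pw -cats1 drop_size_cat // eqxx mulr1.
  by rewrite /arr parrows_drop pw -cats1 drop_oversize ?mulr0 ?addr0 // size_cat addn1.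
rewrite /arr parrows_drop; case: eqP; rewrite ?mulr0 // => /(congr1 size).
by rewrite size_drop -/(plen p) lp /=; have := ltn_ord k; lia.
Qed.

Lemma mul_arrN g a p : last a (parrows p) != a -> (g * arr a) p = 0.
Proof.
move=> h; rewrite fserME big1 // => k _; rewrite /arr parrows_drop.
case: eqP => [E|]; rewrite ?mulr0 //; move: h.
rewrite -(cat_take_drop k (parrows p)) E last_cat /= eqxx //.
Qed.

Lemma mul_arr0 g a p : plen p = 0%N -> (g * arr a) p = 0.
Proof.
move=> p0; rewrite fserME p0 big_ord1 /arr parrows_drop.
by move/size0nil: p0 => ->; rewrite mulr0.
Qed.

Lemma rotrE f p : (0 < plen p)%N ->
  rotr f p = if cyclic p then f (prot (plen p).-1 p) else 0.
Proof.
move=> p0; rewrite /rotr fser_sumE.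
have [w [a pw]] : exists w a, parrows p = rcons w a.
  by move: p0; rewrite /plen; case/lastP: (parrows p) => // w a; exists w, a.
rewrite (bigD1 a) //= big1 ?addr0; last first.
  by move=> b ba; apply: mul_arrN; rewrite pw last_rcons eq_sym.
have lp : plen p = (size w).+1 by rewrite /plen pw size_rcons.
rewrite (mul_arr _ pw) /lder (_ : pstart (ptake _ _) = pstart p) //.
have pe : pend p = tgt a by rewrite /pend /walk_end pw map_rcons last_rcons.
rewrite -pe -/(cyclic p); case: ifP => // cp.
rewrite (@fcoef_p _ _ f (prot (plen p).-1 p)) //.
  rewrite pstart_prot // /pend /= parrows_take lp pw /= -cats1 take_size_cat //.
  have := walk_p p; rewrite pw -cats1 walk_cat /= andbT => /andP[_ /eqP ->].
  by [].
by rewrite parrows_prot // parrows_take lp pw /= -cats1 rot_size_cat take_size_cat.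
Qed.

Definition homc n j f : fser := fun p =>
  if cyclic p && (plen p == n) then f (iter j (prot 1) p) else 0.

Lemma homc_step n j f : (0 < n)%N -> homc n j.+1 f - homc n j f \in cc.
Proof.
move=> n0; have := rotr_cc (homc n j.+1 f).
have -> : fl (const (homc n j.+1 f)) = 0.
  apply/funext => p; rewrite /fl fser0E /const /homc; case: ifP => // _.
  by rewrite (_ : plen (triv _) = 0%N) // (ltn_eqF n0) andbF.
rewrite subr0; suff -> : rotr (homc n j.+1 f) = homc n j f by [].
apply/funext => p.
have [p0|p0] := posnP (plen p).
  rewrite /homc [in RHS]p0 (ltn_eqF n0) andbF /rotr fser_sumE big1 // => a _.
  exact: mul_arr0.
rewrite rotrE // /homc; case: ifP => // cp /=.
rewrite cyclic_prot // plen_prot; case: eqP => // pn.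
by rewrite -[prot 1 (iter _ _ _)]iterS iterSr -protS ?prednK ?prot_plen // prednK.
Qed.

(** The converse of [rotsum_closure]. Rotating a cyclic part of degree [n] does not change it modulo
    commutators, so [n] times this part is congruent to its rotation sum, which is zero. Membership
    thus becomes a system of equations in finitely many coefficients each, which survives limits of
    numbers. *)
Lemma cc_rotsum f : (forall c, cyclic c -> rotsum f c = 0) ->
  (forall i, const f i = 0) -> f \in cc.
Proof.
move=> h h0; apply: cc_lim => N.
have homcc n : (0 < n)%N -> homc n 0 f \in cc.
  move=> n0; have E j : homc n j f - homc n 0 f \in cc.
    elim: j => [|j IH]; first by rewrite subrr rpred0.
    by rewrite -[homc n j.+1 f](subrK (homc n j f)) -addrA rpredD // homc_step.
  have S : \sum_(j < n) homc n j f = 0.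
    apply/funext => p; rewrite fser_sumE fser0E /homc.
    have [/andP[cp /eqP pn]|_] := boolP (_ && _); last by rewrite big1.
    by have := h p cp; rewrite /rotsum pn.
  have : \sum_(j < n) (homc n j f - homc n 0 f) \in cc by apply: rpred_sum => j _.
  rewrite sumrB S sub0r sumr_const card_ord rpredN => nH.
  have -> : homc n 0 f = n%:R^-1 *: (homc n 0 f *+ n).
    rewrite -scaler_nat scalerA mulVf ?scale1r // pnatr_eq0.
    by rewrite -lt0n.
  exact: cc_scale.
pose ncyc : fser := fun p => if cyclic p then 0 else f p.
have ncc : ncyc \in cc.
  have := rotr_cc ncyc.
  have -> : fl (const ncyc) = 0.
    by apply/funext => p; rewrite /fl fser0E /const /ncyc; case: ifP => // _; rewrite /cyclic eqxx.
  have -> : rotr ncyc = 0; last by rewrite !subr0.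
  apply/funext => p; have [p0|p0] := posnP (plen p).
    by rewrite /rotr fser_sumE big1 // => a _; exact: mul_arr0.
  by rewrite rotrE // /ncyc; case: ifP => // cp; rewrite cyclic_prot.
exists (ncyc + \sum_(n < N) homc n.+1 0 f).
  by apply: rpredD => //; apply: rpred_sum => n _; exact: homcc.
move=> p pN; rewrite fserDE fserNE fserDE fser_sumE /ncyc /homc.
case: ifP => cp /=; last by rewrite big1 ?addr0 ?subrr.
have [p0|p0] := posnP (plen p).
  rewrite big1 ?addr0 ?subr0; first by rewrite (trivE p0); exact: h0.
  by move=> n _; rewrite p0.
have pN' : ((plen p).-1 < N)%N by lia.
rewrite (bigD1 (Ordinal pN')) //= prednK // eqxx big1 ?addr0 ?add0r ?subrr // => n.
rewrite -val_eqE /= => nN; case: eqP => // e; case/eqP: nN; lia.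
Qed.

End Commutators.

(** * Substitutions and derivations acting on potentials *)

Section Classes.
Variables (K : numClosedFieldType) (Q : quiver).
Local Notation aser := (aseries K Q).
Local Notation cc := (@comm_closure K Q).
Implicit Types (f g phi psi : aser) (a b : arrow Q).

Lemma aclassP f g : aclass f = aclass g <-> aval (f - g) \in cc.
Proof.
split=> [/(congr1 (@potval K Q))/fclass_eq //|h].
by apply: val_inj; apply/eqP; rewrite -Quotient.idealrBE.
Qed.

Lemma pot_repr (x : potential K Q) : exists f, x = aclass f.
Proof.
by have /asboolP[f fE] := potvalP x; exists f; apply: val_inj.
Qed.

(** By the chain rule [cdr_sub], each [afder a (g psi)] is a sum over [b] of two-sided combinations
    of [g (afder b psi)]. *)
Lemma chain_cl (g : aser -> aser) h (I : aser -> Prop) psi : aend g h ->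
  tideal I -> (forall b, I (g (afder b psi))) -> forall a, cl I (afder a (g psi)).
Proof.
move=> [h1 hp han gE] tI hI a.
have C b : cdr a (h b) (aval (g (afder b psi))) \in @analytic K Q.
  by apply: cdr_analytic => //; exact: avalP.
have -> : afder a (g psi) = \sum_b ASeries (C b).
  apply: aval_inj; rewrite aval_sum /= gE fder_cdr.
  rewrite -{1}[1](@sub_fl _ _ h h1 (fun=> 1)) cdr_sub //.
  by apply: eq_bigr => b _; rewrite gE /= fder_cdr.
apply: tideal_sum; first exact: cl_tideal.
move=> b _; apply: (ins_cl tI _ (hI b)); last reflexivity.
exact/swapK_growth/dker_growth.
Qed.

Lemma vder_analytic (xi : arrow Q -> fseries K Q) f :
  (forall a, xi a \in @analytic K Q) -> vder xi (aval f) \in @analytic K Q.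
Proof.
move=> xan; apply: rpred_sum => a _; apply: ins_analytic => //.
by apply: dker_growth; exact: avalP.
Qed.

(* A derivation that maps [J] to itself cannot have constant terms: otherwise,
   applying it [N] times to [a^N] in [J] would yield an element of [J] outside
   the arrow ideal. *)
Lemma vder_ordge1 (J : aser -> Prop) (xi : arrow Q -> fseries K Q) :
  tideal J -> opn J -> (forall f, J f -> ordge 1 (aval f)) ->
  (forall a, par a (xi a)) -> (forall a, xi a \in @analytic K Q) ->
  (forall f g, J f -> aval g = vder xi (aval f) -> J g) ->
  forall a, ordge 1 (xi a).
Proof.
move=> tJ [N JN] J1 xpar xan Jxi a; apply/ordge1P => i; apply: contrapT => nz.
pose z := const (xi a) i; have z0 : z != 0 by apply/eqP.
have [si ti] : i = src a /\ i = tgt a.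
  split; apply: contrapT => ia; apply: nz; apply: xpar.
    by rewrite /pstart /=; case: eqP => // e; case: ia.
  by rewrite [pend _]/= andbC; case: eqP => // e; case: ia.
have ea : ev K i * arr K a = arr K a.
  by rewrite si; apply: par_lev; exact: par_arr.
(* [X 0] is the idempotent at [i], which lies outside the arrow ideal: the descent ends there. *)
pose X k := ev K i * arr K a ^+ k.
have Xe k : X k * ev K i = X k.
  case: k => [|k]; rewrite /X.
    rewrite expr0 mulr1 /ev fl_rmul; apply/funext => p; rewrite /fl.
    case: ifP => p0; last by rewrite mul0r.
    have -> : pend p = pstart p by rewrite {1}(trivE (eqP p0)).
    by case: eqP => _; rewrite ?mulr1 ?mulr0.
  rewrite exprSr !mulrA -[_ * arr K a * _]mulrA ti par_rev //; exact: par_arr.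
have Xord k : ordge k (X k).
  apply: ordgeMl; elim: k => [|k IH]; first by [].
  by rewrite exprS -add1n; apply: ordgeM => //; exact: ordge_arr.
have xa : ordge 1 (xi a - z *: ev K i).
  apply/ordge1P => j; rewrite /const fserDE fserNE fserZE -/(const _ j).
  rewrite -/(const (ev K i) j) const_fl; have [->|ji] := eqVneq j i.
    by rewrite mulr1 subrr.
  rewrite mulr0 subr0; apply: xpar; rewrite [pstart _]/= -si.
  by rewrite (negbTE ji).
have dX k : ordge k.+1 (vder xi (X k.+1) - (k.+1%:R * z) *: X k).
  elim: k => [|k IH].
    rewrite mul1r /X expr1 ea vder_arr cut_par // expr0 mulr1.
    exact: xa.
  have XS : X k.+2 = X k.+1 * arr K a by rewrite /X exprSr mulrA.
  have -> : vder xi (X k.+2) - (k.+2%:R * z) *: X k.+1 =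
      (vder xi (X k.+1) - (k.+1%:R * z) *: X k) * arr K a
      + X k.+1 * (xi a - z *: ev K i).
    rewrite XS vderM vder_arr cut_par // mulrBl mulrBr scale_mulr Xe scale_mull.
    rewrite (_ : X k * arr K a = X k.+1); last by rewrite /X exprSr mulrA.
    rewrite -[k.+2]addn1 natrD mulrDl mul1r scalerDl.
    by apply/funext => p; rewrite !(fserDE, fserNE); ring.
  apply: ordgeD; rewrite -addn1; apply: ordgeM => //.
  exact: ordge_arr.
(* Each application of [vder xi] shortens the leading monomial by one letter and multiplies its
   coefficient by the nonzero [k.+1%:R * z]; the terms of higher order lose at most one degree. *)
have P m : (m <= N)%N -> exists f (c : K), [/\ J f, c != 0 &
    ordge (N - m).+1 (aval f - c *: X (N - m)%N)].
  elim: m => [|m IH] mN.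
    have Xan : X N \in @analytic K Q.
      rewrite /X; apply: rpredM; first exact: (avalP (al _)).
      by apply: rpredX; exact: arr_analytic.
    exists (ASeries Xan), 1; rewrite subn0 scale1r subrr oner_eq0; split=> //.
    by apply: JN; exact: Xord.
  have [f [c [Jf c0 fc]]] := IH (ltnW mN).
  have kE : (N - m = (N - m.+1).+1)%N by lia.
  move: fc; rewrite kE; move: (N - m.+1)%N => k fc.
  exists (ASeries (vder_analytic f xan)), (c * (k.+1%:R * z)); split.
  - exact: Jxi Jf _.
  - by rewrite !mulf_neq0 // pnatr_eq0.
  have -> : aval (ASeries (vder_analytic f xan)) - (c * (k.+1%:R * z)) *: X k =
     vder xi (aval f - c *: X k.+1) + c *: (vder xi (X k.+1) - (k.+1%:R * z) *: X k).
    rewrite vderB vderZ scalerBr scalerA /=.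
    by apply/funext => p; rewrite !(fserDE, fserNE, fserZE); ring.
  by apply: ordgeD; [exact: (@ordge_vder_pred _ _ _ k.+2)|exact: ordgeZ].
have [f [c [Jf c0]]] := P N (leqnn N); rewrite subnn => /(_ (triv i) isT).
rewrite fserDE fserNE fserZE (J1 f Jf) // sub0r /X expr0 mulr1.
rewrite -/(const (ev K i) i) const_fl eqxx mulr1 => /eqP.
by rewrite oppr_eq0 (negbTE c0).
Qed.

End Classes.

(** * Estimates for derivations *)

(* The coefficients of the power series [(1 - x) ^ - s.+1]. *)
Definition nb s n := 'C(n + s, s).

Lemma nb0 n : nb 0 n = 1%N. Proof. by rewrite /nb addn0 bin0. Qed.

Lemma nb_sum s n : (\sum_(i < n.+1) nb s i)%N = nb s.+1 n.
Proof.
elim: n => [|n IH]; first by rewrite big_ord1 /nb !binn.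
by rewrite big_ord_recr /= IH /nb [in RHS]addSn binS addSnnS.
Qed.

Lemma nb_mono s s' n : (s <= s')%N -> (nb s n <= nb s' n)%N.
Proof.
elim: s' => [|s' IH]; first by rewrite leqn0 => /eqP ->.
rewrite leq_eqVlt => /orP[/eqP -> //|/IH h]; apply: leq_trans h _.
by rewrite -nb_sum big_ord_recr leq_addl.
Qed.

Lemma bin_leq_expn n k : ('C(n, k) <= 2 ^ n)%N.
Proof.
elim: n k => [|n IH] [|k] //; first by rewrite bin0 expn_gt0.
by rewrite binS expnS mul2n -addnn leq_add.
Qed.

Lemma nb_expn s n : (nb s n <= 2 ^ (n + s))%N.
Proof. exact: bin_leq_expn. Qed.

(** The cost of a derivation: the number [n.+1] of positions is traded for [s.+2], which does not
    depend on the length, by raising the index. *)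
Lemma nb_mul s n : (n.+1 * nb s.+1 n <= s.+2 * nb s.+2 n)%N.
Proof.
rewrite /nb -mul_bin_diag [in X in (_ <= _ * X)%N]addnS leq_mul //.
by rewrite addnS ltnS leq_addr.
Qed.

Lemma nb_tail s n k : (k <= n)%N ->
  (\sum_(i < k) nb s (i + (n - k)).+1 <= nb s.+1 n)%N.
Proof.
move=> kn; rewrite -nb_sum (_ : n.+1 = ((n - k).+1 + k)%N); last by lia.
rewrite big_split_ord /=; apply: leq_trans (leq_addl _ _).
by apply: leq_sum => i _; rewrite addSn addnC.
Qed.

Section Bounds.
Variables (K : numClosedFieldType) (Q : quiver).
Local Notation fser := (fseries K Q).
Local Notation ker := (qpath Q * qpath Q -> K).
Local Notation ev := (@ev K Q).
Local Notation cc := (@comm_closure K Q).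
Local Notation biplen := (@biplen Q).
Implicit Types (f g x y D : fser) (p q u v : qpath Q) (a b : arrow Q) (A : ker).

Lemma cut_fder_cc b y f : cut b y * fder b f - fder b f * y \in cc.
Proof.
have De : fder b f * ev (src b) = fder b f by rewrite fder_cdr cdr_rmul eqxx scale1r.
have eD : ev (tgt b) * fder b f = fder b f by rewrite fder_cdr cdr_lmul eqxx scale1r.
rewrite /cut -!mulrA eD.
have := cc_comm (ev (src b)) (y * fder b f).
rewrite -[in X in _ - X]mulrA De => h1.
by rewrite -[X in X - _](subrK (y * fder b f)) -addrA rpredD // cc_comm.
Qed.

Section Transport.
Variable B : arrow Q -> arrow Q -> ker.

(* If [fder a theta = sum_b ins (B a b) (fder b psi)], then [xi] acts on [theta]
   as [transport xi] acts on [psi], modulo commutators. *)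
Definition transport (xi : arrow Q -> fser) b : fser :=
  cut b (\sum_a mulK (swapK (lmulK (xi a) (B a b)))).

Lemma transport_ord1 xi b : (forall a, ordge 1 (xi a)) -> ordge 1 (transport xi b).
Proof.
move=> x1; apply: ordge_cut; apply: ordge_sum => a _.
rewrite -ins1 -[1%N]addn0; apply: ordge_ins => // -[u v] uv.
rewrite /swapK /lmulK /= fserME.
have v0 : plen v = 0%N by move: uv; rewrite /biplen /=; lia.
by rewrite v0 big_ord1 [xi a _]x1 ?mul0r // plen_take.
Qed.

Lemma transport_cc (psi theta : fser) xi :
  (forall a, fder a theta = \sum_b ins (B a b) (fder b psi)) ->
  vder (transport xi) psi - vder xi theta \in cc.
Proof.
move=> hB; pose y b := \sum_a mulK (swapK (lmulK (xi a) (B a b))).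
have E1 := vder_cdr (transport xi) psi; have E2 := vder_cdr xi theta.
have E3 : \sum_b transport xi b * fder b psi - \sum_b fder b psi * y b \in cc.
  by rewrite -sumrB; apply: rpred_sum => b _; exact: cut_fder_cc.
have E4 : \sum_a xi a * fder a theta - \sum_b fder b psi * y b \in cc.
  under eq_bigr do rewrite hB mulr_sumr.
  under [X in _ - X]eq_bigr do rewrite mulr_sumr.
  rewrite exchange_big -sumrB; apply: rpred_sum => b _.
  rewrite -sumrB; apply: rpred_sum => a _.
  have := ins_cc (lmulK (xi a) (B a b)) (fder b psi) 1.
  by rewrite mulr1 ins1 insMl.
have -> : vder (transport xi) psi - vder xi theta =
  (vder (transport xi) psi - \sum_b transport xi b * fder b psi)
  + (\sum_b transport xi b * fder b psi - \sum_b fder b psi * y b)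
  - (\sum_a xi a * fder a theta - \sum_b fder b psi * y b)
  - (vder xi theta - \sum_a xi a * fder a theta).
  by apply/funext => p; rewrite !(fserDE, fserNE); ring.
by rewrite rpredB // rpredB // rpredD.
Qed.

Variables (C be : K).
Hypothesis C1 : 1 <= C.
Hypothesis be0 : 0 <= be.
Hypothesis hB : forall a b uv, `|B a b uv| <= be * C ^+ biplen uv.

Let C0 : 0 <= C. Proof. exact: le_trans C1. Qed.

(** Each of the two nested convolutions in [transport] raises the index of [nb] by one; [C] is
    unchanged. *)
Lemma transport_bound (X : K) s xi b : 0 <= X ->
  (forall a p, `|xi a p| <= X * C ^+ plen p * (nb s (plen p))%:R) ->
  forall p, `|transport xi b p| <=
    (#|arrow Q|%:R * be * X) * C ^+ plen p * (nb s.+2 (plen p))%:R.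
Proof.
move=> X0 hx p; apply: le_trans (cut_dom _ _ _) _; rewrite fser_sumE.
apply: le_trans (ler_norm_sum _ _ _) _.
apply: (@le_trans _ _ (\sum_a (X * be * C ^+ plen p * (nb s.+2 (plen p))%:R))).
  apply: ler_sum => a _; rewrite /mulK; apply: le_trans (ler_norm_sum _ _ _) _.
  apply: (@le_trans _ _ (\sum_(k < (plen p).+1)
      X * be * C ^+ plen p * (nb s.+1 (plen p - k))%:R)).
    apply: ler_sum => k _; rewrite /swapK /lmulK /= fserME.
    have kp : (k <= plen p)%N by rewrite -ltnS.
    apply: le_trans (ler_norm_sum _ _ _) _; rewrite plen_drop.
    rewrite -nb_sum natr_sum mulr_sumr; apply: ler_sum => i _; rewrite normrM.
    have ip : (i <= plen (pdrop k p))%N by rewrite plen_drop -ltnS.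
    apply: le_trans (ler_pM _ _ (hx _ _) (hB _ _ _)) _ => //.
    rewrite /biplen /= plen_take // plen_drop plen_drop plen_take //.
    have e : C ^+ plen p = C ^+ i * C ^+ (plen p - k - i + k).
      by rewrite -exprD; congr (_ ^+ _); move: ip; rewrite plen_drop; lia.
    by rewrite e le_eqVlt; apply/orP; left; apply/eqP; ring.
  rewrite -mulr_sumr -natr_sum ler_wpM2l ?mulr_ge0 ?exprn_ge0 // ler_nat.
  rewrite -nb_sum (reindex_inj rev_ord_inj) /=.
  by apply: leq_sum => k _; rewrite subSS subKn // -ltnS.
rewrite sumr_const -[X in X <= _]mulr_natl le_eqVlt; apply/orP; left; apply/eqP; ring.
Qed.

(** All the iterates share one radius: [nb (k * 2) n] is at most [2^n 4^k], where [2^n] halves the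
    radius once and for all, while [4^k] only affects convergence in time. *)
Lemma iter_transport_bound (X : K) xi k b : 0 <= X ->
  (forall a p, `|xi a p| <= X * C ^+ plen p) ->
  forall p, `|iter k transport xi b p| <=
    X * (4%:R * #|arrow Q|%:R * be) ^+ k * (2%:R * C) ^+ plen p.
Proof.
move=> X0 hx; have Y0 : 0 <= #|arrow Q|%:R * be by rewrite mulr_ge0.
suff H c p : `|iter k transport xi c p| <=
    X * (#|arrow Q|%:R * be) ^+ k * C ^+ plen p * (nb (k * 2) (plen p))%:R.
  move=> p; apply: le_trans (H _ _) _.
  apply: (@le_trans _ _ (X * (#|arrow Q|%:R * be) ^+ k * C ^+ plen p * (2 ^ (plen p + k * 2))%:R)).
    by rewrite ler_wpM2l ?ler_nat ?nb_expn // !mulr_ge0 ?exprn_ge0.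
  have -> : (2 ^ (plen p + k * 2))%:R = 2%:R ^+ plen p * 4%:R ^+ k :> K.
    by rewrite expnD natrM mulnC expnM !natrX.
  rewrite !exprMn le_eqVlt; apply/orP; left; apply/eqP; ring.
elim: k c p => [|k IH] c p; first by rewrite mulr1 mul0n nb0 mulr1; exact: hx.
rewrite iterS mulSn; apply: le_trans (transport_bound c _ IH _) _.
  by rewrite mulr_ge0 ?exprn_ge0.
rewrite exprS le_eqVlt; apply/orP; left; apply/eqP; ring.
Qed.

End Transport.

Lemma vderZl (z : K) (xi : arrow Q -> fser) f :
  vder (fun a => z *: xi a) f = z *: vder xi f.
Proof. by rewrite /vder scaler_sumr; apply: eq_bigr => a _; exact: insZr. Qed.

Lemma vder_bound (eta : arrow Q -> fser) f (X M C : K) s : 0 <= X -> 0 <= M -> 1 <= C ->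
  (forall a, ordge 1 (eta a)) -> (forall a p, `|eta a p| <= M * C ^+ (plen p).-1) ->
  (forall p, `|f p| <= X * C ^+ plen p * (nb s (plen p))%:R) ->
  forall p, `|vder eta f p| <=
    (s.+2%:R * #|arrow Q|%:R * M * X) * C ^+ plen p * (nb s.+2 (plen p))%:R.
Proof.
move=> X0 M0 C1 e1 he hf p; have C0 : 0 <= C by exact: le_trans C1.
rewrite /vder fser_sumE; apply: le_trans (ler_norm_sum _ _ _) _.
apply: (@le_trans _ _ (\sum_a (s.+2%:R * M * X) * C ^+ plen p * (nb s.+2 (plen p))%:R)); last first.
  by rewrite sumr_const -[X in X <= _]mulr_natl le_eqVlt; apply/orP; left; apply/eqP; ring.
apply: ler_sum => a _; rewrite /ins /mulK; apply: le_trans (ler_norm_sum _ _ _) _.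
apply: (@le_trans _ _ (\sum_(k < (plen p).+1) X * M * C ^+ plen p * (nb s.+1 (plen p))%:R)); last first.
  rewrite sumr_const card_ord -[X in X <= _]mulr_natl.
  have -> : (plen p).+1%:R * (X * M * C ^+ plen p * (nb s.+1 (plen p))%:R) =
     (X * M * C ^+ plen p) * ((plen p).+1 * nb s.+1 (plen p))%:R by rewrite natrM; ring.
  have -> : s.+2%:R * M * X * C ^+ plen p * (nb s.+2 (plen p))%:R =
     (X * M * C ^+ plen p) * (s.+2 * nb s.+2 (plen p))%:R by rewrite natrM; ring.
  by rewrite ler_wpM2l ?ler_nat ?nb_mul // !mulr_ge0 ?exprn_ge0.
apply: ler_sum => k _; rewrite /rinK /= fserME.
have kp : (k <= plen p)%N by rewrite -ltnS.
apply: le_trans (ler_norm_sum _ _ _) _.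
(* The term [i = k] inserts an empty path and vanishes, [eta a] having no constant term. In the
   others the exponent [(plen p).-1] of the hypothesis compensates for the arrow that is
   replaced. *)
pose c i := if (i < k)%N then (nb s (i + (plen p - k)).+1)%:R else 0 : K.
apply: (@le_trans _ _ (\sum_(i < (plen (ptake k p)).+1) (X * M * C ^+ plen p) * c i)).
  apply: ler_sum => i _; rewrite normrM /c.
  have pk := plen_take kp.
  have ik : (i <= k)%N by have := ltn_ord i; lia.
  have pi : plen (ptake i (ptake k p)) = i by apply: plen_take; lia.
  have pd : plen (pdrop i (ptake k p)) = (k - i)%N by rewrite plen_drop; lia.
  case: ltnP => ik'; last first.
    by rewrite [eta a _]e1 ?normr0 ?mulr0 // pd; lia.
  set m := (i + (plen p - k)).+1.
  have F : `|dker a f (ptake i (ptake k p), pdrop k p)| <= X * C ^+ m * (nb s m)%:R.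
    have R : 0 <= X * C ^+ m * (nb s m)%:R by rewrite !mulr_ge0 ?exprn_ge0.
    have [h|] := boolP ((pstart (pdrop k p) != tgt a) || (pend (ptake i (ptake k p)) != src a)).
      by rewrite dkerN // normr0.
    rewrite negb_or !negbK => /andP[/eqP vb /eqP ub].
    have [q qs qw] := dker_path vb ub; rewrite (dker_p _ vb qs qw).
    have qm : plen q = m.
      by rewrite {1}/plen qw size_cat /= addnS -!/(plen _) plen_drop pi.
    by have := hf q; rewrite qm.
  apply: le_trans (ler_pM _ _ F (he a _)) _ => //; rewrite pd.
  have e : C ^+ plen p = C ^+ m * C ^+ (k - i).-1.
    by rewrite -exprD; congr (_ ^+ _); rewrite /m; lia.
  by rewrite e le_eqVlt; apply/orP; left; apply/eqP; ring.
rewrite -mulr_sumr ler_wpM2l ?mulr_ge0 ?exprn_ge0 //.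
rewrite plen_take // big_ord_recr /= {2}/c ltnn addr0.
rewrite (eq_bigr (fun i : 'I_k => (nb s (i + (plen p - k)).+1)%:R)) => [|i _].
  by rewrite -natr_sum ler_nat nb_tail.
by rewrite /c ltn_ord.
Qed.

End Bounds.

(** * Formal flows *)

Section GeometricSums.
Variable K : numClosedFieldType.
Implicit Types (u v : nat -> K) (S T B : K).

Local Notation h2 := (2%:R^-1 : K).
Local Notation h4 := (4%:R^-1 : K).

(** Convergence is at rate [2^-n], whereas [dominated] asks for terms of size [4^-k]: the difference
    pays for Cauchy products. *)
Definition sums u S := exists B, forall n, `|S - \sum_(k < n) u k| <= B * h2 ^+ n.

Definition dominated B u := forall k, `|u k| <= B * h4 ^+ k.

(* What is needed of the completeness and of the Archimedean property of the
   complex numbers. *)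
Definition geometric_complete :=
  (forall (x : K) B, (forall n, `|x| <= B * h2 ^+ n) -> x = 0) /\
  (forall u B, dominated B u ->
     exists S, forall n, `|S - \sum_(k < n) u k| <= (B *+ 4) * h2 ^+ n).

Definition csum u : K :=
  if pselect (exists S, sums u S) is left h then projT1 (cid h) else 0.

Hypothesis complK : geometric_complete.

Lemma h2_ge0 n : 0 <= h2 ^+ n. Proof. by rewrite exprn_ge0 // invr_ge0. Qed.

Lemma dominated_ge0 B u : dominated B u -> 0 <= B.
Proof. by move=> /(_ 0%N); rewrite mulr1; apply: le_trans. Qed.

Lemma sums_uniq u S T : sums u S -> sums u T -> S = T.
Proof.
move=> [B hB] [C hC]; apply/eqP; rewrite -subr_eq0; apply/eqP.
apply: (complK.1 _ (B + C)) => n; rewrite mulrDl.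
have -> : S - T = (S - \sum_(k < n) u k) - (T - \sum_(k < n) u k) by ring.
by apply: le_trans (ler_normB _ _) _; apply: lerD.
Qed.

Lemma csumE u S : sums u S -> csum u = S.
Proof.
move=> uS; rewrite /csum; case: pselect => [h|[]]; last by exists S.
by case: cid => T /= uT; exact: sums_uniq uT uS.
Qed.

Lemma csum_tail B u n : dominated B u ->
  `|csum u - \sum_(k < n) u k| <= (B *+ 4) * h2 ^+ n.
Proof.
by move=> /complK.2[S hS]; rewrite (@csumE u S) //; exists (B *+ 4).
Qed.

Lemma csumP B u : dominated B u -> sums u (csum u).
Proof. by move=> h; exists (B *+ 4) => n; exact: csum_tail. Qed.

Lemma csum_norm B u : dominated B u -> `|csum u| <= B *+ 4.
Proof. by move=> /(csum_tail 0); rewrite big_ord0 subr0 mulr1. Qed.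

Lemma sums_ext u v S : (forall k, u k = v k) -> sums u S -> sums v S.
Proof. by move=> uv; rewrite (_ : v = u) //; apply/funext => k. Qed.

Lemma sums0 : sums (fun=> 0) 0.
Proof.
exists 0 => n; rewrite big1 ?subrr ?normr0 ?mul0r //.
Qed.

Lemma sumsD u v S T : sums u S -> sums v T -> sums (fun k => u k + v k) (S + T).
Proof.
move=> [B hB] [C hC]; exists (B + C) => n.
rewrite big_split /= opprD addrACA mulrDl.
exact: le_trans (ler_normD _ _) (lerD (hB n) (hC n)).
Qed.

Lemma sumsN u S : sums u S -> sums (fun k => - u k) (- S).
Proof. by move=> [B hB]; exists B => n; rewrite sumrN -opprD normrN. Qed.

Lemma sumsB u v S T : sums u S -> sums v T -> sums (fun k => u k - v k) (S - T).
Proof. by move=> uS /sumsN; exact: sumsD. Qed.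

Lemma sums_sum (I : Type) (r : seq I) (u : I -> nat -> K) (S : I -> K) :
  (forall i, sums (u i) (S i)) ->
  sums (fun k => \sum_(i <- r) u i k) (\sum_(i <- r) S i).
Proof.
move=> h; elim: r => [|i r IH].
  by rewrite big_nil; apply: sums_ext sums0 => k; rewrite big_nil.
by rewrite big_cons; apply: sums_ext (sumsD (h i) IH) => k; rewrite big_cons.
Qed.

Lemma sums_head u z : u 0%N = z -> (forall k, u k.+1 = 0) -> sums u z.
Proof.
move=> u0 uS; exists `|z| => -[|n]; first by rewrite big_ord0 subr0 mulr1.
rewrite big_ord_recl u0 big1 => [|i _]; last exact: uS.
by rewrite addr0 subrr normr0 mulr_ge0 ?h2_ge0.
Qed.

Lemma sum_h2 n : \sum_(k < n) h2 ^+ k <= 2%:R.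
Proof. by apply: geo_le; rewrite ?invr_ge0 // -[X in X <= _]mulr_natr mulVf ?pnatr_eq0. Qed.

Lemma sumsM B C u v S T : dominated B u -> dominated C v -> sums u S -> sums v T ->
  sums (fun k => \sum_(i < k.+1) u i * v (k - i)%N) (S * T).
Proof.
move=> hu hv uS vT; have B0 := dominated_ge0 hu; have C0 := dominated_ge0 hv.
have eS : S = csum u by rewrite (csumE uS).
have eT : T = csum v by rewrite (csumE vT).
exists (B *+ 4 * `|T| + B * (C *+ 4) * 2%:R) => -[|n].
  rewrite big_ord0 subr0 mulr1 normrM; apply: le_trans (_ : B *+ 4 * `|T| <= _).
    by rewrite ler_wpM2r // eS; exact: csum_norm.
  by rewrite lerDl !mulr_ge0 ?mulrn_wge0.
have -> : \sum_(k < n.+1) \sum_(i < k.+1) u i * v (k - i)%N =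
    \sum_(i < n.+1) u i * \sum_(j < (n - i).+1) v j.
  rewrite -(sum_exchange n (fun i k => u i * v (k - i)%N)).
  apply: eq_bigr => i _; rewrite mulr_sumr; apply: eq_bigr => j _.
  by rewrite addKn.
have -> : S * T - \sum_(i < n.+1) u i * \sum_(j < (n - i).+1) v j =
    (S - \sum_(i < n.+1) u i) * T + \sum_(i < n.+1) u i * (T - \sum_(j < (n - i).+1) v j).
  under [X in _ = _ + X]eq_bigr do rewrite mulrBr.
  by rewrite sumrB -mulr_suml; ring.
rewrite [X in _ <= X]mulrDl; apply: le_trans (ler_normD _ _) _; apply: lerD.
  by rewrite normrM mulrAC ler_wpM2r // eS; exact: csum_tail.
apply: le_trans (ler_norm_sum _ _ _) _.
(* The bound [4^-i] times the tail [2^-(n-i+1)] is [2^-(n+1)] times the summable [2^-i]. *)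
apply: (@le_trans _ _ (\sum_(i < n.+1) B * (C *+ 4) * h2 ^+ n.+1 * h2 ^+ i)).
  apply: ler_sum => i _; rewrite normrM eT.
  apply: le_trans (ler_pM _ _ (hu i) (csum_tail _ hv)) _ => //.
  have i_n : (i <= n)%N by rewrite -ltnS.
  have e4 : h4 ^+ i = h2 ^+ i * h2 ^+ i by rewrite -exprMn -invfM -natrM.
  have e2 : h2 ^+ n.+1 = h2 ^+ i * h2 ^+ (n - i).+1.
    by rewrite -exprD; congr (_ ^+ _); lia.
  by rewrite e4 e2 le_eqVlt; apply/orP; left; apply/eqP; ring.
rewrite -mulr_sumr [X in _ <= X]mulrAC ler_wpM2l ?sum_h2 //.
by rewrite !mulr_ge0 ?mulrn_wge0 ?h2_ge0.
Qed.

End GeometricSums.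

(** * Coefficients of the flow in powers of time *)

Section FormalFlow.
Variables (K : numClosedFieldType) (Q : quiver).
Local Notation fser := (fseries K Q).
Local Notation cc := (@comm_closure K Q).
Implicit Types (f g x y : fser) (p q : qpath Q) (a b : arrow Q).
Variable eta : nat -> arrow Q -> fser.

(* The list of the first [k.+1] coefficients of the formal solution of
   [y' = vder (sum_j t ^ j eta_j) y], [y(0) = f]. *)
Fixpoint flows k f : seq fser :=
  if k is k'.+1 then
    rcons (flows k' f) (k%:R^-1 *: \sum_(i < k) vder (eta (k' - i)) (nth 0 (flows k' f) i))
  else [:: f].

Definition flow k f : fser := nth 0 (flows k f) k.

Lemma size_flows k f : size (flows k f) = k.+1.
Proof. by elim: k => //= k IH; rewrite size_rcons IH. Qed.

Lemma nth_flows k i f : (i <= k)%N -> nth 0 (flows k f) i = flow i f.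
Proof.
elim: k => [|k IH]; first by rewrite leqn0 => /eqP ->.
rewrite leq_eqVlt => /orP[/eqP -> //|]; rewrite ltnS => ik.
by rewrite /= nth_rcons size_flows ltnS ik IH.
Qed.

Lemma flow0 f : flow 0 f = f. Proof. by []. Qed.

Lemma flowS k f :
  flow k.+1 f = k.+1%:R^-1 *: \sum_(i < k.+1) vder (eta (k - i)) (flow i f).
Proof.
rewrite /flow /= nth_rcons size_flows ltnn eqxx; congr (_ *: _).
by apply: eq_bigr => i _; rewrite nth_flows // -ltnS.
Qed.

Lemma flowS' k f :
  k.+1%:R *: flow k.+1 f = \sum_(i < k.+1) vder (eta (k - i)) (flow i f).
Proof. by rewrite flowS scalerA mulfV ?scale1r // pnatr_eq0. Qed.

Lemma flowB k f g : flow k (f - g) = flow k f - flow k g.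
Proof.
elim/ltn_ind: k => -[|k] IH; first by rewrite !flow0.
rewrite !flowS -scalerBr -sumrB; congr (_ *: _); apply: eq_bigr => i _.
by rewrite IH // vderB.
Qed.

Lemma flow_fl k c : flow k.+1 (fl c) = 0.
Proof.
elim/ltn_ind: k => k IH; rewrite flowS big1 ?scaler0 // => i _.
by case: i => -[|i] /= ik; rewrite ?flow0 ?vder_fl // IH ?vder0.
Qed.

Lemma fsum_exchange n (F : nat -> nat -> fser) :
  \sum_(k < n.+1) \sum_(j < (n - k).+1) F k (k + j)%N =
  \sum_(j < n.+1) \sum_(k < j.+1) F k j.
Proof.
apply/funext => p; rewrite !fser_sumE.
under eq_bigr do rewrite fser_sumE; under [RHS]eq_bigr do rewrite fser_sumE.
exact: (sum_exchange n (fun k j => F k j p)).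
Qed.

(** As [vder] is a derivation, both sides are the coefficients of solutions of one differential
    equation. The factor [k.+1%:R] is that of differentiation in [t]; it is cancelled in
    characteristic zero. *)
Lemma flowM k f g : flow k (f * g) = \sum_(i < k.+1) flow i f * flow (k - i) g.
Proof.
elim/ltn_ind: k => -[|k] IH; first by rewrite big_ord1.
have k0 : k.+1%:R != 0 :> K by rewrite pnatr_eq0.
suff : k.+1%:R *: flow k.+1 (f * g) = k.+1%:R *: \sum_(i < k.+2) flow i f * flow (k.+1 - i) g.
  by move/(congr1 (fun x => k.+1%:R^-1 *: x)); rewrite !scalerA mulVf // !scale1r.
have -> : k.+1%:R *: (\sum_(i < k.+2) flow i f * flow (k.+1 - i) g) =
   \sum_(i < k.+2) (i%:R *: flow i f) * flow (k.+1 - i) g +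
   \sum_(i < k.+2) flow i f * ((k.+1 - i)%:R *: flow (k.+1 - i) g).
  rewrite scaler_sumr -big_split; apply: eq_bigr => i _ /=.
  rewrite scale_mull scale_mulr -scalerDl -natrD subnKC //.
  by rewrite -ltnS.
rewrite big_ord_recl scale0r mul0r add0r [X in _ + X]big_ord_recr /= subnn scale0r mulr0 addr0.
rewrite (eq_bigr (fun m : 'I_k.+1 => \sum_(j < m.+1) vder (eta (m - j)) (flow j f) * flow (k - m) g)); last first.
  by move=> m _; rewrite /bump add1n flowS' mulr_suml subSS.
rewrite [X in _ = _ + X](eq_bigr (fun m : 'I_k.+1 => \sum_(j < (k - m).+1) flow m f * vder (eta (k - m - j)) (flow j g))); last first.
  move=> m _; have mk : (m <= k)%N by rewrite -ltnS.
  by rewrite subSn // flowS' mulr_sumr.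
rewrite flowS'.
rewrite (eq_bigr (fun i : 'I_k.+1 => \sum_(j < i.+1) vder (eta (k - i)) (flow j f) * flow (i - j) g +
   \sum_(j < i.+1) flow j f * vder (eta (k - i)) (flow (i - j) g))); last first.
  move=> i _; rewrite IH // vder_sum -big_split; apply: eq_bigr => j _ /=.
  exact: vderM.
rewrite big_split /=; congr (_ + _); last first.
  rewrite -(fsum_exchange k (fun j i => flow j f * vder (eta (k - i)) (flow (i - j) g))).
  by apply: eq_bigr => j _; apply: eq_bigr => l _; rewrite addKn subnDA.
rewrite -(fsum_exchange k (fun j i => vder (eta (k - i)) (flow j f) * flow (i - j) g)).
rewrite -(fsum_exchange k (fun j m => vder (eta (m - j)) (flow j f) * flow (k - m) g)).
apply: eq_bigr => j _; rewrite [RHS](reindex_inj rev_ord_inj) /=.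
apply: eq_bigr => l _; have lk : (l <= k - j)%N by rewrite -ltnS.
by congr (vder (eta _) _ * flow _ _); lia.
Qed.

(** The hypotheses say that, modulo commutators, [psi + t theta] solves the equation whose formal
    solution from [psi] is [flow]; so the coefficients agree. *)
Lemma flow_cc (psi theta : fser) : vder (eta 0%N) psi - theta \in cc ->
  (forall k, vder (eta k.+1) psi + vder (eta k) theta \in cc) ->
  forall k, flow k psi - (if k is k'.+1 then (if k' is 0%N then theta else 0) else psi) \in cc.
Proof.
move=> h0 hS; elim/ltn_ind => -[|[|k]] IH.
- by rewrite flow0 subrr rpred0.
- by rewrite flowS big_ord1 invr1 scale1r.
rewrite subr0 flowS; apply: cc_scale.
rewrite big_ord_recl big_ord_recl /= flow0 subn0 addrA.
apply: rpredD; last first.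
  apply: rpred_sum => i _; apply: vder_cc.
  have := IH (bump 0 (bump 0 i)); rewrite /bump /= !add1n subr0; apply.
  by rewrite !ltnS.
have := IH 1%N isT => h1; rewrite /bump /= subSS subn0.
have -> : vder (eta k.+1) psi + vder (eta k) (flow 1 psi) =
   (vder (eta k.+1) psi + vder (eta k) theta) + vder (eta k) (flow 1 psi - theta).
  by rewrite vderB addrA addrAC addrK.
by apply: rpredD => //; exact: vder_cc.
Qed.

Variables (M mu D : K).
Hypothesis M0 : 0 <= M.
Hypothesis mu0 : 0 <= mu.
Hypothesis D1 : 1 <= D.
Hypothesis eta1 : forall j a, ordge 1 (eta j a).
Hypothesis heta : forall j a p, `|eta j a p| <= M * mu ^+ j * D ^+ (plen p).-1.

(** The summand [mu *+ 2] bounds the sum of the [mu^(k-i) E^i] by [2 E^k]. The other absorbs this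
    two, the two in the index [2 k] of the binomials, and the factor from [vder_bound]. *)
Let E := mu *+ 2 + 4%:R * #|arrow Q|%:R * M.

Lemma flowE0 : 0 <= E.
Proof. by rewrite addr_ge0 ?mulrn_wge0 ?mulr_ge0. Qed.

Lemma sum_mu_E k : \sum_(i < k.+1) mu ^+ (k - i) * E ^+ i <= E ^+ k *+ 2.
Proof.
elim: k => [|k IH].
  by rewrite big_ord1 mulr1 expr0 mulr2n lerDl.
rewrite big_ord_recr /= subnn mul1r mulr2n lerD2r.
rewrite (eq_bigr (fun i : 'I_k.+1 => mu * (mu ^+ (k - i) * E ^+ i))); last first.
  by move=> i _; rewrite mulrA -exprS subSn // -ltnS.
rewrite -mulr_sumr; apply: le_trans (ler_wpM2l mu0 IH) _.
rewrite mulrnAr -mulrnAl exprS ler_wpM2r ?exprn_ge0 ?flowE0 //.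
by rewrite lerDl !mulr_ge0.
Qed.

(* By induction on [k], [flow k f] has coefficients bounded by
   [A E^k C^n 'C(n + 2k, 2k)] in length [n]; each derivation raises the index of
   the binomial coefficient by two, and the factor [2k] this costs is compensated
   by the division by [k] in the recursion. *)
Lemma flow_bound (A C : K) f : 0 <= A -> D <= C ->
  (forall p, `|f p| <= A * C ^+ plen p) ->
  forall k p, `|flow k f p| <= A * (4%:R * E) ^+ k * (2%:R * C) ^+ plen p.
Proof.
move=> A0 DC hf k p; have D0 : 0 <= D by exact: le_trans D1.
have C1 : 1 <= C by exact: le_trans DC.
have C0 : 0 <= C by exact: le_trans C1.
have E0 := flowE0.
have het j a q : `|eta j a q| <= M * mu ^+ j * C ^+ (plen q).-1.
  apply: le_trans (heta _ _ _) _; rewrite ler_wpM2l ?mulr_ge0 ?exprn_ge0 //.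
  by apply: lerXn2r; rewrite ?nnegrE.
have H j q : `|flow j f q| <= A * E ^+ j * C ^+ plen q * (nb (j * 2) (plen q))%:R.
  elim/ltn_ind: j q => -[|j] IH q.
    by rewrite flow0 mul0n nb0 !mulr1; exact: hf.
  rewrite flowS fserZE normrM fser_sumE normfV normr_nat.
  rewrite ler_pdivrMl ?ltr0n //; apply: le_trans (ler_norm_sum _ _ _) _.
  pose n0 : K := #|arrow Q|%:R; pose N := (nb (j.+1 * 2) (plen q))%:R : K.
  apply: (@le_trans _ _ (\sum_(i < j.+1)
      (j.+1%:R * 2%:R * n0 * M * A * C ^+ plen q * N) * (mu ^+ (j - i) * E ^+ i))).
    apply: ler_sum => i _; have ij : (i <= j)%N by rewrite -ltnS.
    have := @vder_bound K Q (eta (j - i)) (flow i f) (A * E ^+ i) (M * mu ^+ (j - i)) C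
      (i * 2) _ _ C1 (@eta1 _) (het _) (IH i _) q.
    move=> /(_ _ _ _)/le_trans; apply.
    - by rewrite mulr_ge0 ?exprn_ge0.
    - by rewrite mulr_ge0 ?exprn_ge0.
    - exact: ltn_ord.
    have -> : (i * 2).+2%:R * #|arrow Q|%:R * (M * mu ^+ (j - i)) * (A * E ^+ i) *
        C ^+ plen q * (nb (i * 2).+2 (plen q))%:R =
      (n0 * M * A * C ^+ plen q * (mu ^+ (j - i) * E ^+ i)) *
        ((i * 2).+2%:R * (nb (i * 2).+2 (plen q))%:R) by rewrite /n0; ring.
    have -> : j.+1%:R * 2%:R * n0 * M * A * C ^+ plen q * N * (mu ^+ (j - i) * E ^+ i) =
      (n0 * M * A * C ^+ plen q * (mu ^+ (j - i) * E ^+ i)) * (j.+1%:R * 2%:R * N) by ring.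
    rewrite ler_wpM2l ?mulr_ge0 ?exprn_ge0 // ler_pM // /N -?natrM ?ler_nat.
      by lia.
    by apply: nb_mono; lia.
  rewrite -mulr_sumr; apply: le_trans (ler_wpM2l _ (sum_mu_E j)) _.
    by rewrite /N /n0 !mulr_ge0 ?exprn_ge0.
  have -> : j.+1%:R * 2%:R * n0 * M * A * C ^+ plen q * N * (E ^+ j *+ 2) =
     (4%:R * n0 * M) * (j.+1%:R * A * C ^+ plen q * N * E ^+ j) by ring.
  have -> : j.+1%:R * (A * E ^+ j.+1 * C ^+ plen q * N) =
     E * (j.+1%:R * A * C ^+ plen q * N * E ^+ j) by rewrite exprS; ring.
  apply: ler_wpM2r; first by rewrite /N !mulr_ge0 ?exprn_ge0.
  by rewrite lerDr mulrn_wge0.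
apply: le_trans (H k p) _.
apply: (@le_trans _ _ (A * E ^+ k * C ^+ plen p * (2 ^ (plen p + k * 2))%:R)).
  by rewrite ler_wpM2l ?ler_nat ?nb_expn // !mulr_ge0 ?exprn_ge0.
have -> : (2 ^ (plen p + k * 2))%:R = 2%:R ^+ plen p * 4%:R ^+ k :> K.
  by rewrite expnD natrM mulnC expnM !natrX.
rewrite !exprMn le_eqVlt; apply/orP; left; apply/eqP; ring.
Qed.

End FormalFlow.

(** * Analytic flows *)

Section NearIdentity.
Variables (K : numClosedFieldType) (I : finType).

(** A vector [v] in the left kernel has [l^1] norm [S] with [S <= n eps S <= S / 2], hence
    vanishes. *)
Lemma near_identity_mx n (L : 'M[K]_n) :
  (forall i j, `|L i j - (i == j)%:R| <= ((1 + n%:R) *+ 2)^-1) -> L \in unitmx.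
Proof.
move=> hL; rewrite -row_free_unit; apply/row_freeP.
suff : kermx L = 0.
  move/eqP; rewrite kermx_eq0 => /row_freeP.
  by case=> B LB; exists B.
apply/eqP; apply: contraT => /rowV0Pn[v /sub_kermxP vL v0].
pose eps : K := ((1 + n%:R) *+ 2)^-1; pose S := \sum_i `|v 0 i|.
have hv j : `|v 0 j| <= S * eps.
  have vj : v 0 j = - \sum_i v 0 i * (L i j - (i == j)%:R).
    under eq_bigr do rewrite mulrBr.
    rewrite sumrB opprB.
    have /rowP/(_ j) := vL; rewrite !mxE => ->; rewrite subr0.
    rewrite (bigD1 j) //= eqxx mulr1 big1 ?addr0 // => i /negbTE ->.
    by rewrite mulr0.
  rewrite vj normrN; apply: le_trans (ler_norm_sum _ _ _) _.
  rewrite mulr_suml; apply: ler_sum => i _; rewrite normrM.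
  exact: ler_wpM2l.
have S0 : S <= 0.
  have : S <= n%:R * eps * S.
    apply: (@le_trans _ _ (\sum_(j < n) S * eps)); first exact: ler_sum.
    by rewrite sumr_const card_ord -[X in X <= _]mulr_natl le_eqVlt; apply/orP; left; apply/eqP; ring.
  have e1 : n%:R * eps <= 2%:R^-1.
    rewrite /eps ler_pdivrMr ?mulrn_wgt0 ?ltr_wpDr //.
    rewrite -[(1 + n%:R) *+ 2]mulr_natr mulrCA mulVf ?pnatr_eq0 // mulr1.
    by rewrite lerDr.
  have S1 : 0 <= S by exact: sumr_ge0.
  move=> h; have := le_trans h (ler_wpM2r S1 e1).
  rewrite mulrC ler_pdivlMr ?ltr0n // mulr_natr mulr2n gerDl.
  by [].
case/negP: v0; apply/eqP/rowP => j; rewrite mxE; apply/eqP.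
rewrite -normr_le0; apply: le_trans S0; rewrite /S (bigD1 j) //= lerDl.
exact: sumr_ge0.
Qed.

Lemma near_identity (L : I -> I -> K) :
  (forall i j, `|L i j - (i == j)%:R| <= ((1 + #|I|%:R) *+ 2)^-1) ->
  exists L' : I -> I -> K,
    (forall i j, \sum_k L i k * L' k j = (i == j)%:R) /\
    (forall i j, \sum_k L' i k * L k j = (i == j)%:R).
Proof.
move=> hL; pose M : 'M[K]_#|I| := \matrix_(i, j) L (enum_val i) (enum_val j).
have Mu : M \in unitmx.
  apply: near_identity_mx => i j; rewrite mxE -(inj_eq enum_val_inj); exact: hL.
exists (fun i j => invmx M (enum_rank i) (enum_rank j)).
have E (F : I -> K) : \sum_k F k = \sum_(k < #|I|) F (enum_val k).
  rewrite (reindex_onto enum_rank enum_val) /=; last by move=> k _; exact: enum_valK.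
  by apply: eq_big => [k|k _]; rewrite enum_rankK ?eqxx.
split=> i j; rewrite E.
  have /matrixP/(_ (enum_rank i) (enum_rank j)) := mulmxV Mu.
  rewrite !mxE (inj_eq enum_rank_inj) => <-; apply: eq_bigr => k _.
  by rewrite mxE enum_valK !enum_rankK.
have /matrixP/(_ (enum_rank i) (enum_rank j)) := mulVmx Mu.
rewrite !mxE (inj_eq enum_rank_inj) => <-; apply: eq_bigr => k _.
by rewrite mxE enum_valK !enum_rankK.
Qed.

End NearIdentity.

(** * Right equivalence is an equivalence relation *)

Section RightEquivalence.
Variables (K : numClosedFieldType) (Q : quiver).
Local Notation aser := (aseries K Q).
Local Notation aarr := (@aarr K Q).
Local Notation cc := (@comm_closure K Q).
Implicit Types (f : aser).

(** The action on potentials is defined through chosen representatives. It does not depend on them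
    because [g], being a substitution, preserves the closure of the commutators. *)
Lemma right_equivalent_of (g : {rmorphism aser -> aser}) (psi phi : aser) :
  bijective g -> (forall c, g (al c) = al c) -> aval (g psi - phi) \in cc ->
  right_equivalent (aclass psi) (aclass phi).
Proof.
move=> gb gl gE; have [h1 hp _ gsub] := aut_aend gl.
have gcc f f' : aclass f = aclass f' -> aclass (g f) = aclass (g f').
  move=> /aclassP h; apply/aclassP; rewrite -rmorphB gsub.
  exact: sub_cc.
pose rp x := projT1 (cid (@pot_repr K Q x)).
have rpE x : aclass (rp x) = x by rewrite /rp; case: cid => f /= ->.
exists g, (fun x => aclass (g (rp x))); split.
- by split.
- by move=> f; apply: gcc; exact: rpE.
by rewrite (gcc _ psi) ?rpE //; apply/aclassP.
Qed.

Lemma bijective_linear (g : {rmorphism aser -> aser}) (L' : arrow Q -> arrow Q -> K) :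
  (forall c, g (al c) = al c) ->
  (forall a c, \sum_b lin (aval (g (aarr a))) b * L' b c = (a == c)%:R) ->
  (forall a c, \sum_b L' a b * lin (aval (g (aarr b))) c = (a == c)%:R) ->
  bijective g.
Proof.
move=> gl LL' L'L; have [h1 hp han gE] := aut_aend gl.
have [k [k1 kp kan kh hk]] := aend_inverse h1 hp han LL' L'L.
have [d [_ _ _ dE]] := sub_aend k1 kp kan.
by exists d => f; apply: aval_inj; rewrite !(gE, dE).
Qed.

Lemma rmorph_inverse (g : {rmorphism aser -> aser}) :
  bijective g -> (forall c, g (al c) = al c) ->
  exists d : {rmorphism aser -> aser},
    [/\ cancel g d, cancel d g & forall c, d (al c) = al c].
Proof.
move=> [d0 gd dg] gl; have [||| d dE] := @mk_rmorphism _ _ d0.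
- by move=> x y; apply: (can_inj gd); rewrite rmorphB !dg.
- by apply: (can_inj gd); rewrite rmorph1 dg.
- by move=> x y; apply: (can_inj gd); rewrite rmorphM !dg.
exists d; split=> [x|x|c]; rewrite dE //.
by apply: (can_inj gd); rewrite dg gl.
Qed.

Lemma right_equivalent_sym (x y : potential K Q) :
  right_equivalent x y -> right_equivalent y x.
Proof.
have [f ->] := pot_repr x; have [f' ->] := pot_repr y.
move=> [g [gp [[gb gl] gi gE]]]; have [d [gd dg dl]] := rmorph_inverse gb gl.
apply: (@right_equivalent_of d) => //; first by exists g.
rewrite -[f](gd f) -rmorphB; have [h1 hp _ ->] := aut_aend dl.
apply: sub_cc => //; apply/aclassP; rewrite -gE; exact: gi.
Qed.

Lemma right_equivalent_trans (x y z : potential K Q) :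
  right_equivalent x y -> right_equivalent y z -> right_equivalent x z.
Proof.
have [f ->] := pot_repr x; have [f' ->] := pot_repr y; have [f'' ->] := pot_repr z.
move=> [g [gp [[gb gl] gi gE]]] [d [dp [[db dl] di dE]]].
have [||| gd gdE] := @mk_rmorphism _ _ (fun x => d (g x)).
- by move=> u v; rewrite !rmorphB.
- by rewrite !rmorph1.
- by move=> u v; rewrite !rmorphM.
apply: (@right_equivalent_of gd) => [|c|].
- by apply: (eq_bij (bij_comp db gb)) => u; rewrite gdE.
- by rewrite gdE gl dl.
have -> : gd f - f'' = (d f' - f'') + d (g f - f').
  by rewrite gdE rmorphB [RHS]addrC addrA subrK.
rewrite avalD; apply: rpredD.
  by apply/aclassP; rewrite -dE; exact: (esym (di f')).
have [h1 hp _ ->] := aut_aend dl; apply: sub_cc => //; apply/aclassP.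
by rewrite -gE; exact: (esym (gi f)).
Qed.

Lemma right_equivalent_refl (x : potential K Q) : right_equivalent x x.
Proof.
have [f ->] := pot_repr x.
apply: (@right_equivalent_of idfun) => //; first by exists id.
by rewrite subrr rpred0.
Qed.

End RightEquivalence.

(** * Summing the flow for small times *)

Section AnalyticFlow.
Variables (K : numClosedFieldType) (Q : quiver).
Hypothesis complK : geometric_complete K.
Local Notation fser := (fseries K Q).
Local Notation aser := (aseries K Q).
Local Notation arr := (@arr K Q).
Local Notation aarr := (@aarr K Q).
Local Notation cc := (@comm_closure K Q).
Local Notation analytic := (@analytic K Q).
Implicit Types (f g : fser) (p q : qpath Q) (a b : arrow Q) (t : K).
Variables (eta : nat -> arrow Q -> fser) (M mu D : K).
Hypothesis M0 : 0 <= M.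
Hypothesis mu0 : 0 <= mu.
Hypothesis D1 : 1 <= D.
Hypothesis eta1 : forall j a, ordge 1 (eta j a).
Hypothesis heta : forall j a p, `|eta j a p| <= M * mu ^+ j * D ^+ (plen p).-1.

Let E := mu *+ 2 + 4%:R * #|arrow Q|%:R * M.
Let E0 : 0 <= E. Proof. exact: (flowE0 _ M0 mu0). Qed.

Definition flow_at t f : fser := fun p => csum (fun k => t ^+ k * flow eta k f p).

Section Small.
Variable t : K.
Hypothesis tE : `|t| * (16%:R * E) <= 1.

(** In [16 E] one factor four is the rate in [flow_bound]; the other produces the ratio [1/4]
    required by [dominated]. *)
Lemma flow_dominated A C f p : 0 <= A -> D <= C ->
  (forall q, `|f q| <= A * C ^+ plen q) ->
  dominated (A * (2%:R * C) ^+ plen p) (fun k => t ^+ k * flow eta k f p).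
Proof.
move=> A0 DC hf k; have C0 : 0 <= C by apply: le_trans DC; exact: le_trans D1.
rewrite normrM normrX; apply: le_trans (ler_wpM2l _ (flow_bound M0 mu0 D1 eta1 heta A0 DC hf k p)) _.
  exact: exprn_ge0.
rewrite -/E [X in X <= _](_ : _ = A * (2%:R * C) ^+ plen p * (`|t| * (4%:R * E)) ^+ k); last first.
  by rewrite [(`|t| * _) ^+ k]exprMn; ring.
apply: ler_wpM2l; first by rewrite mulr_ge0 ?exprn_ge0 ?mulr_ge0.
apply: lerXn2r; rewrite ?nnegrE ?invr_ge0 ?mulr_ge0 //.
rewrite -[4%:R^-1]mul1r ler_pdivlMr ?ltr0n //.
by apply: le_trans tE; rewrite le_eqVlt; apply/orP; left; apply/eqP; ring.
Qed.

Lemma analytic_bound f : f \in analytic -> exists A C : K,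
  [/\ 0 <= A, D <= C & forall q, `|f q| <= A * C ^+ plen q].
Proof.
move=> /analytic1[C C1 [A A0 hA]]; exists A, (C + D).
have C0 : 0 <= C by exact: le_trans C1.
have D0 : 0 <= D by exact: le_trans D1.
split=> //; first by rewrite lerDr.
move=> q; apply: le_trans (hA q) _; rewrite ler_wpM2l //.
by apply: lerXn2r; rewrite ?nnegrE ?addr_ge0 // lerDl.
Qed.

Lemma flow_sums f p : f \in analytic ->
  sums (fun k => t ^+ k * flow eta k f p) (flow_at t f p).
Proof.
move=> /analytic_bound[A [C [A0 DC hf]]].
apply: csumP => //; exact: flow_dominated A0 DC hf.
Qed.

Lemma flow_at_analytic f : f \in analytic -> flow_at t f \in analytic.
Proof.
move=> /analytic_bound[A [C [A0 DC hf]]].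
have C0 : 0 <= C by apply: le_trans DC; exact: le_trans D1.
apply: (@analytic_of _ _ (2%:R * C) (A *+ 4)).
- by rewrite mulr_ge0.
- by rewrite mulrn_wge0.
move=> p; rewrite [X in _ <= X]mulrnAl; apply: (csum_norm complK).
exact: flow_dominated A0 DC hf.
Qed.

Lemma flow_atB f g : f \in analytic -> g \in analytic ->
  flow_at t (f - g) = flow_at t f - flow_at t g.
Proof.
move=> fan gan; apply/funext => p; rewrite fserDE fserNE; apply: (csumE complK).
apply: sums_ext (sumsB (flow_sums p fan) (flow_sums p gan)) => k.
by rewrite flowB fserDE fserNE mulrBr.
Qed.

Lemma flow_at_fl c : flow_at t (fl c) = fl c.
Proof.
apply/funext => p; apply: (csumE complK); apply: sums_head => [|k].
  by rewrite flow0 mul1r.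
by rewrite flow_fl fser0E mulr0.
Qed.

Lemma flow_atM f g : f \in analytic -> g \in analytic ->
  flow_at t (f * g) = flow_at t f * flow_at t g.
Proof.
move=> fan gan; apply/funext => p; rewrite fserME; apply: (csumE complK).
have [A [C [A0 DC hf]]] := analytic_bound fan.
have [A' [C' [A'0 DC' hg]]] := analytic_bound gan.
have := sums_sum (index_enum 'I_(plen p).+1) (fun i => sumsM complK
  (flow_dominated (ptake i p) A0 DC hf) (flow_dominated (pdrop i p) A'0 DC' hg)
  (flow_sums (ptake i p) fan) (flow_sums (pdrop i p) gan)).
apply: sums_ext => k; rewrite exchange_big /= flowM fser_sumE mulr_sumr.
apply: eq_bigr => i _; rewrite fserME mulr_sumr; apply: eq_bigr => m _.
have ik : (i <= k)%N by rewrite -ltnS.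
by rewrite mulrACA -exprD subnKC.
Qed.

Lemma flow_morphism : exists g : {rmorphism aser -> aser},
  (forall c, g (al c) = al c) /\ forall f : aser, aval (g f) = flow_at t (aval f).
Proof.
pose g0 (f : aser) : aser := ASeries (flow_at_analytic (avalP f)).
have [||| g gE] := @mk_rmorphism _ _ g0.
- by move=> x y; apply: aval_inj; apply: flow_atB; exact: avalP.
- by apply: aval_inj; exact: flow_at_fl.
- by move=> x y; apply: aval_inj; apply: flow_atM; exact: avalP.
exists g; split=> [c|f]; last by rewrite gE.
by rewrite gE; apply: aval_inj; exact: flow_at_fl.
Qed.

(** Adic closedness says nothing about a sum converging in [t]. Instead each rotation sum, which
    involves finitely many coefficients, is summed over [k] and vanishes; [cc_rotsum] concludes. *)
Lemma flow_at_cc (psi theta : aser) :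
  vder (eta 0%N) (aval psi) - aval theta \in cc ->
  (forall k, vder (eta k.+1) (aval psi) + vder (eta k) (aval theta) \in cc) ->
  flow_at t (aval psi) - aval (psi + t *: theta) \in cc.
Proof.
move=> h0 hS; have hcc := flow_cc h0 hS.
pose y k : fser := if k is k'.+1 then (if k' is 0%N then aval theta else 0) else aval psi.
have Y p : sums (fun k => t ^+ k * (flow eta k (aval psi) p - y k p))
    ((flow_at t (aval psi) - aval (psi + t *: theta)) p).
  have /(sumsB (flow_sums p (avalP psi))) :
      sums (fun k => t ^+ k * y k p) (aval (psi + t *: theta) p).
    have s0 : sums (fun k => if k == 0%N then aval psi p else 0) (aval psi p).
      by apply: sums_head.
    have s1 : sums (fun k => if k == 1%N then t * aval theta p else 0) (t * aval theta p).
      exists (`|t * aval theta p| *+ 2) => -[|[|n]].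
      - by rewrite big_ord0 subr0 mulr1 mulr2n lerDl.
      - rewrite big_ord1 subr0 expr1 -[X in _ <= X * _]mulr_natr mulfK //.
        by rewrite pnatr_eq0.
      rewrite [X in _ - X](_ : _ = t * aval theta p).
        rewrite subrr normr0; apply: mulr_ge0; first by rewrite mulrn_wge0.
        exact: h2_ge0.
      by rewrite 2!big_ord_recl /= add0r big1 ?addr0.
    rewrite avalD avalZ fserDE fserZE; apply: sums_ext (sumsD s0 s1) => -[|[|k]] /=.
    - by rewrite addr0 mul1r.
    - by rewrite add0r expr1.
    by rewrite addr0 fser0E mulr0.
  by rewrite fserDE fserNE; apply: sums_ext => k; rewrite mulrBr.
apply: cc_rotsum => [c cc_|i].
  apply: (sums_uniq complK (sums_sum (index_enum 'I_(plen c)) (fun k => Y (iter k (prot 1) c)))).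
  apply: sums_ext (sums0 K) => k; rewrite -mulr_sumr.
  by have := rotsum_closure (hcc k) cc_; rewrite /rotsum => ->; rewrite mulr0.
apply: (sums_uniq complK (Y (triv i))); apply: sums_ext (sums0 K) => k.
have := cc_const i (hcc k); rewrite /const fserDE fserNE => ->.
by rewrite mulr0.
Qed.

End Small.

(* The hypotheses say that the derivation [sum_j t^j (eta j)] maps
   [psi + t theta] to its time derivative [theta]. *)
Lemma flow_right_equivalent (psi theta : aser) :
  vder (eta 0%N) (aval psi) - aval theta \in cc ->
  (forall k, vder (eta k.+1) (aval psi) + vder (eta k) (aval theta) \in cc) ->
  exists2 e : K, 0 < e & forall t, `|t| <= e ->
    right_equivalent (aclass psi) (aclass (psi + t *: theta)).
Proof.
move=> h0 hS; pose n0 : K := 1 + #|arrow Q|%:R.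
have n00 : 0 < n0 by rewrite ltr_wpDr.
have n01 : 1 <= n0 by rewrite lerDl.
have D0 : 0 < D by exact: lt_le_trans D1.
pose F := 1 + 16%:R * E.
have F1 : 1 <= F by rewrite lerDl mulr_ge0.
have F0 : 0 < F by exact: lt_le_trans F1.
(* [G] serves twice: [16 E <= G] makes the flow converge, and the distance of its linear part to the
   identity, at most [8 D |t| 16 E], is kept below [1 / (2 n0)]. *)
pose G := 16%:R * D * F * n0.
have G0 : 0 < G by rewrite !mulr_gt0 ?ltr0n.
exists G^-1; first by rewrite invr_gt0.
move=> t te; have tG : `|t| * G <= 1 by rewrite -ler_pdivlMr // mul1r.
have G1 : 16%:R * E <= G.
  apply: (@le_trans _ _ F); first by rewrite lerDr.
  rewrite /G (_ : _ * _ = F * (16%:R * D * n0)); last by ring.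
  rewrite ler_peMr ?(ltW F0) //.
  have : (1 : K) <= 16%:R by rewrite ler1n.
  move=> h16; rewrite -[leLHS]mulr1 ler_pM // -[leLHS]mulr1 ler_pM //.
have tE : `|t| * (16%:R * E) <= 1.
  by apply: le_trans tG; exact: ler_wpM2l.
have [g [gl gE]] := flow_morphism tE.
have [L' [LL' L'L]] : exists L' : arrow Q -> arrow Q -> K,
    (forall a c, \sum_b lin (aval (g (aarr a))) b * L' b c = (a == c)%:R) /\
    (forall a c, \sum_b L' a b * lin (aval (g (aarr b))) c = (a == c)%:R).
  apply: near_identity => a b.
  have ha q : `|arr a q| <= 1 * D ^+ plen q.
    rewrite mul1r /arr; case: eqP => _; rewrite ?normr1 ?normr0 ?exprn_ege1 //.
    by rewrite exprn_ge0 // ltW.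
  have hd := flow_bound M0 mu0 D1 eta1 heta ler01 (lexx D) ha.
  (* Without the term [k = 0], which is the identity, the sum retains a factor [|t|]. *)
  pose u k := if k == 0%N then 0 else t ^+ k * flow eta k (arr a) (apath b).
  have us : sums u (lin (aval (g (aarr a))) b - (a == b)%:R).
    have s0 : sums (fun k => if k == 0%N then (a == b)%:R else 0) ((a == b)%:R : K).
      by apply: sums_head.
    rewrite /lin gE; apply: sums_ext (sumsB (flow_sums tE (apath b) (@arr_analytic K Q a)) s0) => -[|k].
      by rewrite /u /= mul1r flow0 -/(lin _ _) lin_arr eq_sym subrr.
    by rewrite /u /= subr0.
  have ud : dominated (2%:R * D * (`|t| * (16%:R * E))) u.
    move=> [|k]; rewrite /u /=.
      by rewrite normr0 mulr1 !mulr_ge0 // ltW.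
    rewrite normrM normrX; apply: le_trans (ler_wpM2l _ (hd k.+1 (apath b))) _.
      exact: exprn_ge0.
    rewrite -/E [plen _]/= expr1 mul1r.
    have e : `|t| * (4%:R * E) = (`|t| * (16%:R * E)) * 4%:R^-1.
      by field.
    rewrite [X in X <= _](_ : _ = 2%:R * D * (`|t| * (4%:R * E)) ^+ k.+1); last first.
      by rewrite [(`|t| * _) ^+ _]exprMn; ring.
    rewrite e exprMn mulrA ler_wpM2r ?exprn_ge0 ?invr_ge0 //.
    rewrite ler_wpM2l ?mulr_ge0 ?(ltW D0) // exprS ler_piMr ?mulr_ge0 //.
    by rewrite exprn_ile1 ?mulr_ge0.
  rewrite -(csumE complK us); apply: le_trans (csum_norm complK ud) _.
  rewrite -[leRHS]mul1r ler_pdivlMr ?mulrn_wgt0 //.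
  apply: le_trans tG.
  rewrite [X in X <= _](_ : _ = `|t| * (16%:R * D * (16%:R * E) * n0)); last by rewrite /n0; ring.
  rewrite ler_wpM2l // /G ler_wpM2r ?(ltW n00) // ler_wpM2l ?mulr_ge0 ?(ltW D0) //.
  by rewrite /F lerDr.
apply: (@right_equivalent_of _ _ g) => //; first exact: bijective_linear LL' L'L.
by rewrite avalB gE; exact: flow_at_cc.
Qed.

End AnalyticFlow.

(** * Paths in the complex plane *)

Section ComplexNumbers.
Local Open Scope complex_scope.
Variable R : realType.
Implicit Types (x y b s d : R) (z : R[i]).

Definition cnorm z : R := complex.Re `|z|.

Lemma cnormE z : cnorm z = Num.sqrt (complex.Re z ^+ 2 + complex.Im z ^+ 2).
Proof. by rewrite /cnorm normc_def. Qed.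

Lemma normC_cnorm z : `|z| = (cnorm z)%:C.
Proof. by rewrite /cnorm RRe_real // normr_real. Qed.

Lemma norm_le_Re z (B : R[i]) (r : R) : `|z| <= B * r%:C ->
  cnorm z <= complex.Re B * r.
Proof.
rewrite lecE => /andP[_]; rewrite -/(cnorm z); case: B => a c /=.
by rewrite mulr0 subr0.
Qed.

Lemma cnorm_Re z : `|complex.Re z| <= cnorm z.
Proof. by rewrite cnormE -sqrtr_sqr ler_wsqrtr // lerDl sqr_ge0. Qed.

Lemma cnorm_Im z : `|complex.Im z| <= cnorm z.
Proof. by rewrite cnormE -sqrtr_sqr ler_wsqrtr // lerDr sqr_ge0. Qed.

Lemma cnorm_le z : cnorm z <= `|complex.Re z| + `|complex.Im z|.
Proof.
rewrite cnormE -[leRHS]ger0_norm ?addr_ge0 // -sqrtr_sqr ler_wsqrtr //.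
rewrite sqrrD !real_normK ?num_real // addrAC lerDl.
by rewrite mulrn_wge0 // mulr_ge0.
Qed.

Lemma cnorm_ge0 z : 0 <= cnorm z.
Proof. by rewrite cnormE sqrtr_ge0. Qed.

Lemma geo_null x b : (forall n, x <= b * 2%:R^-1 ^+ n) -> x <= 0.
Proof.
move=> h; rewrite leNgt; apply/negP => x0.
have b0 : 0 < b by apply: lt_le_trans x0 _; have := h 0%N; rewrite mulr1.
have [n /ltW nb_] : exists n : nat, b / x < n%:R.
  exists (Num.bound (b / x)); exact: archi_boundP (ltW (divr_gt0 b0 x0)).
have := h n; rewrite exprVn ler_pdivlMr ?exprn_gt0 // -natrX => h1.
have : b <= n%:R * x by rewrite -ler_pdivrMr.
move=> h2; have := le_trans h1 h2.
rewrite mulrC ler_pM2r // ler_nat leqNgt ltn_expl //.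
Qed.

(** The intervals with centre [s n] and radius [e n] are nested: the radius drops by three quarters
    of [e n], while the centre moves by at most half of it. The supremum of the left ends lies in
    all of them. *)
Lemma real_complete (u : nat -> R) b : 0 <= b ->
  (forall k, `|u k| <= b * 4%:R^-1 ^+ k) ->
  exists S, forall n, `|S - \sum_(k < n) u k| <= (b *+ 2) * 4%:R^-1 ^+ n.
Proof.
move=> b0 hu; pose s n := \sum_(k < n) u k; pose e n : R := (b *+ 2) * 4%:R^-1 ^+ n.
have e0 n : 0 <= e n by rewrite mulr_ge0 ?mulrn_wge0 ?exprn_ge0 ?invr_ge0.
have st n : s n - e n <= s n.+1 - e n.+1 /\ s n.+1 + e n.+1 <= s n + e n.
  have := hu n; rewrite ler_norml => /andP[h1 h2].
  have eS : e n.+1 = e n / 4%:R by rewrite /e exprS; field.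
  have eu : b * 4%:R^-1 ^+ n = e n / 2%:R by rewrite /e; field.
  rewrite eu in h1 h2; have := e0 n; rewrite /s big_ord_recr /= -/(s n) eS => en.
  by split; lra.
have mono m n : (m <= n)%N -> s m - e m <= s n - e n /\ s n + e n <= s m + e m.
  elim: n => [|n IH]; first by rewrite leqn0 => /eqP ->.
  rewrite leq_eqVlt => /orP[/eqP -> //|/IH[h1 h2]]; have [h3 h4] := st n.
  by split; [exact: le_trans h3|exact: le_trans h2].
have cross m n : s m - e m <= s n + e n.
  have [h1 _] := mono _ _ (leq_maxl m n); have [_ h2] := mono _ _ (leq_maxr m n).
  apply: le_trans h1 _; apply: le_trans h2.
  by have := e0 (maxn m n); lra.
pose E := [set x | exists n, x = s n - e n]%classic.
have E1 : nonempty E by exists (s 0%N - e 0%N), 0%N.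
have Eub n : ubound E (s n + e n) by move=> _ [m ->]; exact: cross.
have hE : has_sup E by split=> //; exists (s 0%N + e 0%N).
exists (sup E) => n; rewrite -/(e n) -/(s n) ler_norml.
have h1 : s n - e n <= sup E.
  by apply: ub_le_sup; [case: hE|exists n].
have h2 : sup E <= s n + e n by apply: ge_sup.
by apply/andP; split; lra.
Qed.

Lemma pow_complex (r : R) n : (r%:C ^+ n : R[i]) = (r ^+ n)%:C.
Proof. by rewrite rmorphXn. Qed.

Lemma complex_complete : geometric_complete R[i].
Proof.
have inv_nat m : (m%:R^-1 : R[i]) = (m%:R^-1)%:C by rewrite fmorphV rmorph_nat.
split=> [z B hz|u B hu].
  apply/eqP; rewrite -normr_eq0 normC_cnorm (_ : cnorm z = 0) //.
  apply/eqP; rewrite eq_le cnorm_ge0 andbT.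
  apply: (@geo_null _ (complex.Re B)) => n; have := hz n.
  by rewrite inv_nat pow_complex => /norm_le_Re.
pose b := complex.Re B.
have hn k : cnorm (u k) <= b * 4%:R^-1 ^+ k.
  by have := hu k; rewrite inv_nat pow_complex => /norm_le_Re.
have b0 : 0 <= b by have := hn 0%N; rewrite mulr1; apply: le_trans; exact: cnorm_ge0.
have Bb : B = b%:C.
  have := hu 0%N; rewrite mulr1 => /(le_trans (normr_ge0 _)) B0.
  by rewrite /b RRe_real // ger0_real.
have [S1 h1] := real_complete b0 (fun k => le_trans (cnorm_Re _) (hn k)).
have [S2 h2] := real_complete b0 (fun k => le_trans (cnorm_Im _) (hn k)).
exists (S1 +i* S2) => n; rewrite inv_nat pow_complex Bb -rmorphMn -rmorphM normC_cnorm lecR.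
apply: le_trans (cnorm_le _) _.
have sE : \sum_(k < n) u k = (\sum_(k < n) complex.Re (u k)) +i* (\sum_(k < n) complex.Im (u k)).
  elim: n => [|n IH]; first by rewrite !big_ord0.
  by rewrite !big_ord_recr /= IH; case: (u n).
rewrite sE /=; apply: le_trans (lerD (h1 n) (h2 n)) _.
have q : (4%:R^-1 : R) ^+ n <= 2%:R^-1 ^+ n.
  apply: lerXn2r; rewrite ?nnegrE ?invr_ge0 //.
  by rewrite lef_pV2 ?posrE ?ltr0n // ler_nat.
rewrite -mulrDl -mulrnDr ler_wpM2l //.
exact: mulrn_wge0.
Qed.

(** The supremum of the points related to [0] is itself related to [0], and if it were less than [1]
    a larger such point would exist. *)
Lemma unit_interval_connected (P : R -> R -> Prop) :
  (forall s, P s s) ->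
  (forall s s', P s s' -> P s' s) -> (forall s s' s'', P s s' -> P s' s'' -> P s s'') ->
  (forall s, 0 <= s <= 1 -> exists2 d, 0 < d & forall s', 0 <= s' <= 1 ->
     `|s' - s| <= d -> P s s') ->
  P 0 1.
Proof.
move=> Prefl Psym Ptrans Ploc.
pose A := [set s | 0 <= s <= 1 /\ P 0 s]%classic.
have A0 : A 0 by split; rewrite ?lexx ?ler01.
have Aub : ubound A 1 by move=> s [/andP[_]].
have hA : has_sup A by split; [exists 0|exists 1].
have s0 : 0 <= sup A by apply: ub_le_sup => //; case: hA.
have s1 : sup A <= 1 by apply: ge_sup => //; exists 0.
have [|d d0 hd] := Ploc (sup A); first by rewrite s0.
have [a [a01 Pa] ad] := sup_adherent d0 hA.
have asup : a <= sup A by apply: ub_le_sup; [case: hA|].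
have Ps : P 0 (sup A).
  apply: Ptrans Pa _; apply: Psym; apply: hd => //.
  by rewrite ler_norml; apply/andP; split; lra.
have [s1'|] := ltP (sup A) 1; last first.
  by move=> h; have <- : sup A = 1 by apply/eqP; rewrite eq_le s1 h.
pose s' := Num.min 1 (sup A + d).
have hs' : sup A < s' by rewrite lt_min s1' ltrDl d0.
have s'1 : s' <= 1 by rewrite ge_min lexx.
have s'd : s' <= sup A + d by rewrite ge_min lexx orbT.
have : s' <= sup A.
  apply: ub_le_sup; [by case: hA|split; first by apply/andP; split; lra].
  apply: Ptrans Ps _; apply: hd; first by apply/andP; split; lra.
  by rewrite ler_norml; apply/andP; split; lra.
by rewrite leNgt hs'.
Qed.

(* The curves [s + i l s (1 - s)] join [0] to [1]; a given point of the plane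
   other than [0] and [1] lies on at most one of them. *)
Lemma punctured_plane_connected (bad : seq R[i]) (P : R[i] -> R[i] -> Prop) :
  0 \notin bad -> 1 \notin bad ->
  (forall z, P z z) -> (forall z z', P z z' -> P z' z) ->
  (forall z z' z'', P z z' -> P z' z'' -> P z z'') ->
  (forall z, z \notin bad -> exists2 e : R[i], 0 < e & forall t, `|t| <= e -> P z (z + t)) ->
  P 0 1.
Proof.
move=> b0 b1 Pr Ps Pt Pl.
(* For a bad point of real part [0] or [1] the quotient takes the default value [0]. This is
   harmless: over these abscissas the curves only contain the points [0] and [1], which are not
   bad. *)
pose bs := [seq complex.Im z / (complex.Re z * (1 - complex.Re z)) | z <- bad].
pose l := 1 + \sum_(x <- bs) `|x|.
have lb : l \notin bs.
  apply/negP => lbs; have : `|l| <= \sum_(x <- bs) `|x|.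
    by rewrite (perm_big _ (perm_to_rem lbs)) big_cons lerDl sumr_ge0.
  have := ler_norm l; rewrite {1}/l => h1 h2.
  by have := le_trans h1 h2; lra.
pose c s : R[i] := s +i* (l * (s * (1 - s))).
have c0 : c 0 = 0 by rewrite /c mul0r mulr0.
have c1 : c 1 = 1 by rewrite /c subrr mulr0 mulr0.
rewrite -c0 -c1; apply: (unit_interval_connected (P := fun s s' => P (c s) (c s'))).
- by [].
- by move=> s s'; exact: Ps.
- by move=> s s' s''; exact: Pt.
move=> s s01; have cb : c s \notin bad.
  apply/negP => csb.
  have [ss|ss] := eqVneq (s * (1 - s)) 0.
    have [e|e] : s = 0 \/ s = 1.
      move/eqP: ss; rewrite mulf_eq0 subr_eq0 => /orP[/eqP|/eqP <-]; by [left|right].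
    by move: csb; rewrite e c0 (negbTE b0).
    by move: csb; rewrite e c1 (negbTE b1).
  move/negP: lb; apply; apply/mapP; exists (c s) => //=.
  by rewrite mulfK.
have [e e0 he] := Pl _ cb.
have er : e = (complex.Re e)%:C by rewrite RRe_real // ger0_real // ltW.
have e1 : 0 < complex.Re e by move: e0; rewrite er ltcR.
have l1 : 0 < 1 + `|l| by rewrite ltr_wpDr.
(* On the unit interval the curve is Lipschitz with constant [1 + |l|]. *)
exists (complex.Re e / (1 + `|l|)); first exact: divr_gt0.
move=> s' s'01 ss'; have -> : c s' = c s + (c s' - c s) by rewrite addrC subrK.
apply: he; rewrite er normC_cnorm lecR; apply: le_trans (cnorm_le _) _ => /=.
have -> : l * (s' * (1 - s')) - l * (s * (1 - s)) = l * (1 - s - s') * (s' - s) by ring.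
rewrite !normrM; move: ss'; rewrite ler_pdivlMr // => ss'; apply: le_trans ss'.
have k : `|1 - s - s'| <= 1.
  by move/andP: s01 => [? ?]; move/andP: s'01 => [? ?]; rewrite ler_norml; apply/andP; split; lra.
rewrite [X in _ <= X]mulrDr mulr1 lerD2l [X in _ <= X]mulrC ler_wpM2r //.
by rewrite -[leRHS]mulr1 ler_wpM2l.
Qed.

End ComplexNumbers.

(** * Potentials with the same Jacobi ideal *)

Section LocalTriviality.
Variables (R : realType) (Q : quiver).
Local Notation K := R[i].
Local Notation fser := (fseries K Q).
Local Notation ker := (qpath Q * qpath Q -> K).
Local Notation aarr := (@aarr K Q).
Local Notation analytic := (@analytic K Q).
Local Notation aser := (aseries K Q).
Local Notation biplen := (@biplen Q).
Local Notation cc := (@comm_closure K Q).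
Implicit Types (f g phi psi theta : aser) (a b : arrow Q).

(** The coefficients of [f] on the cyclic derivatives, transferred by [ins_cc], form the vector
    field. Commuting it with the cyclic derivatives ([cdr_vder]) yields derivatives of [theta] and
    combinations of those of [psi], so it preserves the Jacobi ideal, and [vder_ordge1] applies. *)
Lemma jac_vector_field psi theta : opn (jac psi) ->
  (forall f, jac psi f -> ordge 1 (aval f)) ->
  (forall a, jac psi (afder a theta)) ->
  (exists2 f, jac psi f & aval (theta - f) \in cc) ->
  exists xi : arrow Q -> fser, [/\ forall a, par a (xi a), forall a, ordge 1 (xi a),
    forall a, xi a \in analytic & vder xi (aval psi) - aval theta \in cc].
Proof.
move=> oJ J1 Jtheta [f /jacP[A hA fA] fcc]; have tJ := jac_tideal psi.
pose xi a : fser := cut a (mulK (swapK (A a))).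
have xpar a : par a (xi a) by exact: par_cut.
have xan a : xi a \in analytic.
  apply: rpredM; last exact: analytic_fl; apply: rpredM; first exact: analytic_fl.
  exact/mulK_analytic/swapK_growth.
have xcc : vder xi (aval psi) - aval theta \in cc.
  have E1 := vder_cdr xi (aval psi).
  have E2 : \sum_a xi a * fder a (aval psi) - aval f \in cc.
    rewrite fA -sumrB; apply: rpred_sum => a _.
    have h1 := cut_fder_cc a (mulK (swapK (A a))) (aval psi).
    have h2 := ins_cc (A a) (fder a (aval psi)) 1.
    rewrite mulr1 ins1 in h2.
    rewrite -[X in X - _](subrK (fder a (aval psi) * mulK (swapK (A a)))) -addrA.
    by apply: rpredD => //; rewrite -opprB rpredN.
  have -> : vder xi (aval psi) - aval theta =
     (vder xi (aval psi) - \sum_a xi a * fder a (aval psi))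
     + (\sum_a xi a * fder a (aval psi) - aval f) - aval (theta - f).
    by apply/funext => p; rewrite avalB !(fserDE, fserNE); ring.
  by rewrite rpredB // rpredD.
exists xi; split=> //; apply: (vder_ordge1 tJ oJ J1 xpar xan).
(* The elements that the derivation keeps in the Jacobi ideal form an open two-sided ideal, so only
   the cyclic derivatives have to be checked. *)
pose I f := jac psi f /\ forall g, aval g = vder xi (aval f) -> jac psi g.
have vE g : aval (ASeries (vder_analytic g xan)) = vder xi (aval g) by [].
suff H g : jac psi g -> I g by move=> g g' /H[_]; apply.
apply: jac_opn.
- split=> [|x y [Jx hx] [Jy hy]|x y [Jy hy]|x y [Jy hy]].
  + split=> [|u uE]; first exact: (tideal0 tJ).
    by rewrite (_ : u = 0); [exact: (tideal0 tJ)|apply: aval_inj; rewrite uE vder0].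
  + split=> [|u uE]; first exact: (tidealB tJ).
    rewrite (_ : u = ASeries (vder_analytic x xan) - ASeries (vder_analytic y xan)).
      by apply: (tidealB tJ); [exact: hx|exact: hy].
    by apply: aval_inj; rewrite uE avalB vderB.
  + split=> [|u uE]; first exact: (tidealMl tJ).
    rewrite (_ : u = ASeries (vder_analytic x xan) * y + x * ASeries (vder_analytic y xan)).
      by apply: (tidealD tJ); apply: (tidealMl tJ) => //; exact: hy.
    by apply: aval_inj; rewrite uE avalM vderM.
  + split=> [|u uE]; first exact: (tidealMr tJ).
    rewrite (_ : u = ASeries (vder_analytic y xan) * x + y * ASeries (vder_analytic x xan)).
      by apply: (tidealD tJ); apply: (tidealMr tJ) => //; exact: hy.
    by apply: aval_inj; rewrite uE avalM vderM.
- case: oJ => N hN; exists N.+1 => x gN; split=> [|u uE].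
    by apply: hN; exact: ordge_le gN.
  by apply: hN; rewrite uE; exact: (@ordge_vder_pred _ _ _ N.+1).
move=> b; split=> [|u uE]; first exact: jac_afder.
have C a : cdr b (xi a) (aval (afder a psi)) \in analytic.
  by apply: cdr_analytic => //; exact: avalP.
rewrite (_ : u = afder b theta - \sum_a ASeries (C a)).
  apply: (tidealB tJ) => //; apply: (tideal_sum tJ) => a _.
  apply: (cl_opn tJ oJ); apply: (ins_cl tJ _ (jac_afder psi a)); last reflexivity.
  exact/swapK_growth/dker_growth.
apply: aval_inj; rewrite uE avalB aval_sum /=.
have := cdr_vder b (aval psi) 1 xpar.
rewrite (_ : vder xi 1 = 0); last exact: vder_fl.
rewrite cdr0r addr0 -!fder_cdr => e.
have -> : fder b (aval theta) = fder b (vder xi (aval psi)).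
  by apply/eqP; rewrite eq_sym -subr_eq0 -fderB fder_closure.
rewrite e; under [X in _ - X]eq_bigr do rewrite fder_cdr.
by rewrite addrK.
Qed.

Lemma locally_trivial psi theta : opn (jac psi) ->
  (forall f, jac psi f -> ordge 1 (aval f)) ->
  (forall a, jac psi (afder a theta)) ->
  (exists2 f, jac psi f & aval (theta - f) \in cc) ->
  exists2 e : K, 0 < e & forall t, `|t| <= e ->
    right_equivalent (aclass psi) (aclass (psi + t *: theta)).
Proof.
move=> oJ J1 Jtheta Jf.
have [xi [xpar xi1 xan xcc]] := jac_vector_field oJ J1 Jtheta Jf.
have /fin_all_exists[B hB] a : exists B : arrow Q -> ker,
    (forall b, growth biplen (B b)) /\
    fder a (aval theta) = \sum_b ins (B b) (fder b (aval psi)).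
  by have /jacP[B hB1 hB2] := Jtheta a; exists B.
have [C1 C11 [X X0 hX]] := analytic_fin xan.
have [C2 C21 [be be0 hbe]] : exists2 C : K, 1 <= C & exists2 M : K, 0 <= M &
    forall (ab : arrow Q * arrow Q) uv, `|B ab.1 ab.2 uv| <= M * C ^+ biplen uv.
  apply: (growth_fin (@short_bipaths Q)) => -[a b] /=.
  by have [h _] := hB a; exact: h.
pose C := C1 + C2.
have C10 : 0 <= C1 by exact: le_trans C11.
have C20 : 0 <= C2 by exact: le_trans C21.
have C1' : 1 <= C by apply: le_trans C11 _; rewrite lerDl.
have C0 : 0 <= C by exact: le_trans C1'.
have hX' a p : `|xi a p| <= X * C ^+ plen p.
  apply: le_trans (hX a p) _; rewrite ler_wpM2l //.
  by apply: lerXn2r; rewrite ?nnegrE // lerDl.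
have hB' a b uv : `|B a b uv| <= be * C ^+ biplen uv.
  apply: le_trans (hbe (a, b) uv) _; rewrite ler_wpM2l //.
  by apply: lerXn2r; rewrite ?nnegrE // lerDr.
pose xis k := iter k (transport B) xi.
have xis1 k a : ordge 1 (xis k a).
  elim: k a => [|k IH] a; first exact: xi1.
  exact: transport_ord1.
(* The expansion of [(1 + t T)^-1 xi] with [T = transport B]: at time [t] this field sends
   [psi + t theta] to [theta] modulo commutators. *)
pose eta k a : fser := (-1) ^+ k *: xis k a.
(* One power of [2 C] is moved into the constant, as the exponent to be reached is [(plen p).-1]; in
   length zero the field vanishes. *)
apply: (@flow_right_equivalent K Q (@complex_complete R) eta (X * (2%:R * C))
  (4%:R * #|arrow Q|%:R * be) (2%:R * C)).
- by rewrite !mulr_ge0.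
- by rewrite !mulr_ge0.
- by rewrite -[leLHS]mulr1 ler_pM // ler1n.
- by move=> k a; exact/ordgeZ/xis1.
- move=> k a p; rewrite /eta fserZE normrM normrX normrN1 expr1n mul1r.
  have [p0|p0] := posnP (plen p).
    by rewrite xis1 ?p0 // normr0 !mulr_ge0 ?exprn_ge0 ?mulr_ge0.
  apply: le_trans (iter_transport_bound C1' be0 hB' k a X0 hX' p) _.
  by rewrite -[in leLHS](prednK p0) exprS le_eqVlt; apply/orP; left; apply/eqP; ring.
- by rewrite (_ : vder (eta 0%N) _ = vder xi (aval psi)) // /eta vderZl scale1r.
move=> k; rewrite /eta !vderZl exprS mulN1r scaleNr addrC -opprB -scalerBr.
rewrite -scalerN; apply: cc_scale.
have := @transport_cc K Q B (aval psi) (aval theta) (xis k) (fun a => (hB a).2).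
by rewrite rpredN.
Qed.

End LocalTriviality.

(** * The segment between two potentials with the same Jacobi ideal *)

Section SameIdeal.
Variables (R : realType) (Q : quiver).
Local Notation K := R[i].
Local Notation aser := (aseries K Q).
Local Notation aarr := (@aarr K Q).
Local Notation cc := (@comm_closure K Q).
Implicit Types (f g r phi psi theta : aser) (a b : arrow Q) (t : K).

(* [r] is in [I + m^(k+1)] for any two-sided ideal [I] with [J <= I + m^k]; this
   holds for the elements of [m J + J m]. *)
Definition deeper (J : aser -> Prop) r := forall (I : aser -> Prop) k, tideal I ->
  (forall g, J g -> exists2 g', I g' & ordge k (aval (g - g'))) ->
  exists2 r', I r' & ordge k.+1 (aval (r - r')).

Lemma deeperD J f g : deeper J f -> deeper J g -> deeper J (f + g).
Proof.
move=> hf hg I k tI h; have [f' If ff] := hf I k tI h; have [g' Ig gg] := hg I k tI h.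
exists (f' + g'); first exact: tidealD.
by rewrite opprD addrACA; exact: ordgeD.
Qed.

Lemma deeper_sum J (F : arrow Q -> aser) : (forall a, deeper J (F a)) ->
  deeper J (\sum_a F a).
Proof.
move=> h; apply: big_ind => [I k tI _|f g|a _]; [|exact: deeperD|exact: h].
by exists 0; [exact: tideal0|rewrite subrr; exact: ordge_zero].
Qed.

Lemma deeperMl (J : aser -> Prop) f g : J g -> ordge 1 (aval f) -> deeper J (f * g).
Proof.
move=> Jg f1 I k tI h; have [g' Ig gg] := h g Jg; exists (f * g').
  exact: tidealMl.
by rewrite -mulrBr -[k.+1]add1n; exact: ordgeM.
Qed.

Lemma deeperMr (J : aser -> Prop) f g : J g -> ordge 1 (aval f) -> deeper J (g * f).
Proof.
move=> Jg f1 I k tI h; have [g' Ig gg] := h g Jg; exists (g' * f).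
  exact: tidealMr.
by rewrite -mulrBl -addn1; exact: ordgeM.
Qed.

(** Modulo [m J + J m], with [m] the arrow ideal, only the values of the coefficients at pairs of
    trivial paths matter, and the endpoints of [afder b psi] single out [tgt b] on the left and
    [src b] on the right. Openness puts the remaining combinations back into [J]. *)
Lemma jac_constants psi f : opn (jac psi) -> jac psi f ->
  exists (c : arrow Q -> K) r, deeper (jac psi) r /\
    f = \sum_b c b *: afder b psi + r.
Proof.
move=> oJ /jacP[A hA fA]; have tJ := jac_tideal psi.
pose r b : aser := ASeries (rsl_analytic (triv (tgt b)) (hA b)).
pose s b : aser := al (const (aval (r b))).
have C a b : ins (lderK a (A b)) (aval (afder b psi)) \in @analytic K Q.
  by apply: ins_analytic; [exact: lderK_growth|exact: avalP].
have JC a b : jac psi (ASeries (C a b)).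
  apply: (cl_opn tJ oJ); apply: (ins_cl tJ _ (jac_afder psi b)); last reflexivity.
  exact: lderK_growth.
exists (fun b => const (aval (r b)) (src b)).
exists (\sum_b afder b psi * (r b - s b) + \sum_b \sum_a aarr a * ASeries (C a b)); split.
  apply: deeperD; apply: deeper_sum => b.
    apply: deeperMr; first exact: jac_afder.
    apply/ordge1P => i; rewrite avalB /const fserDE fserNE -!/(const _ i).
    by rewrite aval_al const_fl subrr.
  apply: deeper_sum => a; apply: deeperMl; first exact: JC.
  exact: ordge_arr.
apply: aval_inj; rewrite fA !avalD !aval_sum addrA -big_split -big_split /=.
apply: eq_bigr => b _; rewrite ins_peel aval_sum; congr (_ + _).
rewrite (bigD1 (tgt b)) //= big1 ?addr0 => [|i ib]; last first.
  by rewrite fder_cdr cdr_lmul eq_sym (negbTE ib) scale0r mul0r.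
rewrite {1}fder_cdr cdr_lmul eqxx scale1r -fder_cdr mulrBr.
have -> : fder b (aval psi) * fl (const (rsl (A b) (triv (tgt b)))) =
    const (rsl (A b) (triv (tgt b))) (src b) *: fder b (aval psi).
  by rewrite fder_cdr cdr_rmul.
by rewrite addrC subrK.
Qed.

Section Family.
Variables phi psi : aser.
Hypothesis oJ : opn (jac psi).
Hypothesis J1 : forall f, jac psi f -> ordge 1 (aval f).
Hypothesis Jphi : forall f, jac phi f <-> jac psi f.
Hypothesis Jf : exists2 f, jac psi f & aval (phi - psi - f) \in cc.

Let theta := phi - psi.
Definition segment t : aser := psi + t *: theta.

Lemma segment_der t a :
  afder a (segment t) = afder a psi + t *: (afder a phi - afder a psi).
Proof.
apply: aval_inj.
change (fder a (aval psi + t *: (aval phi - aval psi)) =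
  fder a (aval psi) + t *: (fder a (aval phi) - fder a (aval psi))).
by rewrite !fder_cdr cdrDl cdrZl -!fder_cdr fderB.
Qed.

Lemma segment_jac_sub t f : jac (segment t) f -> jac psi f.
Proof.
apply: (jac_opn (jac_tideal psi) oJ) => a; rewrite segment_der.
have tJ := jac_tideal psi; apply: (tidealD tJ); first exact: jac_afder.
apply: (tidealZ tJ); apply: (tidealB tJ); last exact: jac_afder.
by apply/Jphi; exact: jac_afder.
Qed.

(** [B] expresses the [afder a phi] modulo [m J + J m]. A left inverse of the matrix of the segment
    puts [J] inside [jac (segment t) + m J + J m], and then, one order at a time, inside the closure
    of [jac (segment t)]. *)
Lemma segment_jac_mx : exists B : arrow Q -> arrow Q -> K, forall t,
  (exists M' : arrow Q -> arrow Q -> K, forall b c,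
     \sum_a M' b a * ((1 - t) * (a == c)%:R + t * B a c) = (b == c)%:R) ->
  forall f, jac psi f -> jac (segment t) f.
Proof.
have /fin_all_exists[c hc] a : exists c : arrow Q -> K, exists2 r, deeper (jac psi) r &
    afder a phi = \sum_b c b *: afder b psi + r.
  have [|c [r [dr e]]] := @jac_constants psi (afder a phi) oJ.
    by apply/Jphi; exact: jac_afder.
  by exists c, r.
exists c => t [M' hM'].
have tI := jac_tideal (segment t); have tJ := jac_tideal psi.
pose near k f := exists2 g, jac (segment t) g & ordge k (aval (f - g)).
have tnear k : tideal (near k).
  split=> [|f g [f' If ff] [g' Ig gg]|f g [g' Ig gg]|f g [g' Ig gg]].
  - by exists 0; [exact: (tideal0 tI)|rewrite subrr; exact: ordge_zero].
  - exists (f' - g'); first exact: (tidealB tI).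
    rewrite (_ : _ - _ = (f - f') - (g - g')); first exact: ordgeB.
    by apply: aval_inj; apply/funext => p; rewrite !(avalB, fserDE, fserNE); ring.
  - exists (f * g'); first exact: (tidealMl tI).
    by rewrite -mulrBr; exact: ordgeMl.
  - exists (g' * f); first exact: (tidealMr tI).
    by rewrite -mulrBl; exact: ordgeMr.
have near_incl k f : jac (segment t) f -> near k f.
  by move=> h; exists f => //; rewrite subrr; exact: ordge_zero.
suff H k f : jac psi f -> near k f.
  move=> f; apply: (cl_opn' tI oJ) => g Jg k; exact: H.
elim: k f => [|k IH] f; first by move=> _; exists 0; [exact: (tideal0 tI)|].
have nD b : near k.+1 (afder b psi).
  have -> : afder b psi = \sum_a M' b a *: (afder a (segment t) -
      t *: (afder a phi - \sum_d c a d *: afder d psi)).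
    have E a : afder a (segment t) - t *: (afder a phi - \sum_d c a d *: afder d psi) =
        \sum_d ((1 - t) * (a == d)%:R + t * c a d) *: afder d psi.
      rewrite segment_der; under [RHS]eq_bigr do rewrite scalerDl -!scalerA.
      rewrite big_split /= -!scaler_sumr.
      have -> : \sum_d (a == d)%:R *: afder d psi = afder a psi.
        rewrite (bigD1 a) //= eqxx scale1r big1 ?addr0 // => d.
        by rewrite eq_sym => /negbTE ->; rewrite scale0r.
      rewrite scalerBl scale1r !scalerBr [- (t *: _ - _)]opprB.
      by apply: aval_inj; apply/funext => p; rewrite !(avalB, avalD, avalZ, fserDE, fserNE, fserZE); ring.
    under [RHS]eq_bigr do rewrite E scaler_sumr.
    rewrite exchange_big /=.
    under [RHS]eq_bigr do [under eq_bigr do rewrite scalerA; rewrite -scaler_suml hM'].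
    rewrite (bigD1 b) //= eqxx scale1r big1 ?addr0 // => d.
    by rewrite eq_sym => /negbTE ->; rewrite scale0r.
  apply: (tideal_sum (tnear _)) => a _; apply: (tidealZ (tnear _)).
  apply: (tidealB (tnear _)); first by apply: near_incl; exact: jac_afder.
  apply: (tidealZ (tnear _)); have [r dr ->] := hc a.
  by rewrite addrC addKr; exact: dr.
move=> Jf'; have /(_ k.+1)[g [g' Ig' gg'] fg] := jac_cl (tnear k.+1) nD Jf'.
by exists g' => //; rewrite -[f](subrK g) -addrA; exact: ordgeD.
Qed.

Lemma segment_jac : exists bad : seq K, [/\ 0 \notin bad, 1 \notin bad &
  forall t, t \notin bad -> forall f, jac (segment t) f <-> jac psi f].
Proof.
have [B hB] := segment_jac_mx; pose n := #|arrow Q|.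
pose M t : 'M[K]_n := \matrix_(i, j)
  ((1 - t) * (i == j)%:R + t * B (enum_val i) (enum_val j)).
pose P : 'M[{poly K}]_n := \matrix_(i, j)
  ((1 - 'X) * (i == j)%:R + 'X * (B (enum_val i) (enum_val j))%:P).
have PM t : (\det P).[t] = \det (M t).
  rewrite -[LHS]/(horner_eval t (\det P)) -det_map_mx; congr determinant.
  apply/matrixP => i j; rewrite !mxE.
  rewrite -[LHS]/(((1 - 'X) * (i == j)%:R + 'X * (B (enum_val i) (enum_val j))%:P).[t]).
  by case: eqP => _; rewrite !hornerE.
have P0 : \det P != 0.
  apply/eqP => h; have := PM 0; rewrite h horner0.
  have -> : M 0 = 1%:M.
    by apply/matrixP => i j; rewrite !mxE subr0 mul1r mul0r addr0.
  by rewrite det1 => /eqP; rewrite eq_sym oner_eq0.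
have [rs hrs] := closed_field_poly_normal (\det P).
(* At [t = 1] the determinant may vanish, since the cyclic derivatives may be dependent modulo
   [m J + J m]; but there the segment is at [phi], and [Jphi] gives the equality of ideals. *)
exists [seq t <- rs | (t != 0) && (t != 1)]; split.
- by rewrite mem_filter eqxx.
- by rewrite mem_filter eqxx andbF.
move=> t; rewrite mem_filter => tbad f; split; first exact: segment_jac_sub.
have [->|t0] := eqVneq t 0; first by rewrite /segment scale0r addr0.
have [->|t1] := eqVneq t 1.
  by rewrite /segment scale1r /theta addrC subrK => /Jphi.
apply: hB.
have Mt : M t \in unitmx.
  rewrite unitmxE unitfE -PM; apply: contraNneq tbad => h; rewrite t0 t1 /=.
  rewrite hrs hornerZ in h; have : root (\prod_(z <- rs) ('X - z%:P)) t.
    move/eqP: h; rewrite mulf_eq0 lead_coef_eq0 (negbTE P0) /=.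
    by rewrite /root.
  by rewrite root_prod_XsubC.
exists (fun a b => invmx (M t) (enum_rank a) (enum_rank b)) => b d.
have /matrixP/(_ (enum_rank b) (enum_rank d)) := mulVmx Mt.
rewrite !mxE (inj_eq enum_rank_inj) => <-.
rewrite (reindex_onto enum_val enum_rank) /=; last by move=> k _; exact: enum_rankK.
apply: eq_big => [k|k _]; first by rewrite enum_valK eqxx.
by rewrite mxE !enum_valK enum_rankK -(inj_eq enum_rank_inj) enum_valK.
Qed.

Lemma same_jac_equivalent : right_equivalent (aclass psi) (aclass phi).
Proof.
have [bad [b0 b1 hbad]] := segment_jac.
pose P t t' := right_equivalent (aclass (segment t)) (aclass (segment t')).
have := @punctured_plane_connected R bad P b0 b1.
have s0 : segment 0 = psi by rewrite /segment scale0r addr0.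
have s1 : segment 1 = phi by rewrite /segment scale1r /theta addrC subrK.
rewrite /P s0 s1; apply.
- by move=> z; exact: right_equivalent_refl.
- by move=> z z'; exact: right_equivalent_sym.
- by move=> z z' z''; exact: right_equivalent_trans.
move=> z zb; have Jz := hbad z zb.
have tJ := jac_tideal psi.
have [|f|a||e e0 he] := @locally_trivial R Q (segment z) theta.
- by have [N hN] := oJ; exists N => f /hN/Jz.
- by move/Jz; exact: J1.
- apply/Jz; have -> : afder a theta = afder a phi - afder a psi.
    by apply: aval_inj; exact: fderB.
  apply: (tidealB tJ); last exact: jac_afder.
  by apply/Jphi; exact: jac_afder.
- by have [f Jpf fcc] := Jf; exists f => //; apply/Jz.
exists e => // t te; have := he t te.
by rewrite /segment -addrA -scalerDl.
Qed.

End Family.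
End SameIdeal.

(** * Isomorphisms of Jacobi algebras *)

Section Quotients.
Variables (K : numClosedFieldType) (Q : quiver).
Local Notation fser := (fseries K Q).
Local Notation aser := (aseries K Q).
Local Notation aarr := (@aarr K Q).
Local Notation cc := (@comm_closure K Q).
Implicit Types (f phi psi : aser) (a b : arrow Q).

(** The order is a property of the class: the part of [phi] of degree at most [n] has vanishing
    rotation sums, so it lies in the closure of the commutators and is removed before
    differentiating. *)
Lemma order_afder phi n a : order_ge n.+1 (aclass phi) ->
  ordge n (aval (afder a phi)).
Proof.
move=> ho; have coef0 c : cyclic c -> (plen c <= n)%N -> fcyc_coef (aval phi) c = 0.
  by move=> cc cn; rewrite -(cyc_coefE _ cc); exact: ho.
pose g : fser := fun p => if (plen p <= n)%N then aval phi p else 0.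
have gcc : g \in cc.
  apply: cc_rotsum => [c hc|i]; last first.
    rewrite /const /g /= -[RHS](coef0 (triv i)) /cyclic ?eqxx //.
    by rewrite /fcyc_coef /rotations /= prot0 ?big_seq1 // /cyclic.
  have [cn|cn] := leqP (plen c) n; last first.
    by rewrite /rotsum big1 // => k _; rewrite /g plen_iter leqNgt cn.
  have -> : rotsum g c = rotsum (aval phi) c.
    by apply: eq_bigr => k _; rewrite /g plen_iter cn.
  have [c0|c0] := posnP (plen c); first by rewrite /rotsum c0 big_ord0.
  by have [m _ ->] := rotsum_coef (aval phi) hc c0; rewrite coef0 ?mul0rn.
have -> : aval (afder a phi) = fder a (aval phi - g).
  by rewrite fderB (fder_closure _ gcc) subr0.
rewrite fder_cdr -[n]addn0; apply: ordge_ins => // -[u v] uv.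
apply: (@dker_ord _ _ n.+1); last by rewrite /biplen addnC.
move=> p pn; rewrite fserDE fserNE /g -ltnS pn; exact: subrr.
Qed.

Lemma jac_ordge phi n f : (forall a, ordge n (aval (afder a phi))) ->
  jac phi f -> ordge n (aval f).
Proof.
move=> h /jacP[A _ ->]; apply: ordge_sum => a _; apply: ordge_ins0; exact: h.
Qed.

Section Automorphism.
Variable g : {rmorphism aser -> aser}.
Hypothesis g_bij : bijective g.
Hypothesis g_al : forall c, g (al c) = al c.

(** The chain rule is applied to the inverse of [g] and the potential [g phi]: it places the cyclic
    derivatives of [phi] in the closure of the preimage of [jac (g phi)]. *)
Lemma jac_aut_cl phi f : jac phi f -> cl (jac (g phi)) (g f).
Proof.
have [d [gd dg dal]] := rmorph_inverse g_bij g_al.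
have [_ _ _ gE] := aut_aend g_al; have [h1 _ _ _] := aut_aend g_al.
have tJ := jac_tideal (g phi).
pose I e := jac (g phi) (g e).
have tI : tideal I.
  split=> [|u v Iu Iv|u v Iv|u v Iv]; rewrite /I ?rmorph0 ?rmorphB ?rmorphM.
  - exact: (tideal0 tJ).
  - exact: (tidealB tJ).
  - exact: (tidealMl tJ).
  - exact: (tidealMr tJ).
have hI a : cl I (afder a phi).
  have := @chain_cl K Q d _ I (g phi) (aut_aend dal) tI _ a; rewrite gd; apply.
  by move=> b; rewrite /I dg; exact: jac_afder.
move=> /(jac_cl (cl_tideal tI) hI) h; have {}h : cl I f by apply: cl_incl2 h => e.
move=> k; have [e Ie fe] := h k; exists (g e) => //.
by rewrite -rmorphB gE; exact: ordge_sub.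
Qed.

Lemma opn_aut phi : opn (jac phi) -> opn (jac (g phi)).
Proof.
have [d [gd dg dal]] := rmorph_inverse g_bij g_al.
have [h1 _ _ dE] := aut_aend dal.
move=> [N hN]; exists N; apply: (nakayama_cl (jac_tideal _)) => f fN.
by rewrite -[f]dg; apply/jac_aut_cl/hN; rewrite dE; exact: ordge_sub.
Qed.

End Automorphism.

Lemma jac_aut (g : {rmorphism aser -> aser}) phi f : bijective g ->
  (forall c, g (al c) = al c) -> opn (jac phi) ->
  jac (g phi) (g f) <-> jac phi f.
Proof.
move=> gb gl oJ; split=> [|h]; last first.
  by apply: cl_opn (jac_aut_cl gb gl h); [exact: jac_tideal|exact: opn_aut].
have [d [gd dg dal]] := rmorph_inverse gb gl.
have db : bijective d by exists g.
move=> /(jac_aut_cl db dal); rewrite !gd; exact: (cl_opn (jac_tideal _)).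
Qed.

Lemma jproj_rmorphism (Phi : potential K Q) :
  exists pr : {rmorphism aser -> jacobi Phi}, pr =1 jproj Phi.
Proof.
apply: mk_rmorphism => //; last exact: jprojM.
by move=> x y; exact: raddfB.
Qed.

Lemma jproj_jac phi f f' : jproj (aclass phi) f = jproj (aclass phi) f' <->
  jac phi (f - f').
Proof. exact: jproj_eq. Qed.

Lemma jproj_jac0 phi f : jproj (aclass phi) f = 0 <-> jac phi f.
Proof.
have [pr prE] := jproj_rmorphism (aclass phi); rewrite -(rmorph0 pr) prE jproj_jac.
by rewrite subr0.
Qed.

Lemma jcproj_eq phi f f' :
  jcproj (aclass phi) (aclass f) = jcproj (aclass phi) (aclass f') <->
  exists2 e, jac phi e & aval (f - f' - e) \in cc.
Proof.
have -> : jcproj (aclass phi) (aclass f) = jcproj (aclass phi) (aclass f') <->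
    aclass f - aclass f' \in jcyc_ideal (aclass phi).
  by rewrite Quotient.idealrBE; split=> [h|/eqP//]; apply/eqP.
rewrite -aclassB; split=> [/asboolP[e Je]|[e Je h]].
  by move/aclassP => h; exists e.
by apply/asboolP; exists e => //; apply/aclassP.
Qed.

Lemma aut_jacobi_iso (g : {rmorphism aser -> aser}) phi : bijective g ->
  (forall c, g (al c) = al c) -> opn (jac phi) ->
  exists (gamma : {rmorphism jacobi (aclass phi) -> jacobi (aclass (g phi))})
    (gammac : jacobi_cyc (aclass phi) -> jacobi_cyc (aclass (g phi))),
  [/\ l_algebra_iso (jl (aclass phi)) (jl (aclass (g phi))) gamma,
      induced_cyc gamma gammac &
      gammac (jcproj (aclass phi) (aclass phi)) =
      jcproj (aclass (g phi)) (aclass (g phi))].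
Proof.
move=> gb gl oJ; have gJ f := jac_aut f gb gl oJ.
have [d [gd dg dal]] := rmorph_inverse gb gl.
have [p pE] := jproj_rmorphism (aclass phi).
have [q qE] := jproj_rmorphism (aclass (g phi)).
pose rp x := projT1 (cid (@jproj_repr K Q (aclass phi) x)).
pose rq x := projT1 (cid (@jproj_repr K Q (aclass (g phi)) x)).
have rpE x : p (rp x) = x by rewrite /rp; case: cid => f /= ->; rewrite pE.
have rqE x : q (rq x) = x by rewrite /rq; case: cid => f /= ->; rewrite qE.
have pq f f' : p f = p f' <-> q (g f) = q (g f').
  by rewrite !pE !qE !jproj_jac -rmorphB gJ.
have gE f : q (g (rp (p f))) = q (g f) by apply/pq; exact: rpE.
have [|||gamma gammaE] := @mk_rmorphism _ _ (fun x => q (g (rp x))).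
- by move=> x y; rewrite -{1}[x]rpE -{1}[y]rpE -rmorphB gE !rmorphB.
- by rewrite -(rmorph1 p) gE !rmorph1.
- by move=> x y; rewrite -{1}[x]rpE -{1}[y]rpE -rmorphM gE !rmorphM.
have gammaP f : gamma (p f) = q (g f) by rewrite gammaE.
have rc (x : jacobi_cyc (aclass phi)) : exists f, jcproj (aclass phi) (aclass f) = x.
  have [f fE] := @pot_repr K Q (repr x); exists f.
  by rewrite -fE /jcproj reprK.
pose gammac x := jcproj (aclass (g phi)) (aclass (g (projT1 (cid (rc x))))).
have gammacE f : gammac (jcproj (aclass phi) (aclass f)) =
    jcproj (aclass (g phi)) (aclass (g f)).
  rewrite /gammac; case: cid => f' /= /jcproj_eq[e Je h].
  apply/jcproj_eq; exists (g e); first exact/gJ.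
  rewrite -!rmorphB; have [h1 hp _ ->] := aut_aend gl; exact: sub_cc.
exists gamma, gammac; split.
- split=> [|c]; last by rewrite /jl -pE -qE gammaP gl.
  exists (fun y => p (d (rq y))) => [x|y].
    rewrite -[x]rpE gammaP; apply/pq; rewrite dg; exact: rqE.
  by rewrite gammaP dg.
- move=> f f'; rewrite -pE -qE gammaP gammacE !qE => /jproj_jac h.
  by apply/jcproj_eq; exists (g f - f'); rewrite ?subrr ?rpred0.
- exact: gammacE.
Qed.

(** * Lifting homomorphisms of Jacobi algebras *)

Section Lift.
Variables (phi psi : aser).
Variable gamma : {rmorphism jacobi (aclass phi) -> jacobi (aclass psi)}.
Hypothesis gamma_l : forall c, gamma (jl (aclass phi) c) = jl (aclass psi) c.
Hypothesis J1 : forall f, jac psi f -> ordge 1 (aval f).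
Hypothesis oJ : opn (jac psi).

(** As [gamma] is not known to be continuous, [f] is expanded letter by letter: both sides agree up
    to elements of arbitrarily high order, and openness of the ideal concludes. *)
Lemma jacobi_lift : exists g : {rmorphism aser -> aser},
  (forall c, g (al c) = al c) /\
  forall f, gamma (jproj (aclass phi) f) = jproj (aclass psi) (g f).
Proof.
have [p pE] := jproj_rmorphism (aclass phi).
have [q qE] := jproj_rmorphism (aclass psi).
have gl c : gamma (p (al c)) = q (al c) by rewrite pE qE; exact: gamma_l.
have /fin_all_exists[h0 h0E] a : exists h0, gamma (p (aarr a)) = q h0.
  by have [f ->] := jproj_repr (gamma (p (aarr a))); exists f; rewrite qE.
pose e i : aser := al (fun j => (j == i)%:R).
pose h a := e (src a) * h0 a * e (tgt a).
have avh a : aval (h a) = cut a (aval (h0 a)) by [].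
have hE a : gamma (p (aarr a)) = q (h a).
  rewrite /h !rmorphM -h0E -!gl -!rmorphM; congr (gamma (p _)).
  by apply: aval_inj; rewrite [RHS](cut_par (@par_arr K Q a)).
clearbody h.
(* Were [z] nonzero, [1 - z^-1 h a] would be right invertible modulo the ideal, like [1 - z^-1 a]
   upstairs, although its constant term at [i] vanishes; elements of the ideal have no constant
   terms. *)
have h1 a : ordge 1 (aval (h a)).
  apply/ordge1P => i; apply/eqP/negPn/negP => ni; set z := const _ i in ni.
  pose c : aser := al (fun=> z^-1); have [|v hv] := @quasi_regular K Q (c * aarr a).
    by rewrite avalM; apply: ordgeMl; exact: ordge_arr.
  have [v' v'E] := jproj_repr (gamma (p v)).
  have E : q ((1 - c * h a) * v') = q 1.
    rewrite rmorphM rmorphB rmorphM !rmorph1 -hE -gl qE -v'E.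
    by rewrite -(rmorph1 gamma) -(rmorph1 p) -!(rmorphM, rmorphB) hv.
  have /ordge1P/(_ i) : ordge 1 (aval ((1 - c * h a) * v' - 1)).
    by apply/J1/jproj_jac; rewrite -!qE.
  have -> : const (aval ((1 - c * h a) * v' - 1)) i =
      (1 - z^-1 * z) * const (aval v') i - 1.
    rewrite {1}/const avalB fserDE fserNE; congr (_ - _).
    rewrite avalM; apply: etrans (constM _ _ _) _; congr (_ * _).
    rewrite /const avalB fserDE fserNE; congr (_ - _).
    rewrite avalM; exact: constM.
  by rewrite mulVf // subrr mul0r sub0r => /eqP; rewrite oppr_eq0 oner_eq0.
have [||| g ge] := @sub_aend K Q (fun a => aval (h a)).
- exact: h1.
- by move=> a; rewrite avh; exact: par_cut.
- by move=> a; exact: avalP.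
have [_ hpar _ gE] := ge.
have gal := aend_al ge; exists g; split => // f.
have garr a : g (aarr a) = h a by apply: aval_inj; rewrite gE /=; exact: sub_arr.
have H n : forall f, exists2 r, ordge n (aval r) & gamma (p f) = q (g f) + q r.
  elim: n => [|n IH] {}f.
    have [f' f'E] := jproj_repr (gamma (p f)); exists (f' - g f) => //.
    by rewrite -rmorphD addrC subrK qE.
  have /fin_all_exists[r rP] a : exists r, ordge n (aval r) /\
      gamma (p (alder a f)) = q (g (alder a f)) + q r.
    by have [r r1 r2] := IH (alder a f); exists r.
  exists (\sum_a h a * r a).
    rewrite aval_sum; apply: ordge_sum => a _; rewrite avalM -add1n.
    by apply: ordgeM; [exact: h1|case: (rP a)].
  rewrite {1 2}(aser_decomp f) !rmorphD gl gal -addrA; congr (_ + _).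
  rewrite !rmorph_sum -big_split; apply: eq_bigr => a _ /=.
  by have [_ E] := rP a; rewrite !rmorphM garr hE E mulrDr.
have [f' f'E] := jproj_repr (gamma (jproj _ f)); rewrite f'E; apply/jproj_jac.
apply: (cl_opn (jac_tideal _) oJ) => n; have [r rn E] := H n f.
exists (f' - g f - r); last by rewrite opprB addrC subrK.
rewrite -jproj_jac0 -qE !rmorphB /= [X in X - _ - _]qE -f'E -pE E.
by rewrite [X in X - _]addrC addKr addrN.
Qed.

End Lift.

(** Both [gamma] and its inverse are lifted. The composites are the identity modulo ideals of order
    two, so the linear parts of the two lifts are inverse matrices. *)
Lemma jacobi_iso_lift phi psi
    (gamma : {rmorphism jacobi (aclass phi) -> jacobi (aclass psi)}) :
  (forall a, ordge 2 (aval (afder a phi))) ->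
  (forall a, ordge 2 (aval (afder a psi))) ->
  opn (jac phi) -> opn (jac psi) ->
  l_algebra_iso (jl (aclass phi)) (jl (aclass psi)) gamma ->
  exists g : {rmorphism aser -> aser}, [/\ bijective g, forall c, g (al c) = al c &
    forall f, gamma (jproj (aclass phi) f) = jproj (aclass psi) (g f)].
Proof.
move=> dphi dpsi ophi opsi [[del gd dg] gl].
have [|||delta deltaE] := @mk_rmorphism _ _ del.
- by move=> x y; apply: (can_inj gd); rewrite rmorphB !dg.
- by apply: (can_inj gd); rewrite rmorph1 dg.
- by move=> x y; apply: (can_inj gd); rewrite rmorphM !dg.
have J1 chi : (forall a, ordge 2 (aval (afder a chi))) ->
    forall f, jac chi f -> ordge 1 (aval f).
  by move=> h f /(jac_ordge h); exact: ordge_le.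
have [g [gal gE]] := jacobi_lift gl (J1 _ dpsi) opsi.
have [|k [kal kE]] := jacobi_lift (gamma := delta) _ (J1 _ dphi) ophi.
  by move=> c; rewrite deltaE -gl gd.
have [g1 gp _ gs] := aut_aend gal; have [k1 kp _ ks] := aut_aend kal.
have key (u v : {rmorphism aser -> aser}) (ua : forall c, u (al c) = al c)
    (va : forall c, v (al c) = al c) chi :
    (forall a, ordge 2 (aval (afder a chi))) ->
    (forall a, jac chi (u (v (aarr a)) - aarr a)) ->
    forall a c, \sum_b lin (aval (v (aarr a))) b * lin (aval (u (aarr b))) c = (a == c)%:R.
  move=> dchi uv a c; have [u1 up _ us] := aut_aend ua.
  rewrite -(lin_sub _ _ u1 up) -us [RHS](_ : _ = lin (aval (aarr a)) c); last first.
    by rewrite lin_arr eq_sym.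
  apply/eqP; rewrite -subr_eq0; apply/eqP.
  exact: (jac_ordge dchi (uv a) (p := apath c)).
exists g; split=> //; apply: (@bijective_linear _ _ g (fun b c => lin (aval (k (aarr b))) c) gal).
- apply: (key k g kal gal phi dphi) => a; apply/jproj_jac.
  by rewrite -kE -gE deltaE gd.
- apply: (key g k gal kal psi dpsi) => a; apply/jproj_jac.
  by rewrite -gE -kE deltaE dg.
Qed.

End Quotients.

Theorem theorem4p5 (R : realType) (Q : quiver) (Phi Psi : potential R[i] Q)
    (Phi_fin : jacobi_finite Phi) (Psi_fin : jacobi_finite Psi)
    (Phi_ord : order_ge 3 Phi) (Psi_ord : order_ge 3 Psi) :
  (exists (gamma : {rmorphism jacobi Phi -> jacobi Psi})
          (gammac : jacobi_cyc Phi -> jacobi_cyc Psi),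
     [/\ l_algebra_iso (jl Phi) (jl Psi) gamma,
         induced_cyc gamma gammac &
         gammac (jcproj Phi Phi) = jcproj Psi Psi])
  <-> right_equivalent Phi Psi.
Proof.
have [phi ephi] := pot_repr Phi; have [psi epsi] := pot_repr Psi; subst Phi Psi.
have ophi := jacobi_finite_opn Phi_fin; have opsi := jacobi_finite_opn Psi_fin.
split=> [[gamma [gammac [iso ind gphi]]]|[g [gp [[gb gl] ind e]]]]; last first.
  move: e; rewrite ind => <-; exact: aut_jacobi_iso.
have dphi a := order_afder a Phi_ord; have dpsi a := order_afder a Psi_ord.
have [g [gb gl gE]] := jacobi_iso_lift dphi dpsi ophi opsi iso.
have [[del gd _] _] := iso.
(* [g phi] and [psi] have the same Jacobi ideal, and [gphi] says that their classes differ by the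
   class of an element of it. *)
apply: right_equivalent_trans (_ : right_equivalent _ (aclass (g phi))) _.
  by apply: (right_equivalent_of gb gl); rewrite subrr rpred0.
apply/right_equivalent_sym/same_jac_equivalent => //.
- by move=> f /(jac_ordge dpsi); exact: ordge_le.
- have [d [_ dg _]] := rmorph_inverse gb gl.
  move=> f; rewrite -[f]dg (jac_aut _ gb gl ophi) -!jproj_jac0 -gE.
  by split=> [->|h]; [exact: rmorph0|apply: (can_inj gd); rewrite h rmorph0].
- by apply/jcproj_eq; rewrite -(ind _ _ (gE phi)).
Qed.
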